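(* Fix a real number $\vartheta$ with $0<\vartheta<1$ and a constant $A>0$. Then there exist $x_0$ and $C>0$ such that for all real $x\ge x_0$ and all real $z>0$ with $|\log z|\le A\log\log x$, \[ \left|B(x,z)-z\,S_\vartheta(x)\right|\le C\,z\,S_\vartheta(x)\sqrt{\frac{\log\log x}{\log x}}. \]
   Context: For a natural number $m$, let $k(m)$ denote the largest square-free divisor of $m$. For fixed $\vartheta\in(0,1)$ and real $x\ge1$, let $S_\vartheta(x)$ be the number of natural numbers $m\le x$ with $k(m)\le m^{\vartheta}$, and for $z>0$ let $B(x,z)$ be the number of natural numbers $n\le x$ with $k(n)\le z\,n^{\vartheta}$. *)

(* Defs.v *)
From Stdlib Require Import Reals ZArith.
From mathcomp Require Import all_boot.

Set Implicit Arguments.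
Unset Strict Implicit.
Unset Printing Implicit Defensive.

Definition squarefree (d : nat) : bool :=
  [forall i : 'I_d.+1, (1 < i)%N ==> ~~ (i * i %| d)%N].

Definition k (m : nat) : nat :=
  \max_(d < m.+1 | (d %| m)%N && squarefree d) d.

Definition count_upto (x : R) (P : nat -> bool) : nat :=
  count P (iota 1 (Z.to_nat (Int_part x))).

Definition Rleb (a b : R) : bool := if Rle_dec a b then true else false.

Definition S (theta x : R) : nat :=
  count_upto x (fun m => Rleb (INR (k m)) (Rpower (INR m) theta)).

Definition B (theta x z : R) : nat :=
  count_upto x (fun n => Rleb (INR (k n)) (z * Rpower (INR n) theta)).

(* Main.v *)
Require Import Defs.
From mathcomp Require Import all_boot all_order all_algebra.
From mathcomp Require Import classical_sets reals sequences exp.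
From mathcomp Require Import ring lra zify.
Set Implicit Arguments.
Unset Strict Implicit.
Unset Printing Implicit Defensive.
Import Order.TTheory GRing.Theory Num.Theory.
Local Open Scope ring_scope.

(* Write n = d * m with m = k n.  Summing over d, the count B(x, z) becomes a sum over d of numbers
   of squarefree multiples of k d below z x^theta K(ln d - v), where v = (1 - theta) ln x - ln z and
   K t = exp (- max t (- beta t)), beta = theta / (1 - theta).  A sieve replaces it by
   c z x^theta f(v), with f(v) = sum_d a(d) K(ln d - v) and a(d) = prod_(p | d) al p, where
   al p is close to 1 / p.  Since S = B(x, 1), everything reduces to showing that f(V - t) / f(V) is
   1 + O(sqrt (ln V / V)) for |t| <= A ln V.

   Classifying d by its exact power of a prime p gives f = f_p + al p T_p f_p + T_p (f - f_p), where
   f_p only sees the d prime to p and T_p shifts by ln p; hence f - T_p f = f_p - (1 - al p) T_p f_p.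
   Almost all of the mass of f at V sits on d with omega d <= O(sqrt (V / ln V)), so that d has
   blocks q^e with e ln q at least h ~ sqrt (V ln V).  Removing parts of these blocks shows that f is
   comparable with its average over a window of length h, hence f_p = O(p ln p / h) f.  By strong
   induction on m, comparing T_p f_p with T_(p-1) f_p, one gets
   |ln f(v - ln m) - ln f(v)| = O(ln m / h) for m up to a multiple of sqrt (V / ln V), and any shift t
   is within O(sqrt (ln V / V)) of a difference of such logarithms plus a multiple of ln 2. *)

(** * Sums over primes *)

(** For fixed d the two constraints n <= x and k n <= z n^theta amount to a single upper bound on k
    n; the kernel K records which of them binds. No asymptotic formula for f is derived: B and S are
    evaluated with the same weights and the same sieve constant, so only a ratio of values of f
    matters, and the only inputs on primes are Chebyshev's upper bound and a lower bound for the sum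
    of 1/p drawn from the harmonic series. The obstacle is that soft arguments control f only up to
    constant factors, whereas the ratio is needed up to 1 + o(1). The gain comes from the identity
    for f - T_p f: its right-hand side contains only f_p, which is smaller than f by a factor p ln p
    / h, so a crude relative estimate of f_p becomes a precise one for f. The recursion contracts as
    long as p ln p is a small multiple of h, that is for p up to the order of sqrt (V / ln V). This
    limits the integers m, and 1/m is the precision with which ratios of such integers approximate a
    shift; it matches the error sqrt (ln V / V). *)

Lemma prime_Ndvd_fact n p : prime p -> (n < p)%N -> ~~ (p %| n`!)%N.
Proof.
move=> pp; elim: n => [|n IH] lt.
  by rewrite fact0 dvdn1 gtn_eqF ?prime_gt1.
rewrite factS Euclid_dvdM // negb_or IH ?(ltnW lt)// andbT.
by apply/negP => /dvdn_leq; lia.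
Qed.

Lemma prod_primes_dvd (s : seq nat) n : uniq s -> all prime s ->
  all (fun p => p %| n)%N s -> (\prod_(p <- s) p %| n)%N.
Proof.
elim: s => [|p s IH]; first by rewrite big_nil dvd1n.
rewrite /= big_cons => /andP[ps us] /andP[pp aps] /andP[pn an].
rewrite Gauss_dvd ?pn ?IH//.
rewrite big_seq; apply: (big_ind (fun x => coprime p x)).
- exact: coprimen1.
- by move=> x y cx cy; rewrite coprimeMr cx.
- move=> q qs; rewrite prime_coprime// dvdn_prime2//; last by have/allP := aps; apply.
  by apply: contra ps => /eqP ->.
Qed.

Lemma bin_le_exp2 m j : ('C(m, j) <= 2 ^ m)%N.
Proof.
elim: m j => [|m IH] [|j] //; first by rewrite bin0 expn_gt0.
by rewrite binS expnS mul2n -addnn leq_add.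
Qed.

Definition block i := [seq p <- index_iota (2 ^ i).+1 (2 ^ i.+1).+1 | prime p].

Lemma mem_block i p : p \in block i -> [/\ prime p, (2 ^ i < p)%N & (p <= 2 ^ i.+1)%N].
Proof. by rewrite mem_filter mem_index_iota => /andP[-> /andP[-> ?]]. Qed.

(** Chebyshev's argument: every prime of the block divides the central binomial coefficient
    ['C(2 ^ i.+1, 2 ^ i)], which is at most [2 ^ (2 ^ i.+1)], while their product is at least
    [(2 ^ i) ^ size (block i)]. *)
Lemma size_block i : (size (block i) * i <= 2 ^ i.+1)%N.
Proof.
have pos : (0 < 2 ^ i)%N by rewrite expn_gt0.
have e2 : (2 ^ i.+1 = 2 ^ i + 2 ^ i)%N by rewrite expnS mul2n addnn.
rewrite -(leq_exp2l (m := 2)) // mulnC expnM.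
apply: (@leq_trans (\prod_(p <- block i) p)).
  rewrite -[X in (X <= _)%N](_ : (\prod_(p <- block i) 2 ^ i)%N = _); last first.
    by rewrite big_const_seq count_predT iter_muln muln1.
  rewrite big_seq [X in (_ <= X)%N]big_seq.
  by apply: leq_prod => p /mem_block[_ /ltnW].
apply: leq_trans (bin_le_exp2 (2 ^ i.+1) (2 ^ i)).
apply: dvdn_leq; first by rewrite bin_gt0 e2 leq_addr.
apply: prod_primes_dvd.
- by rewrite filter_uniq// iota_uniq.
- exact: filter_all.
apply/allP => p /mem_block[pp lt le].
have := bin_fact (leq_addr (2 ^ i) (2 ^ i)); rewrite addnK -e2 => bf.
have : (p %| (2 ^ i.+1)`!)%N by apply: dvdn_fact; rewrite prime_gt0.
by rewrite -bf !Euclid_dvdM // (negPf (prime_Ndvd_fact pp lt)) !orbF.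
Qed.

Section PrimeSums.
Variable R : realType.
Implicit Types G : nat -> R.

Lemma sum_blocks G i0 I : (i0 <= I)%N ->
  \sum_((2 ^ i0).+1 <= p < (2 ^ I).+1 | prime p) G p
  = \sum_(i0 <= i < I) \sum_(p <- block i) G p.
Proof.
elim: I => [|I IH]; first by rewrite leqn0 => /eqP->; rewrite !big_geq.
rewrite leq_eqVlt => /orP[/eqP<-|]; first by rewrite !big_geq.
rewrite ltnS => le; rewrite big_nat_recr//= -IH//.
rewrite (@big_cat_nat _ _ _ (2 ^ I).+1)//=; last 2 first.
- by rewrite ltnS leq_exp2l.
- by rewrite ltnS leq_exp2l// ltnW.
by rewrite /block big_filter.
Qed.

Lemma sum_block_le i (c : R) G : (0 < i)%N -> 0 <= c ->
  (forall p, (2 ^ i < p)%N -> G p <= c / (2 ^ i)%:R) ->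
  \sum_(p <- block i) G p <= 2 * c / i%:R.
Proof.
move=> i0 c0 HG.
have i0R : 0 < i%:R :> R by rewrite ltr0n.
have p0 : 0 < (2 ^ i)%:R :> R by rewrite ltr0n expn_gt0.
apply: (@le_trans _ _ (\sum_(p <- block i) (c / (2 ^ i)%:R))).
  rewrite big_seq [leRHS]big_seq; apply: ler_sum => p /mem_block[_ lt _].
  exact: HG.
rewrite big_const_seq count_predT iter_addr addr0 -[_ *+ _]mulr_natr.
have -> : c / (2 ^ i)%:R * (size (block i))%:R
    = c * ((size (block i))%:R * i%:R / (2 ^ i)%:R) / i%:R by field; lra.
rewrite ler_pM2r ?invr_gt0// [2 * c]mulrC ler_wpM2l// ler_pdivrMr//.
rewrite -!natrM ler_nat; have := size_block i; rewrite expnS; lia.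
Qed.

Lemma ln2_gt0 : 0 < ln (2 : R). Proof. by apply: ln_gt0; lra. Qed.

Lemma ln2_ge : 2^-1 <= ln (2 : R).
Proof.
have e2 : 0 < (2 : R) by lra.
have : ln (2^-1) <= - 2^-1 :> R.
  have -> : (2^-1 : R) = 1 + (- 2^-1) by lra.
  by apply: le_trans (le_ln1Dx _) _; lra.
by rewrite lnV ?posrE//; lra.
Qed.

Lemma sum_inv_sq_le i0 I : (2 <= i0)%N ->
  \sum_(i0 <= i < I) (i%:R * i%:R)^-1 <= (i0.-1%:R)^-1 :> R.
Proof.
move=> h0; case: (leqP i0 I) => [le|/ltnW lt]; last by rewrite big_geq// invr_ge0.
apply: (@le_trans _ _ (i0.-1%:R^-1 - I.-1%:R^-1)); last first.
  by rewrite gerBl invr_ge0.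
elim: I le => [|I IH].
  by rewrite leqn0 => /eqP->; rewrite big_geq// subrr.
rewrite leq_eqVlt => /orP[/eqP<-|]; first by rewrite big_geq// subrr.
rewrite ltnS => le; rewrite big_nat_recr//=.
apply: le_trans (lerD (IH le) (lexx _)) _.
have I2 : 1 <= I.-1%:R :> R by rewrite ler1n; lia.
have -> : I%:R = I.-1%:R + 1 :> R by rewrite natr1; congr (_%:R); lia.
set x := I.-1%:R in I2 *.
have -> : x^-1 = (x + 1)^-1 + (x * (x + 1))^-1 by field; lra.
have : ((x + 1) * (x + 1))^-1 <= (x * (x + 1))^-1.
  rewrite lef_pV2 ?posrE; nra.
lra.
Qed.

(** Block [i] has at most [2 ^ i.+1 / i] primes, each of weight at most [2 / (i * 2 ^ i)], hence a
    total of at most 4 / i^2. Summing from [i0], the integer part of the binary logarithm of [y],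
    gives O(1 / ln y). *)
Lemma sum_prime_inv_ln (y : R) n : 4 <= y ->
  \sum_(0 <= p < n | prime p && (y < p%:R)) (p%:R * ln p%:R)^-1 <= 24 / ln y.
Proof.
move=> y4.
have y0 : 0 <= y by lra.
pose m := Num.truncn y.
have /andP[m1 m2] := truncn_itv y0.
rewrite -/m in m1 m2.
have m4 : (4 <= m)%N by rewrite /m truncn_ge_nat//; lra.
pose i0 := trunc_log 2 m.
have /andP[i1 i2] := trunc_log_bounds (isT : (1 < 2)%N) (leq_trans (isT : (0 < 4)%N) m4).
rewrite -/i0 in i1 i2.
have i02 : (2 <= i0)%N.
  rewrite leqNgt; apply/negP => lt.
  have := leq_pexp2l (isT : (0 < 2)%N) (lt : (i0.+1 <= 2)%N).
  by move: (2 ^ i0.+1)%N i2 => ?; lia.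
have Gge p : 0 <= (p%:R * ln p%:R)^-1 :> R.
  by rewrite invr_ge0 mulr_ge0// ; case: p => [|p]; [rewrite ln0|rewrite ln_ge0// ler1n].
have lny : ln y <= (i0.+1)%:R * ln 2.
  rewrite mulr_natl -lnXn; last lra.
  rewrite ler_ln ?posrE; [|lra|by apply: exprn_gt0; lra].
  apply: ltW; apply: (lt_le_trans m2).
  by rewrite -natrX ler_nat.
have lny0 : 0 < ln y by apply: ln_gt0; lra.
apply: (@le_trans _ _ (\sum_((2 ^ i0).+1 <= p < (2 ^ (i0 + n)).+1 | prime p)
   (p%:R * ln p%:R)^-1)).
  have -> : \sum_(0 <= p < n | prime p && (y < p%:R)) (p%:R * ln p%:R)^-1
    = \sum_(0 <= p < n | (prime p && (y < p%:R)) && ((2 ^ i0).+1 <= p)%N) (p%:R * ln p%:R)^-1 :> R.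
    apply: eq_bigl => p; case: (prime p) => //=; case: (ltP y p%:R) => //= yp.
    apply/esym; apply: leq_ltn_trans i1 _.
    by rewrite -(ltr_nat R); apply: le_lt_trans m1 yp.
  apply: (@le_trans _ _ (\sum_(0 <= p < (2 ^ (i0 + n)).+1
       | (prime p && (y < p%:R)) && ((2 ^ i0).+1 <= p)%N) (p%:R * ln p%:R)^-1)).
    rewrite [leRHS](@big_cat_nat _ _ _ n)//=.
      by rewrite lerDl sumr_ge0.
    apply: leqW; apply: leq_trans (leq_addl i0 n) _.
    by apply: ltnW; apply: ltn_expl.
  rewrite (@big_cat_nat _ _ _ (2 ^ i0).+1)//=; last first.
    by rewrite ltnS leq_exp2l// leq_addr.
  rewrite big_nat_cond big_pred0 ?add0r; last first.
    by move=> p; apply/negP => /andP[]; lia.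
  rewrite big_mkcond [leRHS]big_mkcond.
  apply: ler_sum => p _; case: (prime p) => //=.
  by case: ifP.
rewrite sum_blocks ?leq_addr//.
apply: (@le_trans _ _ (\sum_(i0 <= i < i0 + n) (4 * (i%:R * i%:R)^-1))).
  rewrite big_nat_cond [leRHS]big_nat_cond; apply: ler_sum => i /andP[/andP[ii _] _].
  have i0' : (0 < i)%N by lia.
  have iR : 0 < i%:R :> R by rewrite ltr0n.
  have -> : 4 * (i%:R * i%:R)^-1 = 2 * (2 / i%:R) / i%:R :> R by field; lra.
  apply: sum_block_le => //; first by apply: divr_ge0; lra.
  move=> p pi.
  have q0 : 0 < (2 ^ i)%:R :> R by rewrite ltr0n expn_gt0.
  have qp : (2 ^ i)%:R <= p%:R :> R by rewrite ler_nat ltnW.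
  have -> : 2 / i%:R / (2 ^ i)%:R = ((2 ^ i)%:R * (i%:R / 2))^-1 :> R by field; lra.
  have lnp : i%:R / 2 <= ln (p%:R : R).
    apply: (@le_trans _ _ (ln ((2 : R) ^+ i))); last first.
      by rewrite ler_ln ?posrE -?natrX//; lra.
    by rewrite lnXn ?ltr0n// -[ln 2 *+ i]mulr_natl ler_wpM2l// ln2_ge.
  rewrite lef_pV2 ?posrE; [apply: ler_pM; lra | apply: mulr_gt0; lra | apply: mulr_gt0; lra].
rewrite -mulr_sumr.
have := sum_inv_sq_le (i0 + n) i02.
have i1R : 1 <= i0.-1%:R :> R by rewrite ler1n; lia.
have e1 : i0.+1%:R = i0.-1%:R + 2 :> R by rewrite -natrD; congr (_%:R); lia.
move=> h1; apply: (@le_trans _ _ (4 * (i0.-1%:R)^-1)); first by rewrite ler_pM2l//; lra.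
rewrite ler_pdivlMr// mulrAC ler_pdivrMr; last lra.
have : ln 2 <= 1 :> R.
  have -> : (2 : R) = 1 + 1 by lra.
  by apply: le_ln1Dx; lra.
move: lny; rewrite e1; set j := i0.-1%:R in i1R *.
have := ln2_gt0; nra.
Qed.

Lemma sum_inv_le_ln I : (0 < I)%N -> \sum_(1 <= i < I.+1) i%:R^-1 <= 1 + ln I%:R :> R.
Proof.
case: I => // I _; elim: I => [|I IH].
  by rewrite big_nat1 invr1 ln1 addr0.
rewrite big_nat_recr//=; apply: le_trans (lerD IH (lexx _)) _.
rewrite -addrA lerD2l.
have x0 : 0 < I.+1%:R :> R by rewrite ltr0n.
have e : I.+2%:R = I.+1%:R + 1 :> R by rewrite natr1.
have : ln (I.+1%:R / I.+2%:R) <= - I.+2%:R^-1 :> R.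
  have -> : I.+1%:R / I.+2%:R = 1 + (- I.+2%:R^-1) :> R by rewrite e; field; lra.
  apply: le_ln1Dx; rewrite ltrN2 invf_lt1; lra.
rewrite ln_div ?posrE ?ltr0n// => H.
move: (ln _) (ln _) (I.+2%:R^-1) H => a b c H; lra.
Qed.

Lemma ln_le_sum_inv n : (0 < n)%N -> ln n%:R <= \sum_(1 <= i < n) i%:R^-1 :> R.
Proof.
case: n => // n _; elim: n => [|n IH]; first by rewrite ln1 big_geq.
rewrite big_nat_recr//=; apply: le_trans (lerD IH (lexx _)).
have x0 : 0 < n.+1%:R :> R by rewrite ltr0n.
have e : n.+2%:R = n.+1%:R + 1 :> R by rewrite natr1.
have : ln (n.+2%:R / n.+1%:R) <= n.+1%:R^-1 :> R.
  have -> : n.+2%:R / n.+1%:R = 1 + n.+1%:R^-1 :> R by rewrite e; field; lra.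
  by apply: le_ln1Dx; apply: (@lt_trans _ _ 0); rewrite ?invr_gt0//; lra.
by rewrite ln_div ?posrE ?ltr0n// lerBlDl.
Qed.

(** Block [i] now contributes at most 2 / i. The factor 2 in front of the double logarithm is
    harmless: [fresh_sum] only compares the result, which is O(s), with a multiple of s^2. *)
Lemma sum_prime_inv_le n : (2 <= n)%N ->
  \sum_(0 <= p < n | prime p) p%:R^-1 <= 4 + 2 * ln (up_log 2 n)%:R :> R.
Proof.
move=> n2.
have I0 : (0 < up_log 2 n)%N by rewrite up_log_gt0//.
set I := up_log 2 n in I0 *.
have nI : (n <= 2 ^ I)%N by apply: up_logP.
apply: (@le_trans _ _ (\sum_(0 <= p < (2 ^ I).+1 | prime p) p%:R^-1)).
  rewrite [leRHS](@big_cat_nat _ _ _ n)//= ?(leqW nI)// lerDl.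
  by apply: sumr_ge0 => p _; rewrite invr_ge0.
rewrite (@big_cat_nat _ _ _ (2 ^ 1).+1)//=; last by rewrite ltnS leq_exp2l.
have -> : \sum_(0 <= p < (2 ^ 1).+1 | prime p) p%:R^-1 = 2^-1 :> R.
  by rewrite /index_iota /= 3!big_cons big_nil /= addr0.
rewrite sum_blocks//.
apply: (@le_trans _ _ (2^-1 + \sum_(1 <= i < I) 2 * i%:R^-1)).
  rewrite lerD2l big_nat_cond [leRHS]big_nat_cond.
  apply: ler_sum => i /andP[/andP[ii _] _].
  rewrite -[2 * _]/(2 / i%:R) -[2 in leRHS]mulr1.
  apply: sum_block_le => // p pi; rewrite div1r lef_pV2 ?posrE ?ltr0n ?expn_gt0//.
    by rewrite ler_nat ltnW.
  by apply: leq_ltn_trans pi.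
rewrite -mulr_sumr.
have : \sum_(1 <= i < I) i%:R^-1 <= 1 + ln I%:R :> R.
  apply: le_trans (sum_inv_le_ln I0).
  by rewrite big_nat_recr//= lerDl invr_ge0.
lra.
Qed.

End PrimeSums.

(** * Multiplicative weights and Rankin's bound *)

Section Mult.
Variable R : realType.
Implicit Types (al : nat -> R) (w : nat -> R).

Definition amul al d := \prod_(p <- primes d) al p.

(** Weight 0 at [p] deletes the multiples of [p] from a weighted sum, so [f (rem al p)] is the f_p
    of the overview. *)
Definition rem al p := fun q => if q == p then 0 else al q.

Lemma amul_ge0 al d : (forall p, 0 <= al p) -> 0 <= amul al d.
Proof. by move=> h; apply: prodr_ge0. Qed.

Lemma amul1 al : amul al 1 = 1.
Proof. by rewrite /amul big_nil. Qed.

Lemma eq_amul al al' d : (forall p, prime p -> (p %| d)%N -> al p = al' p) ->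
  amul al d = amul al' d.
Proof.
move=> h; rewrite /amul big_seq [RHS]big_seq; apply: eq_bigr => p.
by rewrite mem_primes => /and3P[pp _ pd]; apply: h.
Qed.

Lemma ler_amul al al' d : (forall p, prime p -> (p %| d)%N -> 0 <= al p <= al' p) ->
  amul al d <= amul al' d.
Proof.
move=> h; rewrite /amul big_seq [leRHS]big_seq; apply: ler_prod => p.
by rewrite mem_primes => /and3P[pp _ pd]; apply: h.
Qed.

Lemma amul_pM al p d : prime p -> (0 < d)%N ->
  amul al (p * d) = if (p %| d)%N then amul al d else al p * amul al d.
Proof.
move=> pp d0; rewrite /amul; case: ifP => pd.
  congr (\prod_(q <- _) _); apply/eq_primes => q.
  rewrite primesM ?(prime_gt0 pp)// (primes_prime pp) inE orb_idl// => /eqP->.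
  by rewrite mem_primes pp d0.
transitivity (\prod_(q <- p :: primes d) al q); last by rewrite big_cons.
apply/perm_big/uniq_perm; rewrite ?primes_uniq//=.
  by rewrite primes_uniq mem_primes pd !andbF.
by move=> q; rewrite primesM ?(prime_gt0 pp)// (primes_prime pp) !inE.
Qed.

Lemma amul_pXM al p i d : prime p -> (0 < d)%N -> (p %| d)%N ->
  amul al (p ^ i * d) = amul al d.
Proof.
move=> pp d0 pd; elim: i => [|i IH]; first by rewrite mul1n.
rewrite expnS -mulnA amul_pM ?dvdn_mull// ?IH//.
by rewrite muln_gt0 expn_gt0 prime_gt0.
Qed.

Lemma amul_coprime al m n : (0 < m)%N -> (0 < n)%N -> coprime m n ->
  amul al (m * n) = amul al m * amul al n.
Proof.
move=> m0 n0 cmn; rewrite /amul -big_cat; apply/perm_big/uniq_perm.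
- exact: primes_uniq.
- rewrite cat_uniq !primes_uniq andbT /=; apply/hasPn => p.
  rewrite !mem_primes => /and3P[pp _ pn]; apply/negP => /and3P[_ _ pm].
  have := dvdn_gcd p m n; rewrite pm pn (eqP cmn) /= dvdn1.
  by move/eqP => e; rewrite e in pp.
- by move=> p; rewrite primesM// mem_cat.
Qed.

Lemma amul_rem al p d : prime p -> (0 < d)%N ->
  amul (rem al p) d = if (p %| d)%N then 0 else amul al d.
Proof.
move=> pp d0; case: ifP => pd.
  rewrite /amul (big_rem p) /= ?mem_primes ?pp ?d0//.
  by rewrite /rem eqxx mul0r.
apply: eq_amul => q _ qd; rewrite /rem; case: eqP => // e.
by rewrite -e qd in pd.
Qed.

Lemma sum_multiples w p n : (0 < p)%N ->
  \sum_(1 <= d < p * n | (p %| d)%N) w d = \sum_(1 <= m < n) w (p * m)%N.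
Proof.
move=> p0; rewrite -big_filter -(big_map (muln p) xpredT).
apply/perm_big/uniq_perm.
- by rewrite filter_uniq// iota_uniq.
- rewrite map_inj_uniq ?iota_uniq// => x y /eqP.
  by rewrite eqn_pmul2l// => /eqP.
move=> d; rewrite mem_filter mem_index_iota; apply/idP/mapP.
  move=> /andP[/dvdnP[m ->] /andP[]]; rewrite mulnC muln_gt0 p0 /= => m0 lt.
  by exists m; rewrite ?mem_index_iota ?m0//=; rewrite ltn_pmul2l in lt.
move=> [m]; rewrite mem_index_iota => /andP[m0 lt] ->.
by rewrite dvdn_mulr// muln_gt0 p0 m0 ltn_pmul2l.
Qed.

Lemma sum_multiples_le w p n : (forall d, 0 <= w d) -> (0 < p)%N ->
  \sum_(1 <= d < n | (p %| d)%N) w d <= \sum_(1 <= m < n) w (p * m)%N.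
Proof.
move=> w0 p0; rewrite -sum_multiples//.
case: n => [|n]; first by rewrite muln0 !big_geq.
rewrite [leRHS](@big_cat_nat _ _ _ n.+1)//= ?lerDl ?sumr_ge0//.
by rewrite leq_pmull.
Qed.

Lemma ln_natM (m n : nat) : (0 < m)%N -> (0 < n)%N ->
  ln (m * n)%:R = ln m%:R + ln n%:R :> R.
Proof. by move=> m0 n0; rewrite natrM lnM// posrE ltr0n. Qed.

Lemma ln_nat_ge0 (n : nat) : 0 <= ln n%:R :> R.
Proof. by case: n => [|n]; [rewrite ln0|rewrite ln_ge0// ler1n]. Qed.

Lemma ln_prime_gt0 (p : nat) : prime p -> 0 < ln p%:R :> R.
Proof. by move=> pp; rewrite ln_gt0// ltr1n prime_gt1. Qed.

(** A finite Euler product, by induction on a bound [y] for the primes of nonzero weight. Admitting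
    a prime [y] adds the sum [S'] over its multiples; dividing these by [y] gives S' <= (S' + al y *
    S y) / r with r = y^sg, hence S' <= al y / (r - 1) * S y. *)
Lemma rankin al (sg : R) n : (forall p, 0 <= al p) -> 0 < sg ->
  \sum_(1 <= d < n) amul al d * expR (- (sg * ln d%:R))
  <= \prod_(0 <= p < n | prime p) (1 + al p / (expR (sg * ln p%:R) - 1)).
Proof.
move=> al0 sg0.
pose ay y := fun p => if (p < y)%N then al p else 0.
have ay0 y p : 0 <= ay y p by rewrite /ay; case: ifP.
pose e d := expR (- (sg * ln d%:R)).
have e0 d : 0 <= e d by apply: expR_ge0.
pose S y := \sum_(1 <= d < n) amul (ay y) d * e d.
have -> : \sum_(1 <= d < n) amul al d * e d = S n.
  rewrite /S big_nat [RHS]big_nat; apply: eq_bigr => d /andP[d0 dn].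
  congr (_ * _); apply: eq_amul => p _ pd; rewrite /ay.
  by rewrite (leq_ltn_trans (dvdn_leq d0 pd) dn).
suff : forall y, S y <= \prod_(0 <= p < y | prime p)
  (1 + al p / (expR (sg * ln p%:R) - 1)) by apply.
elim=> [|y IH].
  rewrite [leRHS]big_geq// /S; case: (leqP n 1) => n1; first by rewrite big_geq.
  rewrite big_ltn// big_nat big1 ?addr0 ?amul1 ?mul1r.
    by rewrite /e ln1 mulr0 oppr0 expR0.
  move=> d /andP[d2 _]; rewrite /amul.
  rewrite (big_rem (pdiv d)) /= ?mul0r// mem_primes pdiv_prime//.
  by rewrite pdiv_dvd/=; lia.
rewrite [leRHS]big_mkcond big_nat_recr//= -big_mkcond.
case: (boolP (prime y)) => py; last first.
  rewrite [X in _ <= _ * X]/= mulr1; apply: le_trans IH; rewrite le_eqVlt.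
  apply/orP; left; apply/eqP.
  apply: eq_bigr => d _; congr (_ * _); apply: eq_amul => p pp _.
  rewrite /ay ltnS [(p <= y)%N]leq_eqVlt; case: eqP => // epy.
  by rewrite epy (negPf py) in pp.
set r := expR (sg * ln y%:R).
have r1 : 1 < r by rewrite /r expR_gt1 mulr_gt0// ln_prime_gt0.
have y0 : (0 < y)%N by rewrite prime_gt0.
pose S' := \sum_(1 <= d < n | (y %| d)%N) amul (ay y.+1) d * e d.
have amE d : (0 < d)%N -> amul (ay y) d = if (y %| d)%N then 0 else amul (ay y.+1) d.
  move=> d0; rewrite -amul_rem//; apply: eq_amul => p _ _.
  rewrite /rem /ay ltnS [(p <= y)%N]leq_eqVlt; case: eqP => //= ->.
  by rewrite ltnn.
have SE : S y.+1 = S y + S'.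
  rewrite /S /S' [\sum_(1 <= d < n | (y %| d)%N) _]big_mkcond -big_split /=.
  rewrite big_nat [RHS]big_nat; apply: eq_bigr => d /andP[d0 _].
  by rewrite amE//; case: ifP => _; rewrite ?mul0r ?add0r ?addr0.
have S'0 : 0 <= S' by apply: sumr_ge0 => d _; rewrite mulr_ge0// amul_ge0.
have Sy0 : 0 <= S y by apply: sumr_ge0 => d _; rewrite mulr_ge0// amul_ge0.
have S'le : S' <= r^-1 * (S' + al y * S y).
  apply: le_trans (sum_multiples_le _ _ y0) _.
    by move=> d; rewrite mulr_ge0// amul_ge0.
  rewrite /S' /S [al y * _]mulr_sumr [\sum_(1 <= d < n | (y %| d)%N) _]big_mkcond.
  rewrite -big_split mulr_sumr /=.
  rewrite big_nat [leRHS]big_nat; apply: ler_sum => d /andP[d0 _].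
  have -> : e (y * d)%N = r^-1 * e d.
    by rewrite -expRN -expRD -opprD -mulrDr -ln_natM.
  have ayy : ay y.+1 y = al y by rewrite /ay ltnSn.
  rewrite amul_pM// amE// ayy mulrCA ler_pM2l ?invr_gt0; last lra.
  by case: ifP => _; rewrite ?mul0r ?mulr0 ?addr0 ?add0r// mulrA.
rewrite SE; apply: (@le_trans _ _ (S y * (1 + al y / (r - 1)))); last first.
  by rewrite ler_wpM2r// addr_ge0// divr_ge0//; lra.
rewrite mulrDr mulr1 lerD2l mulrA ler_pdivlMr; last lra.
have : r * S' <= S' + al y * S y.
  by rewrite -ler_pdivlMl//; lra.
rewrite [S y * _]mulrC; lra.
Qed.

Lemma count_spread (P : pred nat) n (c : R) : 0 <= c ->
  (forall i j, P i -> P j -> j%:R - i%:R <= c) ->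
  (count P (index_iota 0 n))%:R <= c + 1.
Proof.
move=> c0 hP; pose m := Num.truncn c.
have /andP[m1 m2] : m%:R <= c < m.+1%:R by apply: truncn_itv.
apply: (@le_trans _ _ m.+1%:R); last by rewrite -natr1 lerD2r.
rewrite ler_nat.
have [/hasP[i0 _ Pi0]|/hasPn no] := boolP (has P (index_iota 0 n)); last first.
  by rewrite (eq_in_count (a2 := pred0)) ?count_pred0// => i /no /negPf ->.
have exP : exists i, P i by exists i0.
case: (ex_minnP exP) => a Pa amin.
rewrite -size_filter; have <- := size_iota a m.+1.
apply: uniq_leq_size; first by rewrite filter_uniq// iota_uniq.
move=> i; rewrite mem_filter mem_iota => /andP[Pi _].
rewrite amin//= -(ltr_nat R) natrD.
by have := hP a i Pa Pi; lra.
Qed.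

Lemma prod_le_expR_sum (I : Type) (r : seq I) (P : pred I) (x : I -> R) :
  (forall i, P i -> 0 <= x i) ->
  \prod_(i <- r | P i) (1 + x i) <= expR (\sum_(i <- r | P i) x i).
Proof.
move=> x0; rewrite expR_sum; apply: ler_prod => i Pi.
by rewrite expR_ge1Dx addr_ge0 ?x0.
Qed.

Lemma sum_prime_pp1 n : \sum_(0 <= p < n | prime p) (p%:R * (p%:R - 1))^-1 <= 1 :> R.
Proof.
apply: (@le_trans _ _ (\sum_(2 <= p < n) (p%:R * (p%:R - 1))^-1)).
  have pos (p : nat) : (2 <= p)%N -> 0 <= (p%:R * (p%:R - 1))^-1 :> R.
    by move=> p2; rewrite invr_ge0 mulr_ge0// subr_ge0 ler1n; lia.
  rewrite big_mkcond; case: (leqP 2 n) => n2; last first.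
    rewrite [leRHS]big_geq ?(ltnW n2)// big_nat big1// => p /andP[_ pn].
    by case: ifP => // /prime_gt1; lia.
  rewrite (@big_cat_nat _ _ _ 2)//= [X in X + _]big_nat big1 ?add0r; last first.
    by move=> p /andP[_ p2]; case: ifP => // /prime_gt1; lia.
  rewrite big_nat [leRHS]big_nat; apply: ler_sum => p /andP[p2 _].
  by case: ifP => // _; apply: pos.
case: (leqP 2 n) => n2; last by rewrite big_geq// ltnW.
suff h : \sum_(2 <= p < n) (p%:R * (p%:R - 1))^-1 <= 1 - (n.-1%:R)^-1 :> R.
  by apply: (le_trans h); rewrite gerBl invr_ge0.
elim: n n2 => // n IH; rewrite leq_eqVlt => /orP[/eqP<-|]; first by rewrite big_geq// invr1 subrr.
rewrite ltnS => n2; rewrite big_nat_recr//=; apply: le_trans (lerD (IH n2) (lexx _)) _.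
have h1 : 1 <= n.-1%:R :> R by rewrite ler1n; lia.
have -> : n%:R = n.-1%:R + 1 :> R by rewrite natr1; congr (_%:R); lia.
move: h1; set x := n.-1%:R => h1; rewrite addrK.
have -> : (x + 1)^-1 = x^-1 - ((x + 1) * x)^-1 by field; lra.
by move: (_^-1) (_^-1) => a b; lra.
Qed.

Definition psum w n := \sum_(1 <= d < n) w d.
(** For nonnegative terms the supremum of the partial sums is the sum of the series, so bounds on
    [tot] reduce to bounds on finite sums; [summable] excludes the unbounded case, where [sup] is a
    default value. *)
Definition tot w := sup (range (psum w)).
Definition summable w := (forall d, 0 <= w d) /\ exists M : R, forall n, psum w n <= M.

Lemma psum_le_tot w n : summable w -> psum w n <= tot w.
Proof.
move=> [w0 [M HM]]; apply: ub_le_sup; last by exists n.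
by exists M => _ [m _ <-].
Qed.

Lemma tot_le w M : (forall n, psum w n <= M) -> tot w <= M.
Proof.
by move=> h; apply: ge_sup => [|_ [m _ <-]//]; exists (psum w 0); exists 0%N.
Qed.

Lemma psum_ge0 w n : (forall d, 0 <= w d) -> 0 <= psum w n.
Proof. by move=> h; apply: sumr_ge0. Qed.

Lemma ler_psum w m n : (forall d, 0 <= w d) -> (m <= n)%N -> psum w m <= psum w n.
Proof.
move=> h le; case: m le => [|m] le; first by rewrite /psum big_geq// sumr_ge0.
by rewrite /psum [leRHS](@big_cat_nat _ _ _ m.+1)//= lerDl sumr_ge0.
Qed.

Lemma tot_ge0 w : summable w -> 0 <= tot w.
Proof. by move=> sw; apply: le_trans (psum_le_tot 0 sw); case: sw => w0 _; exact: psum_ge0. Qed.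

Lemma psum_le w w' n : (forall d, (0 < d)%N -> w d <= w' d) -> psum w n <= psum w' n.
Proof.
move=> h; rewrite /psum big_nat [leRHS]big_nat; apply: ler_sum => d /andP[d0 _].
exact: h.
Qed.

Lemma le_tot w w' : summable w' -> (forall d, (0 < d)%N -> w d <= w' d) -> tot w <= tot w'.
Proof.
move=> sw h; apply: tot_le => n; apply: le_trans (psum_le_tot n sw).
exact: psum_le.
Qed.

Lemma eq_tot w w' : (forall d, (0 < d)%N -> w d = w' d) -> tot w = tot w'.
Proof.
move=> h; suff E : psum w = psum w' by rewrite /tot E.
apply: boolp.funext => n; rewrite /psum big_nat [RHS]big_nat; apply: eq_bigr => d /andP[d0 _].
exact: h.
Qed.

Lemma summable_le w w' : (forall d, 0 <= w d) -> summable w' ->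
  (forall d, (0 < d)%N -> w d <= w' d) -> summable w.
Proof.
move=> w0 [w'0 [M HM]] h; split=> //; exists M => n; apply: le_trans (HM n).
exact: psum_le.
Qed.

Lemma totD w w' : summable w -> summable w' ->
  tot (fun d => w d + w' d) = tot w + tot w'.
Proof.
move=> sw sw'; apply/eqP; rewrite eq_le; apply/andP; split.
  apply: tot_le => n; rewrite /psum big_split /=.
  by apply: lerD; apply: psum_le_tot.
have sww' : summable (fun d => w d + w' d).
  case: sw sw' => [h0 [M HM]] [h0' [M' HM']]; split=> [d|]; first exact: addr_ge0.
  by exists (M + M') => n; rewrite /psum big_split /=; apply: lerD; [exact: HM|exact: HM'].
rewrite -lerBrDr; apply: tot_le => m; rewrite lerBrDr addrC -lerBrDr.
apply: tot_le => n; rewrite lerBrDr.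
apply: le_trans (psum_le_tot (maxn m n) sww'); rewrite /psum big_split /= addrC.
case: sw sw' => [h0 _] [h0' _].
by apply: lerD; apply: ler_psum => //; rewrite ?leq_maxl ?leq_maxr.
Qed.

Lemma totZ w c : 0 <= c -> summable w -> tot (fun d => c * w d) = c * tot w.
Proof.
rewrite le_eqVlt => /orP[/eqP<- _|c0 sw].
  rewrite mul0r; apply/eqP; rewrite eq_le; apply/andP; split.
    by apply: tot_le => n; rewrite /psum big1// => d _; rewrite mul0r.
  apply: tot_ge0; split=> [d|]; first by rewrite mul0r.
  by exists 0 => n; rewrite /psum big1// => d _; rewrite mul0r.
have sc : summable (fun d => c * w d).
  case: sw => h0 [M HM]; split=> [d|]; first by rewrite mulr_ge0// ltW.
  by exists (c * M) => n; rewrite /psum -mulr_sumr ler_pM2l//; apply: HM.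
apply/eqP; rewrite eq_le; apply/andP; split.
  apply: tot_le => n; rewrite /psum -mulr_sumr ler_pM2l//; exact: psum_le_tot.
rewrite -ler_pdivlMl//; apply: tot_le => n; rewrite ler_pdivlMl//.
by apply: le_trans (psum_le_tot n sc); rewrite /psum -mulr_sumr.
Qed.

Lemma tot_multiples w p : summable w -> (0 < p)%N ->
  tot (fun d => if (p %| d)%N then w d else 0) = tot (fun m => w (p * m)%N).
Proof.
move=> [w0 [M HM]] p0.
have E n : psum (fun d => if (p %| d)%N then w d else 0) (p * n) =
    psum (fun m => w (p * m)%N) n.
  by rewrite /psum -sum_multiples// -big_mkcond.
have w0' d : 0 <= (if (p %| d)%N then w d else 0) by case: ifP.
have s1 : summable (fun d => if (p %| d)%N then w d else 0).
  by apply: (@summable_le _ w) => // [|d _]; [split=> //; exists M | case: ifP].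
have s2 : summable (fun m => w (p * m)%N).
  split=> //; exists M => n; rewrite -E; apply: le_trans (HM (p * n)%N).
  by apply: psum_le => d _; case: ifP.
apply/eqP; rewrite eq_le; apply/andP; split; apply: tot_le => n; last first.
  by rewrite -E; apply: psum_le_tot.
apply: le_trans (psum_le_tot n s2); rewrite -E.
by apply: ler_psum => //; rewrite leq_pmull.
Qed.

End Mult.

(** * The kernel sum *)

Section Kernel.
Variable R : realType.
Variable be : R.
Hypothesis be0 : 0 < be.
Implicit Types (al : nat -> R) (w : nat -> R).

(** The minimum of e^(-t) and e^(be t). With t = ln d - v, the first branch expresses n <= x and the
    second k n <= z n^theta. The constant [ga] below bounds the Lipschitz constant of ln K, which is
    the larger of 1 and [be]. *)
Definition K (t : R) := expR (- Num.max t (- be * t)).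
Definition ga : R := 1 + be.

Lemma ga_gt1 : 1 < ga. Proof. by have := be0; rewrite /ga; lra. Qed.

Lemma K_gt0 t : 0 < K t. Proof. exact: expR_gt0. Qed.

Lemma K_shift (t u : R) : K (t + u) <= expR (ga * `|u|) * K t.
Proof.
rewrite /K -expRD ler_expR /ga.
have h1 : u <= `|u| by apply: ler_norm.
have h2 : - u <= `|u| by rewrite -normrN ler_norm.
have h3 : 0 <= be * (`|u| - u) by rewrite mulr_ge0 ?subr_ge0// ltW.
have h4 : 0 <= be * (`|u| + u).
  by apply: mulr_ge0; [exact: ltW | lra].
have h5 : 0 <= be * `|u| by rewrite mulr_ge0// ltW.
move: (normr_ge0 u) h1 h2 h3 h4 h5; set z := `|u|.
rewrite !maxElt; case: ltP => a; case: ltP => b; lra.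
Qed.

Lemma K_le t (sg : R) : 0 <= sg <= 1 -> K t <= expR (- (sg * t)).
Proof.
move=> /andP[s0 s1]; have b0 := be0; rewrite /K ler_expR lerN2.
rewrite le_max; case: (lerP 0 t) => t0; apply/orP; [left|right]; nra.
Qed.

Lemma K_leL t : K t <= expR (be * t).
Proof. by rewrite /K ler_expR lerNl le_max; apply/orP; right; lra. Qed.

Lemma K0 : K 0 = 1.
Proof. by rewrite /K mulr0 maxxx oppr0 expR0. Qed.

Lemma K_ge t : expR (- (ga * `|t|)) <= K t.
Proof.
have := K_shift t (- t); rewrite subrr K0 normrN => h.
by rewrite expRN -[_^-1]mulr1 ler_pdivrMl ?expR_gt0.
Qed.

Definition adm al := forall p, 0 <= al p /\ (prime p -> al p <= p%:R^-1).
(** The factor 2 leaves room for the local sieve factor, which lies between 1 - 1/p and 1. *)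
Definition nondeg al (p : nat) := (2 * p%:R)^-1 <= al p.

Lemma adm_ge0 al : adm al -> forall p, 0 <= al p.
Proof. by move=> h p; case: (h p). Qed.

Lemma adm_rem al p : adm al -> adm (rem al p).
Proof.
move=> h q; rewrite /rem; case: eqP => _; last exact: h.
by split=> // _; rewrite invr_ge0.
Qed.

Lemma nondeg_rem al p q : q != p -> nondeg al q -> nondeg (rem al p) q.
Proof. by move=> qp h; rewrite /nondeg /rem (negPf qp). Qed.

Definition term al v (d : nat) := amul al d * K (ln d%:R - v).
Definition f al v := tot (term al v).

Lemma term_ge0 al v d : adm al -> 0 <= term al v d.
Proof. by move=> h; rewrite mulr_ge0 ?amul_ge0 ?(ltW (K_gt0 _))//; apply: adm_ge0. Qed.

Lemma psum_term_le al v (sg : R) n : adm al -> 0 < sg <= 1 ->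
  psum (term al v) n <= expR (sg * v) *
    \sum_(1 <= d < n) amul al d * expR (- (sg * ln d%:R)).
Proof.
move=> h /andP[s0 s1]; rewrite mulr_sumr; apply: ler_sum => d _.
rewrite mulrCA /term ler_wpM2l ?amul_ge0//; first exact: adm_ge0.
by rewrite -expRD; apply: le_trans (K_le _ (_ : 0 <= sg <= 1)) _;
  rewrite ?(ltW s0)// ler_expR; lra.
Qed.

Lemma summable_term al v : adm al -> summable (term al v).
Proof.
move=> h; split=> [d|]; first exact: term_ge0.
exists (expR v * expR 1) => n.
(* Rankin's bound with exponent 1: the Euler factors are at most 1 + 1 / (p (p - 1)), whose product
   converges. *)
apply: le_trans (psum_term_le v n h (_ : 0 < 1 <= 1)) _; first by rewrite ltr01 lexx.
rewrite mul1r ler_pM2l ?expR_gt0//.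
apply: le_trans (rankin n (adm_ge0 h) ltr01) _.
apply: (@le_trans _ _ (expR (\sum_(0 <= p < n | prime p) (p%:R * (p%:R - 1))^-1))); last first.
  by rewrite ler_expR sum_prime_pp1.
have pp p : prime p -> 1 < p%:R :> R by move=> pp; rewrite ltr1n prime_gt1.
apply: le_trans (@prod_le_expR_sum _ _ _ _ (fun p => (p%:R * (p%:R - 1))^-1) _); last first.
  by move=> p /pp p1; rewrite invr_ge0 mulr_ge0//; lra.
apply: ler_prod => p pr; have p1 := pp p pr.
rewrite mul1r lnK ?posrE; last lra.
have [a0 a1] := h p; rewrite addr_ge0 ?divr_ge0//=; last lra.
by rewrite lerD2l invfM ler_pM2r ?a1// invr_gt0; lra.
Qed.

Lemma f_ge0 al v : adm al -> 0 <= f al v.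
Proof. by move=> h; apply: tot_ge0; apply: summable_term. Qed.

Lemma term_le_f al v d : adm al -> (0 < d)%N -> term al v d <= f al v.
Proof.
move=> h d0; apply: le_trans (psum_le_tot d.+1 (summable_term v h)).
by rewrite /psum big_nat_recr//= lerDr psum_ge0// => e; apply: term_ge0.
Qed.

Lemma f_gt0 al v : adm al -> 0 < f al v.
Proof.
move=> h; apply: lt_le_trans (term_le_f v h (isT : (0 < 1)%N)).
by rewrite /term amul1 mul1r K_gt0.
Qed.

Lemma f_shift al v u : adm al -> f al (v + u) <= expR (ga * `|u|) * f al v.
Proof.
move=> h; rewrite /f -totZ ?expR_ge0//; last exact: summable_term.
apply: le_tot.
  split=> [d|]; first by rewrite mulr_ge0 ?expR_ge0// term_ge0.
  have [_ [M HM]] := summable_term v h.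
  by exists (expR (ga * `|u|) * M) => n; rewrite /psum -mulr_sumr ler_wpM2l ?expR_ge0//; apply: HM.
move=> d _; rewrite /term mulrCA ler_wpM2l ?amul_ge0//; first exact: adm_ge0.
by rewrite opprD addrA -[`|u|]normrN; apply: K_shift.
Qed.

Lemma f_shift_le al v v' c : adm al -> `|v - v'| <= c -> f al v <= expR (ga * c) * f al v'.
Proof.
move=> h hc; rewrite -[v](subrKC v').
apply: le_trans (f_shift _ _ h) _.
rewrite ler_wpM2r ?f_ge0// ler_expR ler_wpM2l//; have := ga_gt1; lra.
Qed.

Lemma f_mono al al' v : adm al' -> adm al -> (forall p, prime p -> al p <= al' p) ->
  f al v <= f al' v.
Proof.
move=> h' h le; apply: le_tot; first exact: summable_term.
move=> d _; rewrite ler_wpM2r ?(ltW (K_gt0 _))//.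
by apply: ler_amul => p pp _; rewrite adm_ge0// le.
Qed.

Lemma f_rem_le al p v : adm al -> f (rem al p) v <= f al v.
Proof.
move=> h; apply: f_mono => //; first exact: adm_rem.
by move=> q _; rewrite /rem; case: ifP => // _; apply: adm_ge0.
Qed.

(* Split the sum according to whether p divides d, and write d = p m. *)
Lemma f_split al p v : adm al -> prime p ->
  f al v = f (rem al p) v + al p * f (rem al p) (v - ln p%:R)
           + (f al (v - ln p%:R) - f (rem al p) (v - ln p%:R)).
Proof.
move=> h pp; have hr := adm_rem p h; have p0 := prime_gt0 pp.
set v' := v - _.
have E1 : f al v = f (rem al p) v + tot (fun m => term al v (p * m)%N).
  rewrite -tot_multiples//; last exact: summable_term.
  rewrite /f -totD; first last.
  - apply: (@summable_le _ _ (term al v)) => [d||d _]; last by case: ifP => _ //; apply: term_ge0.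
      by case: ifP => _ //; apply: term_ge0.
    exact: summable_term.
  - exact: summable_term.
  apply: eq_tot => d d0; rewrite {2}/term amul_rem//.
  by case: ifP => _; rewrite ?mul0r ?add0r ?addr0.
have E2 : tot (fun m => term al v (p * m)%N) + f (rem al p) v'
    = f al v' + al p * f (rem al p) v'.
  rewrite /f -[al p * _]totZ ?adm_ge0//; last exact: summable_term.
  have s1 : summable (fun m => term al v (p * m)%N).
    split=> [d|]; first exact: term_ge0.
    have [_ [M HM]] := summable_term v h.
    exists M => n; rewrite /psum -(sum_multiples _ _ p0); apply: le_trans (HM (p * n)%N).
    rewrite big_mkcond; apply: ler_sum => d _.
    by case: ifP => // _; apply: term_ge0.
  have s2 : summable (fun d => al p * term (rem al p) v' d).
    split=> [d|]; first by apply: mulr_ge0; [exact: adm_ge0 | exact: term_ge0].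
    have [_ [M HM]] := summable_term v' hr.
    by exists (al p * M) => n; rewrite /psum -mulr_sumr ler_wpM2l ?adm_ge0//; apply: HM.
  rewrite -!totD//; try exact: summable_term.
  apply: eq_tot => d d0; rewrite /term amul_pM// amul_rem// ln_natM//.
  have -> : ln p%:R + ln d%:R - v = ln d%:R - v' by rewrite /v'; lra.
  by case: ifP => _; rewrite ?mul0r ?mulr0 ?addr0// mulrA addrC.
rewrite E1; move: E2; move: (tot _) (f al v') (f (rem al p) v') (f _ v) => a b c d; lra.
Qed.

(** Iterate [f_split] and drop the last remainder f - f_p, which is nonnegative. *)
Lemma f_sub_rem_ge al p v J : adm al -> prime p ->
  al p * \sum_(1 <= j < J.+1) f (rem al p) (v - j%:R * ln p%:R)
  <= f al v - f (rem al p) v.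
Proof.
move=> h pp; elim: J v => [|J IH] v.
  by rewrite big_geq// mulr0 subr_ge0 f_rem_le.
rewrite big_nat_recl// mul1r (f_split v h pp).
have := IH (v - ln p%:R).
have -> : \sum_(1 <= j < J.+1) f (rem al p) (v - ln p%:R - j%:R * ln p%:R) =
   \sum_(1 <= i < J.+1) f (rem al p) (v - i.+1%:R * ln p%:R).
  by apply: eq_bigr => j _; congr (f _ _); rewrite -natr1; lra.
rewrite mulrDr.
move: (\sum_(_ <= _ < _) _) => S; move: (al p * S) (f al _) => a b.
lra.
Qed.

Lemma f_sub_shift al p v : adm al -> prime p ->
  f al v - f al (v - ln p%:R)
  = f (rem al p) v - (1 - al p) * f (rem al p) (v - ln p%:R).
Proof.
move=> h pp; rewrite (f_split v h pp) mulrBl mul1r.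
lra.
Qed.

(** 23 is 22 + 1, as al b >= 1 / (2 b) >= 1 / 22 for a prime b <= 11; the exponential pays for a
    shift of at most 11, more than ln b. *)
Definition CQ := 23 * expR (ga * 11).

Lemma CQ_ge1 : 1 <= CQ.
Proof.
have : 1 <= expR (ga * 11) by apply: ltW; rewrite expR_gt1; have := ga_gt1; lra.
by rewrite /CQ; lra.
Qed.

Definition small_nondeg al := exists b, [/\ prime b, (b <= 11)%N & nondeg al b].

(** The bound does not depend on [j] because the steps are made on g = f - f_b, which is exactly
    monotone along multiples of ln b; the constant is paid once, in f (w - ln b) <= 23 * g w. *)
Lemma f_step_back al b v j : adm al -> prime b -> (b <= 11)%N -> nondeg al b ->
  f al (v - j%:R * ln b%:R) <= 23 * f al v.
Proof.
move=> h pb b11 nb; have fv := f_ge0 v h.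
case: j => [|j]; first by rewrite mul0r subr0; lra.
pose g v := f al v - f (rem al b) v.
have g_ge (w : R) : 0 <= g w by rewrite subr_ge0 f_rem_le.
have gs (w : R) : g w = al b * f (rem al b) (w - ln b%:R) + g (w - ln b%:R).
  by rewrite {1}/g (f_split w h pb) /g; lra.
have hr := adm_rem b h.
have ab0 : 22^-1 <= al b.
  have b0 : 0 < b%:R :> R by rewrite ltr0n (prime_gt0 pb).
  have b11R : b%:R <= 11 :> R by rewrite ler_nat.
  by apply: le_trans nb; rewrite lef_pV2 ?posrE; lra.
have gmono i (w : R) : g (w - i%:R * ln b%:R) <= g w.
  elim: i w => [|i IH] w; first by rewrite mul0r subr0.
  apply: le_trans (IH w); rewrite [leRHS]gs.
  have -> : w - i.+1%:R * ln b%:R = w - i%:R * ln b%:R - ln b%:R by rewrite -natr1; lra.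
  by rewrite lerDr mulr_ge0 ?adm_ge0// f_ge0.
have fg (w : R) : f al (w - ln b%:R) <= 23 * g w.
  have := g_ge (w - ln b%:R); have := f_ge0 (w - ln b%:R) hr.
  rewrite (gs w) /g; move: (f (rem al b) _) (f al _) => x y x0 xy.
  nra.
have -> : v - j.+1%:R * ln b%:R = v - j%:R * ln b%:R - ln b%:R by rewrite -natr1; lra.
apply: (le_trans (fg _)); rewrite ler_pM2l//; apply: (le_trans (gmono _ _)).
by rewrite /g gerBl f_ge0.
Qed.

(** Round v - u down to a multiple of ln b: the remainder costs the Lipschitz factor of f, and all
    the steps together cost 23. *)
Lemma f_quasi_mono al u v : adm al -> small_nondeg al -> u <= v -> f al u <= CQ * f al v.
Proof.
move=> h [b [pb b11 nb]] uv.
have lb : 0 < ln b%:R :> R by apply: ln_prime_gt0.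
have lb11 : ln b%:R <= 11 :> R.
  apply: ltW; apply: (lt_le_trans (ln_sublinear _)); first by rewrite ltr0n prime_gt0.
  by rewrite ler_nat.
pose j := Num.truncn ((v - u) / ln b%:R).
have /andP[j1 j2] : j%:R <= (v - u) / ln b%:R < j.+1%:R.
  by apply: truncn_itv; rewrite divr_ge0 ?subr_ge0// ltW.
move: j1 j2; rewrite ler_pdivlMr// ltr_pdivrMr// -natr1 => j1 j2.
apply: (@le_trans _ _ (expR (ga * 11) * f al (v - j%:R * ln b%:R))).
  by apply: f_shift_le => //; rewrite ler_norml; apply/andP; split; lra.
rewrite /CQ [23 * _]mulrC -mulrA ler_pM2l ?expR_gt0//.
exact: f_step_back.
Qed.

Lemma f_lb al v : adm al -> small_nondeg al -> 0 <= v -> CQ^-1 <= f al v.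
Proof.
move=> h sn v0; have C1 := CQ_ge1.
rewrite -[CQ^-1]mulr1 ler_pdivrMl; last lra.
apply: le_trans (f_quasi_mono h sn v0).
apply: le_trans (term_le_f 0 h (isT : (0 < 1)%N)).
by rewrite /term amul1 mul1r ln1 subr0 K0.
Qed.

(** Each [i] is rounded down to a multiple of ln p, at the cost of [CQ] by quasi-monotonicity. A
    given multiple serves at most ln p + 1 values of [i], and the sum of f_p over the multiples is
    at most 2 p f by [f_sub_rem_ge], since al p >= 1 / (2 p). *)
Lemma sum_f_rem_le al p v n : adm al -> prime p -> small_nondeg (rem al p) -> nondeg al p ->
  \sum_(0 <= i < n) f (rem al p) (v - i%:R)
  <= 2 * CQ * (ln p%:R + 1) * p%:R * f al v.
Proof.
move=> h pp sn np; have hr := adm_rem p h; have C1 := CQ_ge1.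
have large_prime : 0 < ln p%:R :> R by apply: ln_prime_gt0.
have p0 : 0 < p%:R :> R by rewrite ltr0n prime_gt0.
have ap0 : 0 < al p by apply: lt_le_trans np; rewrite invr_gt0 mulr_gt0.
pose jj (i : nat) := Num.truncn (i%:R / ln p%:R : R).
have jP i : (jj i)%:R * ln p%:R <= (i%:R : R) < (jj i).+1%:R * ln p%:R.
  by rewrite -ler_pdivlMr// -ltr_pdivrMr//; apply: truncn_itv; rewrite divr_ge0// ltW.
pose G j := f (rem al p) (v - j%:R * ln p%:R).
have G0 j : 0 <= G j by apply: f_ge0.
pose J := jj n.
have jJ i : (i < n)%N -> (jj i < J.+1)%N.
  move=> lt; rewrite ltnS /J /jj; apply: le_truncn.
  by rewrite ler_pM2r ?invr_gt0// ler_nat ltnW.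
apply: (@le_trans _ _ (\sum_(0 <= i < n) CQ * G (jj i))).
  apply: ler_sum => i _; apply: f_quasi_mono => //.
  by have /andP[] := jP i; lra.
rewrite -mulr_sumr.
have cnt j : (count (fun i => jj i == j) (index_iota 0 n))%:R <= ln p%:R + 1 :> R.
  apply: count_spread => [|i i' /eqP e /eqP e']; first exact: ltW.
  have /andP[h2 _] := jP i; have /andP[_ h1] := jP i'.
  by move: h1 h2; rewrite e e' -[j.+1%:R]natr1 => h1 h2; clear -h1 h2; lra.
have E : \sum_(0 <= i < n) G (jj i) <= (ln p%:R + 1) * \sum_(0 <= j < J.+1) G j.
  have -> : \sum_(0 <= i < n) G (jj i) = \sum_(0 <= j < J.+1)
      \sum_(0 <= i < n | jj i == j) G j.
    under [RHS]eq_bigr do rewrite big_mkcond.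
    rewrite exchange_big /= big_nat [RHS]big_nat; apply: eq_bigr => i /andP[_ lt].
    rewrite (bigD1_seq (jj i)) ?mem_index_iota ?jJ ?iota_uniq//= ?eqxx.
    by rewrite big1 ?addr0// => j ne; rewrite eq_sym (negPf ne).
  rewrite mulr_sumr; apply: ler_sum => j _.
  rewrite big_const_seq iter_addr addr0 -[_ *+ _]mulr_natl ler_wpM2r//.
have S1 : \sum_(0 <= j < J.+1) G j <= 2 * p%:R * f al v.
  rewrite big_nat_recl//= {1}/G mul0r subr0.
  have := f_sub_rem_ge v J h pp.
  have -> : \sum_(1 <= j < J.+1) f (rem al p) (v - j%:R * ln p%:R) =
    \sum_(0 <= i < J) G i.+1 by rewrite big_add1.
  set S := \sum_(_ <= _ < _) _ => hS.
  have S0 : 0 <= S by apply: sumr_ge0.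
  have : S <= 2 * p%:R * (f al v - f (rem al p) v).
    rewrite -ler_pdivrMl ?mulr_gt0//; apply: le_trans hS; rewrite ler_wpM2r//.
  have : 1 <= p%:R :> R by rewrite ler1n prime_gt0.
  have := f_ge0 v hr; have := f_rem_le p v h.
  move: (f al v) (f _ v) => x y; nra.
have S2 : 0 <= \sum_(0 <= j < J.+1) G j by apply: sumr_ge0.
have -> : 2 * CQ * (ln p%:R + 1) * p%:R * f al v =
  CQ * ((ln p%:R + 1) * (2 * p%:R * f al v)) by ring.
rewrite ler_pM2l; last lra.
by apply: (le_trans E); rewrite ler_pM2l//; lra.
Qed.

End Kernel.

(** * Scales and atypical integers *)

Section Scales.
Variable R : realType.
Implicit Types (s : R).

(** The threshold is fixed before any variable quantified inside [P], so the estimates are uniform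
    in the weights, the points and the truncations. *)
Definition large (P : R -> Prop) := exists s0 : R, forall s, s0 <= s -> P s.

Lemma large_ge (C : R) : large (fun s => C <= s).
Proof. by exists C. Qed.

Lemma large_and P Q : large P -> large Q -> large (fun s => P s /\ Q s).
Proof.
move=> [a ha] [b hb]; exists (Num.max a b) => s; rewrite ge_max => /andP[h1 h2].
by split; [apply: ha|apply: hb].
Qed.

Lemma large_imp (P Q : R -> Prop) : (forall s, P s -> Q s) -> large P -> large Q.
Proof. by move=> h [a ha]; exists a => s /ha /h. Qed.

(* [V s] stands for (1 - theta) ln x, so that s = sqrt (ln V).  All scales are monomials in
   X = V^(1/16) and s, which makes their comparison polynomial; typical d have omega d = O(N s). *)
Definition X s : R := expR (s ^+ 2 / 16).
Definition V s : R := X s ^+ 16.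
Definition N s : R := X s ^+ 8 / s.
Definition H s : R := X s ^+ 8 * s.
Definition L s : R := X s ^+ 4.

Lemma X_gt0 s : 0 < X s. Proof. exact: expR_gt0. Qed.

Lemma X_ge1 s : 1 <= X s.
Proof.
apply: le_trans (expR_ge1Dx _); rewrite lerDl.
by rewrite divr_ge0// ?sqr_ge0.
Qed.

Lemma N_gt0 s : 0 < s -> 0 < N s.
Proof. by move=> s0; rewrite divr_gt0// exprn_gt0// X_gt0. Qed.

Lemma H_gt0 s : 0 < s -> 0 < H s.
Proof. by move=> s0; rewrite mulr_gt0// exprn_gt0// X_gt0. Qed.

Lemma V_gt0 s : 0 < V s.
Proof. by rewrite exprn_gt0// X_gt0. Qed.

Lemma V_HN s : 0 < s -> V s = H s * N s.
Proof. by move=> s0; rewrite /V /H /N; field; rewrite gt_eqF. Qed.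

Lemma lnX s : ln (X s) = s ^+ 2 / 16. Proof. exact: expRK. Qed.

Lemma lnV_ s : ln (V s) = s ^+ 2.
Proof. by rewrite /V lnXn ?X_gt0// lnX -mulr_natr; field. Qed.

Lemma V_expR s : V s = expR (s ^+ 2).
Proof. by rewrite -lnV_ lnK// posrE exprn_gt0// X_gt0. Qed.

Lemma large_X (C : R) (n : nat) : large (fun s => C * s ^+ n <= X s).
Proof.
pose D : R := 16 ^+ n.+1 * n.+1`!%:R.
have D0 : 0 < D by rewrite mulr_gt0 ?exprn_gt0// ltr0n fact_gt0.
exists (Num.max 1 (Num.max C 0 * D)) => s; rewrite ge_max => /andP[s1 sC].
have s0 : 0 <= s by lra.
apply: (@le_trans _ _ (Num.max C 0 * s ^+ n)).
  by rewrite ler_wpM2r ?exprn_ge0// le_max lexx.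
have x0 : 0 <= s ^+ 2 / 16 by rewrite divr_ge0// exprn_ge0.
apply: le_trans (expR_ge1Dxn n x0).
apply: (@le_trans _ _ ((s ^+ 2 / 16) ^+ n.+1 / n.+1`!%:R)); last by rewrite lerDr.
have -> : (s ^+ 2 / 16) ^+ n.+1 / n.+1`!%:R = s ^+ n * (s ^+ n * s ^+ 2) / D.
  rewrite expr_div_n -exprM /D; have -> : (2 * n.+1 = n + (n + 2))%N by lia.
  rewrite !exprD invfM !mulrA; ring.
rewrite ler_pdivlMr// mulrAC [leRHS]mulrC.
rewrite ler_wpM2r ?exprn_ge0//; apply: (le_trans sC).
have h1 : 1 <= s ^+ n by apply: exprn_ege1.
have : s <= s ^+ 2 by rewrite expr2; nra.
by move: (s ^+ 2) (s ^+ n) h1 => a b h1 h2; nra.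
Qed.

Lemma sum_count_le (P : pred nat) (Y : R) n : 0 <= Y -> (forall p, P p -> p%:R <= Y) ->
  \sum_(0 <= p < n | P p) 1 <= Y + 1.
Proof.
move=> Y0 h; pose m := Num.truncn Y.
have /andP[m1 m2] := truncn_itv Y0.
apply: (@le_trans _ _ m.+1%:R); last by rewrite -natr1 lerD2r.
rewrite big_const_seq iter_addr addr0 ler_nat -size_filter.
rewrite -[m.+1](size_iota 0); apply: uniq_leq_size; first by rewrite filter_uniq// iota_uniq.
move=> p; rewrite mem_filter mem_iota add0n => /andP[/h pY _] /=.
by rewrite ltnS truncn_ge_nat.
Qed.

Lemma expRB1_ge (x : R) : x <= expR x - 1.
Proof. by have := expR_ge1Dx x; lra. Qed.

(** One factor e^omega of E2^omega matches the weight in [sum_atypical_le], the other detects omega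
    > Om. In [CP], 55 exceeds 24 * 16 / 7, the cost of the large primes in [rankin_main], and 1 pays
    for the small ones. The 6 in [Om] absorbs v / H <= 4 N and leaves the decay e^(- N). *)
Definition E2 : R := expR 2.
Definition CP : R := 55 * E2 + 1.
Definition Om s : R := (CP + 6) * N s.
Definition iv (p : nat) : R := p%:R^-1.
Definition omega d := size (primes d).

Lemma E2_ge3 : 3 <= E2. Proof. by have := expR_ge1Dx (2 : R); rewrite /E2; lra. Qed.

Lemma CP_gt0 : 0 < CP. Proof. by have := E2_ge3; rewrite /CP; lra. Qed.

Lemma Om_gt0 s : 0 < s -> 0 < Om s.
Proof.
move=> s0; apply: mulr_gt0; last exact: N_gt0.
by have := CP_gt0; lra.
Qed.

Lemma amulZ (c : R) (al : nat -> R) d :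
  amul (fun p => c * al p) d = c ^+ omega d * amul al d.
Proof. by rewrite /amul big_split /= big_const_seq count_predT iter_mulr_1. Qed.

(** Primes up to X^7 are few enough for a trivial bound: each factor is at most V = e^(s^2), and s^2
    (X^7 + 1) <= N. Beyond X^7, [sum_prime_inv_ln] bounds the logarithm of the product by O(H / s^2)
    = O(N). *)
Lemma rankin_main : large (fun s => forall n,
  \sum_(1 <= d < n) amul (fun p => E2 * iv p) d * expR (- ((H s)^-1 * ln d%:R))
  <= expR (CP * N s)).
Proof.
have := large_and (large_X (E2 + 4) 0) (large_and (large_X 2 3) (large_ge 1)).
apply: large_imp => s [h1 [h2 s1]] n; rewrite expr0 mulr1 in h1.
have E3 := E2_ge3.
have X0 := X_gt0 s; set x := X s in h1 h2 X0.
have sx : s <= x.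
  apply: le_trans h2; have -> : s ^+ 3 = s * (s * s) by ring.
  nra.
have H0 : 0 < H s by rewrite mulr_gt0 ?exprn_gt0// ; lra.
have al0 p : 0 <= E2 * iv p by rewrite mulr_ge0 ?invr_ge0// /E2 expR_ge0.
apply: le_trans (rankin n al0 _) _; first by rewrite invr_gt0.
pose y p := if p%:R <= x ^+ 7 then s ^+ 2 else E2 * H s * (p%:R * ln p%:R)^-1 : R.
have x7 : 4 <= x ^+ 7.
  have : 1 <= x ^+ 6 by apply: exprn_ege1; lra.
  by rewrite [x ^+ 7]exprS; nra.
apply: (@le_trans _ _ (\prod_(0 <= p < n | prime p) expR (y p))).
  apply: ler_prod => p pp.
  have large_prime : 0 < ln p%:R :> R by apply: ln_prime_gt0.
  have p2 : 2 <= p%:R :> R by rewrite ler_nat prime_gt1.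
  have d0 : 0 < (H s)^-1 * ln p%:R by rewrite mulr_gt0 ?invr_gt0.
  have ee := expRB1_ge ((H s)^-1 * ln p%:R).
  have q0 : 0 <= E2 * iv p / (expR ((H s)^-1 * ln p%:R) - 1) by rewrite divr_ge0//; lra.
  rewrite addr_ge0//=.
  have le1 : E2 * iv p / (expR ((H s)^-1 * ln p%:R) - 1) <= E2 * H s * (p%:R * ln p%:R)^-1.
    have -> : E2 * H s * (p%:R * ln p%:R)^-1 = E2 * iv p / ((H s)^-1 * ln p%:R).
      by rewrite /iv; field; rewrite !gt_eqF//; lra.
    by rewrite ler_wpM2l// lef_pV2 ?posrE//; lra.
  rewrite /y; case: ifP => hp; last first.
    apply: le_trans (expR_ge1Dx _); lra.
  have lp2 : 2^-1 <= ln p%:R :> R.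
    by apply: le_trans (ln2_ge R) _; rewrite ler_ln ?posrE//; lra.
  have : E2 * H s * (p%:R * ln p%:R)^-1 <= E2 * H s.
    rewrite ler_piMr//; first by rewrite mulr_ge0// /E2 ?expR_ge0// ltW.
    by rewrite invf_le1 ?mulr_gt0//; nra.
  move=> le2; rewrite -V_expR /V.
  apply: (@le_trans _ _ (1 + E2 * H s)); first lra.
  rewrite /H -/x.
  have x8 : 1 <= x ^+ 8 by apply: exprn_ege1; lra.
  have -> : x ^+ 16 = x ^+ 8 * x ^+ 8 by ring.
  have : x * x <= x ^+ 8.
    have -> : x ^+ 8 = x * x * x ^+ 6 by ring.
    have : 1 <= x ^+ 6 by apply: exprn_ege1; lra.
    have : 0 <= x * x by nra.
    move: (x * x) (x ^+ 6) => a b; nra.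
  have : E2 * s <= x * x - 1 by nra.
  move: (x ^+ 8) x8 (x * x) => a ? b; nra.
rewrite -expR_sum ler_expR.
rewrite (bigID (fun p => p%:R <= x ^+ 7)) /=.
have -> : \sum_(0 <= p < n | prime p && (p%:R <= x ^+ 7)) y p =
   s ^+ 2 * \sum_(0 <= p < n | prime p && (p%:R <= x ^+ 7)) 1.
  by rewrite mulr_sumr; apply: eq_bigr => p /andP[_ hp]; rewrite /y hp mulr1.
have -> : \sum_(0 <= p < n | prime p && ~~ (p%:R <= x ^+ 7)) y p =
   E2 * H s * \sum_(0 <= p < n | prime p && (x ^+ 7 < p%:R)) (p%:R * ln p%:R)^-1.
  rewrite mulr_sumr; apply: eq_big => p; first by rewrite real_leNgt ?negbK ?num_real.
  by move=> /andP[_ /negPf hp]; rewrite /y hp.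
have c1 : \sum_(0 <= p < n | prime p && (p%:R <= x ^+ 7)) 1 <= x ^+ 7 + 1.
  by apply: sum_count_le => [|p /andP[]//]; lra.
have c2 := sum_prime_inv_ln n x7.
have lx7 : ln (x ^+ 7) = 7 * s ^+ 2 / 16.
  by rewrite lnXn// lnX -mulr_natl; field.
have s20 : 0 < s ^+ 2 by rewrite exprn_gt0//; lra.
have EH : 0 <= E2 * H s by apply: mulr_ge0; lra.
apply: (@le_trans _ _ (s ^+ 2 * (x ^+ 7 + 1) + E2 * H s * (24 / ln (x ^+ 7)))).
  by apply: lerD; rewrite ler_wpM2l// ltW.
have -> : CP * N s = N s + 55 * E2 * N s by rewrite /CP; ring.
rewrite lx7; apply: lerD; last first.
  have -> : E2 * H s * (24 / (7 * s ^+ 2 / 16)) = (24 * 16 / 7) * E2 * N s.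
    by rewrite /H /N; field; rewrite gt_eqF//; lra.
  have N0 : 0 < N s by apply: N_gt0; lra.
  have : 0 <= E2 * N s by apply: mulr_ge0; lra.
  by lra.
rewrite /N -/x ler_pdivlMr; last lra.
have -> : s ^+ 2 * (x ^+ 7 + 1) * s = s ^+ 3 * (x ^+ 7 + 1) by ring.
have -> : x ^+ 8 = x * x ^+ 7 by rewrite exprS.
have : 0 <= s ^+ 3 by rewrite exprn_ge0//; lra.
move: (s ^+ 3) (x ^+ 7) h2 x7 => a b ? ? ?; nra.
Qed.

Section Bad.
Variable be : R.
Hypothesis be0 : 0 < be.
Local Notation K := (K be).

(** Rankin's bound at exponent 1 / H. If omega d exceeds Om, then e^omega <= e^(2 omega - Om); if ln
    d is far from v, the kernel is at most e^(- e1 V - (ln d - v) / H), and Om <= e1 V. The weight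
    e^omega in the sum serves to absorb a factor omega d later. *)
Lemma sum_atypical_le (ep : R) : 0 < ep -> large (fun s => forall v n, v <= 4 * V s ->
  \sum_(1 <= d < n | (ep * V s < `|ln d%:R - v|) || (Om s < (omega d)%:R))
     expR (omega d)%:R * amul iv d * K (ln d%:R - v) <= expR (- N s)).
Proof.
move=> ep0; have b0 := be0; have CP0 := CP_gt0.
(* For sg <= 1/2 the quotient of K t by e^(- sg t) is at most e^(- |t| / 2) for t >= 0 and e^(- be
   |t|) for t < 0. *)
pose e1 := ep * Num.min 2^-1 be.
have m0 : 0 < Num.min 2^-1 be by rewrite lt_min be0 invr_gt0 ltr0n.
have e10 : 0 < e1 by rewrite mulr_gt0.
have := large_and rankin_main (large_and (large_X ((CP + 6) / e1) 0) (large_ge 2)).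
apply: large_imp => s [hR [h1 s1]] v n vV; rewrite expr0 mulr1 in h1.
have s0 : 0 < s by lra.
have N0 := N_gt0 s0; have H0 := H_gt0 s0; have V0 := V_gt0 s.
have X1 := X_ge1 s.
have OV : Om s <= e1 * V s.
  rewrite /Om (V_HN s0) mulrA ler_pM2r// -ler_pdivrMl//.
  rewrite mulrC; apply: (le_trans h1); rewrite /H.
  have : X s <= X s ^+ 8 by apply: ler_eXnr.
  have := X_gt0 s; move: (X s ^+ 8) => a; nra.
set sg := (H s)^-1.
have H2 : 2 <= H s.
  rewrite /H; have : 1 <= X s ^+ 8 by apply: exprn_ege1.
  move: (X s ^+ 8) => a; nra.
have sg0 : 0 < sg by rewrite invr_gt0.
have sg1 : sg <= 2^-1 by rewrite lef_pV2 ?posrE//; lra.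
have key d : (0 < d)%N -> (ep * V s < `|ln d%:R - v|) || (Om s < (omega d)%:R) ->
  expR (omega d)%:R * K (ln d%:R - v) <=
  expR (- Om s + sg * v) * (E2 ^+ omega d * expR (- (sg * ln d%:R))).
  move=> d0 hd; rewrite /E2 -expRM_natr; set t := ln d%:R - v in hd *.
  have -> : expR (- Om s + sg * v) * (expR (2 * (omega d)%:R) * expR (- (sg * ln d%:R)))
    = expR ((omega d)%:R + ((omega d)%:R - Om s) - sg * t).
    by rewrite -!expRD; congr expR; rewrite /t; ring.
  have om0 : 0 <= (omega d)%:R :> R by [].
  case/orP: hd => hd; last first.
    have hK := K_le be0 t (_ : 0 <= sg <= 1).
    apply: (@le_trans _ _ (expR (omega d)%:R * expR (- (sg * t)))).
      by rewrite ler_pM2l ?expR_gt0//; apply: hK; apply/andP; split; lra.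
    by rewrite -expRD ler_expR; lra.
  apply: (@le_trans _ _ (expR (omega d)%:R * expR (- (e1 * V s) - sg * t))); last first.
    by rewrite -expRD ler_expR; lra.
  rewrite ler_pM2l ?expR_gt0//.
  have mh : Num.min 2^-1 be <= 2^-1 by rewrite ge_min lexx.
  have mb : Num.min 2^-1 be <= be by rewrite ge_min lexx orbT.
  have epV : 0 < ep * V s by rewrite mulr_gt0.
  have E1 : e1 * V s = Num.min 2^-1 be * (ep * V s) by rewrite /e1; ring.
  case: (lerP 0 t) => t0.
    rewrite ger0_norm// in hd.
    apply: (le_trans (K_le be0 t (_ : 0 <= 1 <= 1))); first by rewrite ler01 lexx.
    rewrite ler_expR E1; nra.
  rewrite ltr0_norm// in hd.
  apply: (le_trans (K_leL be t)).
  rewrite ler_expR E1; nra.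
apply: (@le_trans _ _ (expR (- Om s + sg * v) * expR (CP * N s))); last first.
  rewrite -expRD ler_expR /Om.
  have : sg * v <= 4 * N s.
    have -> : N s = sg * V s by rewrite (V_HN s0) mulKf// gt_eqF.
    by rewrite mulrCA ler_pM2l.
  lra.
apply: (@le_trans _ _ (expR (- Om s + sg * v) *
   \sum_(1 <= d < n) amul (fun p => E2 * iv p) d * expR (- (sg * ln d%:R)))); last first.
  by rewrite ler_pM2l ?expR_gt0//; apply: hR.
rewrite mulr_sumr big_mkcond big_nat [leRHS]big_nat.
apply: ler_sum => d /andP[d0 _].
have iv0 p : 0 <= iv p by rewrite invr_ge0.
have E20 : 0 <= E2 by rewrite /E2 expR_ge0.
case: ifP => hd; last first.
  by rewrite !mulr_ge0 ?expR_ge0// amul_ge0// => p; rewrite mulr_ge0.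
rewrite amulZ mulrAC.
have -> : expR (- Om s + sg * v) * (E2 ^+ omega d * amul iv d * expR (- (sg * ln d%:R)))
 = expR (- Om s + sg * v) * (E2 ^+ omega d * expR (- (sg * ln d%:R))) * amul iv d by ring.
by rewrite ler_wpM2r ?amul_ge0//; apply: key.
Qed.

End Bad.

End Scales.

(** * Growth *)

Section Growth.
Variable R : realType.
Variable be : R.
Hypothesis be0 : 0 < be.
Implicit Types (s v : R) (al : nat -> R).
Local Notation K := (K be).
Local Notation f := (f be).
Local Notation term := (term be).

(** Above V^2 the weight 1/q beats the number Om of prime factors of a typical d, and q cannot be
    one of the removed primes, which are at most V. Below e^X a step ln q is at most X, so many
    steps fit into a length X^9. *)
Definition fresh s (q : nat) := prime q && ((V s ^+ 2 < q%:R) && (q%:R <= expR (X s))).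
Definition Mf s := (Num.truncn (expR (X s))).+1.

(** Rankin's bound with all weights 1 and exponent 1 dominates the harmonic sum up to e^X, so the
    sum of 1 / (p - 1) is at least ln X = s^2 / 16. Replacing p - 1 by p costs 1, and the primes up
    to about V^2 account for O(s) only. *)
Lemma fresh_sum : large (fun s => 1 <= \sum_(0 <= q < Mf s | fresh s q) (iv R q)).
Proof.
have := large_and (large_X (2 : R) 2) (large_ge (100 : R)).
apply: large_imp => s [h1 s1].
have s0 : 0 < s by lra.
have X0 := X_gt0 s; have V0 := V_gt0 s.
have ss : s * s = s ^+ 2 by rewrite expr2.
have X2 : 2 <= X s by apply: le_trans h1; rewrite -ss; nra.
have eX0 : 0 <= expR (X s) by apply: expR_ge0.
have /andP[m1 m2] := truncn_itv eX0; rewrite -/(Mf s) in m2.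
have M0 : (0 < Mf s)%N by [].
have lM : X s <= ln (Mf s)%:R.
  by rewrite -[X s]expRK ler_ln ?posrE ?expR_gt0 ?ltr0n// ltW.
have one0 (p : nat) : 0 <= (fun=> 1 : R) p by [].
have hR := rankin (Mf s) one0 ltr01; clear one0.
have hsum : ln ((Mf s)%:R : R) <= expR (\sum_(0 <= p < Mf s | prime p) (p%:R - 1)^-1).
  apply: le_trans (ln_le_sum_inv R M0) _.
  apply: (@le_trans _ _ (\sum_(1 <= d < Mf s) amul (fun=> 1) d * expR (- (1 * ln d%:R)))).
    rewrite big_nat [leRHS]big_nat; apply: ler_sum => d /andP[d0 _].
    by rewrite /amul big1// !mul1r expRN lnK// posrE ltr0n.
  apply: (le_trans hR); apply: le_trans (@prod_le_expR_sum _ _ _ _ (fun p => (p%:R - 1)^-1) _); last first.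
    by move=> p pp; rewrite invr_ge0 subr_ge0 ler1n prime_gt0.
  apply: ler_prod => p pp; have p1 : 1 < p%:R :> R by rewrite ltr1n prime_gt1.
  have -> : expR (1 * ln p%:R) = p%:R :> R by rewrite (mul1r (ln _)) lnK// posrE; lra.
  by rewrite div1r lexx andbT addr_ge0// invr_ge0; lra.
have h2 : s ^+ 2 / 16 <= \sum_(0 <= p < Mf s | prime p) (p%:R - 1)^-1.
  by rewrite -ler_expR; apply: le_trans hsum.
have h3 : \sum_(0 <= p < Mf s | prime p) (p%:R - 1)^-1 <=
   \sum_(0 <= p < Mf s | prime p) iv R p + 1.
  apply: (@le_trans _ _ (\sum_(0 <= p < Mf s | prime p) iv R p +
    \sum_(0 <= p < Mf s | prime p) (p%:R * (p%:R - 1))^-1)); last first.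
    by rewrite lerD2l; apply: sum_prime_pp1.
  rewrite -big_split /=; apply: ler_sum => p pp.
  have p1 : 1 < p%:R :> R by rewrite ltr1n prime_gt1.
  rewrite le_eqVlt /iv; apply/orP; left; apply/eqP; field.
  by rewrite !gt_eqF//; lra.
pose n := (Num.truncn (V s ^+ 2)).+1.
have V20 : 0 <= V s ^+ 2 by rewrite exprn_ge0// ltW.
have /andP[n1 n2] := truncn_itv V20; rewrite -/n in n2.
have V1 : 1 <= V s by apply: exprn_ege1; exact: X_ge1.
have n_2 : (2 <= n)%N by rewrite ltnS truncn_ge_nat// exprn_ege1.
have h4 : \sum_(0 <= p < Mf s | prime p) iv R p <=
   \sum_(0 <= p < n | prime p) iv R p + \sum_(0 <= q < Mf s | fresh s q) iv R q.
  rewrite (bigID (fun p : nat => V s ^+ 2 < p%:R)) /= addrC; apply: lerD; last first.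
    rewrite big_nat_cond [leRHS]big_nat_cond.
    rewrite le_eqVlt; apply/orP; left; apply/eqP; apply: eq_bigl => p.
    rewrite /fresh; case: (boolP (p < Mf s)%N) => //= lt.
    case: (prime p) => //=; case: (V s ^+ 2 < p%:R) => //=.
    by apply/esym; apply: le_trans m1; rewrite ler_nat -ltnS.
  rewrite -big_filter -[leRHS]big_filter.
  set A := [seq i <- index_iota 0 (Mf s) | _]; set B := [seq i <- index_iota 0 n | prime i].
  have AB : {subset A <= B}.
    move=> p; rewrite !mem_filter !mem_index_iota => /andP[/andP[pp hp] _].
    by rewrite pp /= ltnS truncn_ge_nat// leNgt.
  have uA : uniq A by rewrite filter_uniq// iota_uniq.
  have uB : uniq B by rewrite filter_uniq// iota_uniq.
  rewrite [leRHS](bigID (fun p => p \in A)) /= -[leLHS]addr0; apply: lerD; last first.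
    by apply: sumr_ge0 => p _; rewrite invr_ge0.
  rewrite -[leRHS]big_filter le_eqVlt; apply/orP; left; apply/eqP.
  apply: perm_big; apply: uniq_perm => //; first exact: filter_uniq uB.
  by move=> p; rewrite [RHS]mem_filter; apply/idP/andP => [pA|[]//]; split=> //; exact: AB.
have h5 := sum_prime_inv_le R n_2.
have I0 : (0 < up_log 2 n)%N by rewrite up_log_gt0.
have h6 : ln (up_log 2 n)%:R <= 7 + 2 * s.
  have lI : (2 ^ (up_log 2 n).-1 < n)%N.
    by apply: up_log_gtn => //; lia.
  have nV : n%:R <= 2 * V s ^+ 2.
    have -> : n%:R = (Num.truncn (V s ^+ 2))%:R + 1 :> R by rewrite natr1.
    have : 1 <= V s ^+ 2 by apply: exprn_ege1.
    by clear -n1; lra.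
  have : (up_log 2 n).-1%:R * ln 2 <= 1 + 2 * s ^+ 2.
    rewrite mulr_natl -lnXn// -lnV_.
    have -> : 1 + 2 * ln (V s) = 1 + ln (V s ^+ 2) by rewrite lnXn// mulr_natl.
    apply: (@le_trans _ _ (ln (2 * V s ^+ 2))).
      rewrite ler_ln ?posrE ?exprn_gt0 ?mulr_gt0 ?exprn_gt0//.
      by apply: le_trans nV; rewrite -natrX ler_nat ltnW.
    rewrite lnM ?posrE ?exprn_gt0// lerD2r.
    have -> : (2 : R) = 1 + 1 by lra.
    by apply: le_ln1Dx; lra.
  have l2 := ln2_ge R => h.
  have h' : (up_log 2 n)%:R <= 7 * s ^+ 2.
    have -> : (up_log 2 n)%:R = (up_log 2 n).-1%:R + 1 :> R by rewrite natr1 prednK.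
    have : 0 <= (up_log 2 n).-1%:R :> R by [].
    rewrite -ss in h *; move: (up_log 2 n).-1%:R h => a h a0; nra.
  apply: (@le_trans _ _ (ln (7 * s ^+ 2))).
    by rewrite ler_ln ?posrE ?ltr0n ?mulr_gt0 ?exprn_gt0.
  rewrite lnM ?posrE ?exprn_gt0// lnXn// -[ln s *+ 2]mulr_natl.
  have := ln_sublinear (_ : 0 < (7 : R)); have := ln_sublinear s0; lra.
have h7 : \sum_(0 <= p < n | prime p) iv R p <= 4 + 2 * ln (up_log 2 n)%:R by [].
rewrite -ss in h2.
move: h2 h3 h4 h6 h7.
set a := \sum_(_ <= _ < _ | _) _; set b := \sum_(_ <= _ < _ | _) _.
set c := \sum_(_ <= _ < n | _) _; set d := \sum_(_ <= _ < _ | _) _; set e := ln _.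
move=> *; nra.
Qed.

(** Double counting: the left side weighs each d by the number of its divisors among the chosen
    primes, at most omega d. This is at most Om for typical d; the others contribute at most e^(-
    N), which the lower bound for f turns into the extra 1. *)
Lemma sum_sub_rem_le : large (fun s => forall al v (P : pred nat) M,
  adm al -> small_nondeg al -> 0 <= v <= 4 * V s -> (forall q, P q -> prime q) ->
  \sum_(0 <= q < M | P q) (f al v - f (rem al q) v) <= (Om s + 1) * f al v).
Proof.
have := large_and (sum_atypical_le be0 (ltr01)) (large_and (large_X (CQ be) 0)
  (large_and (large_X 1 1) (large_ge 2))).
apply: large_imp => s [h1 [h2 [sX s1]]] al v P M had sn /andP[v0 vV] HP.
rewrite expr0 mulr1 in h2; rewrite mul1r expr1 in sX.
have s0 : 0 < s by lra.
have N0 := N_gt0 s0; have C1 := CQ_ge1 be0.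
have O0 := ltW (Om_gt0 s0).
have eN : expR (- N s) <= f al v.
  apply: le_trans (f_lb be0 had sn v0); rewrite expRN lef_pV2 ?posrE ?expR_gt0//; last lra.
  apply: (le_trans h2); apply: le_trans (expR_ge1Dx _).
  have : X s <= N s.
    rewrite /N ler_pdivlMr//.
    have X1 := X_ge1 s.

    have : X s * X s <= X s ^+ 8.
      by rewrite -expr2; apply: ler_weXn2l.
    nra.
  lra.
rewrite sumrB lerBlDr.
set c := \sum_(0 <= q < M | P q) f al v.
have -> : c = tot (fun d => (\sum_(0 <= q < M | P q) 1) * term al v d).
  rewrite totZ; last exact: summable_term.
    by rewrite mulr_suml; apply: eq_bigr => q _; rewrite mul1r.
  by apply: sumr_ge0.
apply: tot_le => n.
have tq q : P q -> psum (term (rem al q) v) n <= f (rem al q) v.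
  by move=> _; apply: psum_le_tot; apply: summable_term => //; apply: adm_rem.
apply: (@le_trans _ _ ((Om s + 1) * f al v + \sum_(0 <= q < M | P q) psum (term (rem al q) v) n)); last first.
  by rewrite lerD2l; apply: ler_sum.
rewrite -lerBlDr /psum -mulr_sumr mulr_suml -sumrB.
have -> : \sum_(0 <= q < M | P q) (1 * \sum_(1 <= d < n) term al v d - \sum_(1 <= d < n) term (rem al q) v d)
  = \sum_(1 <= d < n) term al v d * (\sum_(0 <= q < M | P q && (q %| d)%N) 1).
  under eq_bigr do rewrite mul1r -sumrB.
  rewrite exchange_big /= big_nat [RHS]big_nat; apply: eq_bigr => d /andP[d0 _].
  rewrite mulr_sumr big_mkcondr /=; apply: eq_bigr => q Pq.
  rewrite /term amul_rem ?HP//; case: ifP => _; rewrite ?mul0r ?subr0 ?mulr1//.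
  by rewrite subrr.
have cnt d : (0 < d)%N -> \sum_(0 <= q < M | P q && (q %| d)%N) 1 <= (omega d)%:R :> R.
  move=> d0; rewrite big_const_seq iter_addr addr0 ler_nat -size_filter.
  apply: uniq_leq_size; first by rewrite filter_uniq// iota_uniq.
  by move=> q; rewrite mem_filter mem_primes => /andP[/andP[/HP -> ->] _]; rewrite d0.
have t0 d : 0 <= term al v d by apply: term_ge0.
apply: (@le_trans _ _ (\sum_(1 <= d < n) term al v d * (omega d)%:R)).
  rewrite big_nat [leRHS]big_nat; apply: ler_sum => d /andP[d0 _].
  by rewrite ler_wpM2l// cnt.
rewrite (bigID (fun d => Om s < (omega d)%:R)) /= addrC mulrDl mul1r; apply: lerD.
  apply: (@le_trans _ _ (Om s * psum (term al v) n)); last first.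
    by rewrite ler_wpM2l//; apply: psum_le_tot; apply: summable_term.
  rewrite /psum mulr_sumr [leLHS]big_mkcond; apply: ler_sum => d _.
  case: ifP => hd; last by rewrite mulr_ge0.
  by rewrite mulrC ler_wpM2r// leNgt.
apply: le_trans eN; apply: le_trans (h1 v n vV).
rewrite [leLHS]big_mkcond [leRHS]big_mkcond; apply: ler_sum => d _.
have iv0 p : 0 <= iv R p by rewrite invr_ge0.
case: ifP => hd; last by case: ifP => _ //; rewrite !mulr_ge0 ?expR_ge0 ?amul_ge0 ?ltW ?K_gt0.
rewrite orbT /term mulrC -mulrA.
have ko : (omega d)%:R <= expR (omega d)%:R :> R.
  by apply: le_trans (expR_ge1Dx _); rewrite lerDr.
apply: ler_pM => //; first by rewrite mulr_ge0 ?amul_ge0 ?ltW ?K_gt0//; apply: adm_ge0.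
rewrite ler_wpM2r//; first exact: ltW (K_gt0 _ _).
by apply: ler_amul => p pp _; rewrite adm_ge0//=; have [_] := had p; apply.
Qed.

(* Sum f - f_q >= al q * sum_j T_q^j f_q over the fresh q: their reciprocals sum to at least 1,
   whereas at most Om of them divide a typical d. *)
Lemma growth : large (fun s => forall al v,
  adm al -> small_nondeg al -> (forall q, fresh s q -> nondeg al q) ->
  2 * X s ^+ 9 <= v <= 4 * V s -> 2 * f al (v - 2 * X s ^+ 9) <= f al v).
Proof.
have C1 := CQ_ge1 be0; have P0 := CP_gt0 R.
have := large_and fresh_sum (large_and sum_sub_rem_le (large_and
  (large_X (4 * (CP R + 7)) 0) (large_and (large_X 2 2) (large_ge (8 * CQ be * (CP R + 7)))))).
apply: large_imp => s [h1 [h2 [h3 [h3' h4]]]] al v had sn nzq /andP[v1 v2].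
have s1 : 8 <= s by apply: le_trans h4; nra.
rewrite expr0 mulr1 in h3.
have s0 : 0 < s by lra.
have N0 := N_gt0 s0; have X0 := X_gt0 s; have X1 := X_ge1 s.
have X90 : 0 < X s ^+ 9 by rewrite exprn_gt0.
set u := v - 2 * X s ^+ 9.
have u0 : 0 <= u by rewrite /u; lra.
have hv := h2 al v (fresh s) (Mf s) had sn.
have hu := h2 al u (fresh s) (Mf s) had sn.
have fr q : fresh s q -> prime q by case/andP.
have NX : N s <= X s ^+ 8 by rewrite /N ler_pdivrMr// ler_peMr ?exprn_ge0 ?ltW//; lra.
have X81 : 1 <= X s ^+ 8 by apply: exprn_ege1.
have N1 : 1 <= N s.
  rewrite /N ler_pdivlMr// mul1r; apply: (@le_trans _ _ (X s)); last by apply: ler_eXnr.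
  by apply: le_trans h3'; rewrite expr2; nra.
have Om1 : Om s + 1 <= (CP R + 7) * N s by rewrite /Om; lra.
have Vbig : (Om s + 1) / V s ^+ 2 <= 2^-1.
  rewrite ler_pdivrMr ?exprn_gt0 ?V_gt0//; apply: (le_trans Om1).
  have -> : V s ^+ 2 = X s ^+ 8 * X s ^+ 24 by rewrite /V; ring.
  have : X s <= X s ^+ 24 by apply: ler_eXnr.
  move: (X s ^+ 24) => y hy.
  have : (CP R + 7) * N s <= (CP R + 7) * X s ^+ 8 by rewrite ler_pM2l//; lra.
  move: (X s ^+ 8) X81 => x x1 hx; nra.
have fq u' : \sum_(0 <= q < Mf s | fresh s q) iv R q * (f al u' - f (rem al q) u')
   <= (V s ^+ 2)^-1 * \sum_(0 <= q < Mf s | fresh s q) (f al u' - f (rem al q) u').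
  rewrite mulr_sumr; apply: ler_sum => q /andP[pq /andP[q1 _]].
  rewrite ler_wpM2r ?subr_ge0 ?f_rem_le// lef_pV2 ?posrE ?exprn_gt0 ?V_gt0 ?ltr0n ?prime_gt0//.
  exact: ltW.
(* As the fresh 1/q sum to at least 1, f is at most the sum of (1/q) f; replacing f by f_q costs at
   most (Om + 1) / V^2 <= 1/2 of f, because q > V^2. *)
have lowu : f al u / 2 <= \sum_(0 <= q < Mf s | fresh s q) iv R q * f (rem al q) u.
  have fu := f_ge0 be0 u had.
  have : f al u <= \sum_(0 <= q < Mf s | fresh s q) iv R q * f al u.
    by rewrite -mulr_suml ler_peMl.
  have -> : \sum_(0 <= q < Mf s | fresh s q) iv R q * f al u =
    \sum_(0 <= q < Mf s | fresh s q) iv R q * (f al u - f (rem al q) u)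
    + \sum_(0 <= q < Mf s | fresh s q) iv R q * f (rem al q) u.
    by rewrite -big_split /=; apply: eq_bigr => q _; rewrite -mulrDr subrK.
  have hscale : \sum_(0 <= q < Mf s | fresh s q) iv R q * (f al u - f (rem al q) u) <= f al u / 2.
    apply: (le_trans (fq u)).
    apply: (@le_trans _ _ ((V s ^+ 2)^-1 * ((Om s + 1) * f al u))).
      rewrite ler_pM2l ?invr_gt0 ?exprn_gt0 ?V_gt0//; apply: hu => //.
      by apply/andP; split=> //; rewrite /u; lra.
    rewrite mulrA [_^-1 * _]mulrC [leRHS]mulrC ler_wpM2r//.
  move: hscale; move: (\sum_(_ <= _ < _ | _) _) => a; move: (\sum_(_ <= _ < _ | _) _) => b; clear; lra.
have main : X s ^+ 8 / (2 * CQ be) * \sum_(0 <= q < Mf s | fresh s q) iv R q * f (rem al q) u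
   <= (Om s + 1) * f al v.
  apply: le_trans (hv _ _) => //; last by apply/andP; split => //; lra.
  rewrite mulr_sumr; apply: ler_sum => q fq'.
  have pq := fr _ fq'; have /andP[_ /andP[q1 q2]] := fq'.
  have hr := adm_rem q had.
  have lq : 0 < ln q%:R :> R by apply: ln_prime_gt0.
  have lqX : ln q%:R <= X s.
    by rewrite -[X s]expRK ler_ln ?posrE ?expR_gt0 ?ltr0n ?prime_gt0.
  (* All J steps of length ln q stay above u, where quasi-monotonicity bounds f_q from below by its
     value at u; ln q <= X makes J at least X^8. *)
  pose J := Num.truncn (2 * X s ^+ 9 / ln q%:R).
  have /andP[J1 J2] : J%:R <= 2 * X s ^+ 9 / ln q%:R < J.+1%:R.
    by apply: truncn_itv; rewrite divr_ge0 ?mulr_ge0 ?ltW.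
  have J3 : J%:R * ln q%:R <= 2 * X s ^+ 9 by rewrite -ler_pdivlMr.
  have J4 : X s ^+ 8 <= J%:R.
    have : 2 * X s ^+ 8 <= 2 * X s ^+ 9 / ln q%:R.
      rewrite ler_pdivlMr//.
      have -> : X s ^+ 9 = X s ^+ 8 * X s by rewrite exprSr.
      by rewrite mulrA ler_pM2l//; apply: mulr_gt0 => //; rewrite exprn_gt0.
    by move: J2; rewrite -natr1; clear -X81; lra.
  apply: le_trans (f_sub_rem_ge be0 v J had pq).
  have snr : small_nondeg (rem al q).
    case: sn => b [pb b11 nb]; exists b; split=> //; apply: nondeg_rem => //.
    apply/eqP => e; move: q1; rewrite -e.
    have bb : b%:R <= 11 :> R by rewrite ler_nat.
    have : 11 <= V s ^+ 2.
      have : X s <= V s ^+ 2 by rewrite /V -exprM; apply: ler_eXnr.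
      by move: (V s ^+ 2) => y; clear -h3 P0; lra.
    by clear -bb; lra.
  apply: (@le_trans _ _ (al q * \sum_(1 <= j < J.+1) (f (rem al q) u / CQ be))); last first.
    rewrite ler_wpM2l ?adm_ge0// big_nat [leRHS]big_nat; apply: ler_sum => j /andP[_ jJ].
    rewrite ler_pdivrMr; last by clear -C1; lra.
    rewrite mulrC; apply: f_quasi_mono => //; rewrite /u.
    have : j%:R * ln q%:R <= J%:R * ln q%:R :> R by rewrite ler_pM2r// ler_nat -ltnS.
    by clear -J3; lra.
  rewrite big_const_nat subn1 /= iter_addr addr0 -[_ / CQ be *+ J]mulr_natl.
  have fr0 : 0 <= f (rem al q) u / CQ be by rewrite divr_ge0 ?f_ge0//; clear -C1; lra.
  have -> : X s ^+ 8 / (2 * CQ be) * (iv R q * f (rem al q) u) =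
    (2 * q%:R)^-1 * (X s ^+ 8 * (f (rem al q) u / CQ be)).
    have q0 : q%:R != 0 :> R by rewrite pnatr_eq0 -lt0n prime_gt0.
    have C0 : CQ be != 0 by rewrite gt_eqF//; apply: lt_le_trans C1.
    by clear -q0 C0; rewrite /iv; field; rewrite q0 C0.
  apply: ler_pM => //.
  - by rewrite invr_ge0 mulr_ge0.
  - by rewrite mulr_ge0// exprn_ge0// ltW.
  - exact: nzq.
  - by rewrite ler_wpM2r.
have fv := f_ge0 be0 v had; have fu := f_ge0 be0 u had.
have e1 : X s ^+ 8 / (4 * CQ be) * f al u <= (CP R + 7) * N s * f al v.
  apply: (@le_trans _ _ ((Om s + 1) * f al v)); last by rewrite ler_wpM2r.
  apply: le_trans main.
  have -> : X s ^+ 8 / (4 * CQ be) * f al u = X s ^+ 8 / (2 * CQ be) * (f al u / 2).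
    by field; clear -C1; lra.
  by rewrite ler_pM2l// divr_gt0 ?exprn_gt0//; clear -C1; lra.
have N0' : 0 < (CP R + 7) * N s by rewrite mulr_gt0//; clear -P0; lra.
(* Since X^8 = s N, what remains is s / (4 CQ) >= 2 (CP + 7), which is the threshold imposed on
   s. *)
rewrite -(ler_pM2l N0'); apply: le_trans e1.
have -> : X s ^+ 8 = s * N s by rewrite /N mulrC divfK// gt_eqF.
have -> : (CP R + 7) * N s * (2 * f al u) = (2 * (CP R + 7)) * (N s * f al u) by ring.
have -> : s * N s / (4 * CQ be) * f al u = s / (4 * CQ be) * (N s * f al u) by ring.
apply: ler_wpM2r; first by apply: mulr_ge0; [exact: ltW | exact: fu].
by clear -h4 C1; rewrite ler_pdivlMr; lra.
Qed.

End Growth.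

(** * Typical integers and the part of d made of large primes *)

Section Good.
Variable R : realType.
Variable be : R.
Hypothesis be0 : 0 < be.
Implicit Types (s v : R) (al : nat -> R).
Local Notation K := (K be).
Local Notation f := (f be).
Local Notation term := (term be).

Definition regular s al := [/\ adm al, small_nondeg al & forall q, fresh s q -> nondeg al q].

Definition large_prime s : nat_pred := [pred p : nat | L s < ln p%:R].

Definition good s ep v d :=
  [&& `|ln d%:R - v| <= ep * V s, (omega d)%:R <= Om s & ln (d`_(large_prime s))%:R <= ep * V s].

Definition ivL s p : R := if L s < ln p%:R then iv R p else 0.

(** The exponent X^(-10) balances two losses: the Euler product over primes above e^L costs e^(24
    X^6), because X^10 / L = X^6, and undoing the twist for ln e <= 3 V costs e^(3 X^6). Both lie
    below the growth of f over a distance ep V, which is exponential in X^7. *)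
Lemma rankin_large : large (fun s => forall n,
  \sum_(1 <= e < n) amul (ivL s) e * expR (- ((X s ^+ 10)^-1 * ln e%:R))
  <= expR (24 * X s ^+ 6)).
Proof.
have := large_X (4 : R) 0; apply: large_imp => s h1 n.
rewrite expr0 mulr1 in h1.
have X0 := X_gt0 s.
have X100 : 0 < X s ^+ 10 by rewrite exprn_gt0.
have L0 : 0 < L s by rewrite exprn_gt0.
have y4 : 4 <= expR (L s).
  apply: le_trans (expR_ge1Dx _); have : X s <= L s by apply: ler_eXnr => //; lra.
  lra.
have iv0 p : 0 <= ivL s p by rewrite /ivL; case: ifP => // _; rewrite invr_ge0.
apply: le_trans (rankin n iv0 _) _; first by rewrite invr_gt0.
pose y p : R := if expR (L s) < p%:R then X s ^+ 10 * (p%:R * ln p%:R)^-1 else 0.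
have y0 p : 0 <= y p.
  rewrite /y; case: ifP => // _; apply: mulr_ge0; first exact: ltW.
  by rewrite invr_ge0 mulr_ge0// ln_nat_ge0.
apply: (@le_trans _ _ (\prod_(0 <= p < n | prime p) (1 + y p))).
  apply: ler_prod => p pp.
  have lp0 : 0 < ln p%:R :> R by apply: ln_prime_gt0.
  have p0 : 0 < p%:R :> R by rewrite ltr0n prime_gt0.
  have d0 : 0 < (X s ^+ 10)^-1 * ln p%:R by rewrite mulr_gt0 ?invr_gt0.
  have ee := expRB1_ge ((X s ^+ 10)^-1 * ln p%:R).
  rewrite addr_ge0 ?divr_ge0 ?iv0//=; last by clear -d0 ee; lra.
  rewrite lerD2l /y.
  have -> : (expR (L s) < p%:R) = (L s < ln p%:R).
    by rewrite -{2}[L s]expRK ltr_ln ?posrE ?expR_gt0.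
  rewrite /ivL; case: ifP => _; last by rewrite mul0r.
  have -> : X s ^+ 10 * (p%:R * ln p%:R)^-1 = iv R p / ((X s ^+ 10)^-1 * ln p%:R).
    by rewrite /iv !invfM invrK; ring.
  rewrite ler_wpM2l ?invr_ge0// lef_pV2 ?posrE//; clear -d0 ee; lra.
apply: le_trans (prod_le_expR_sum _ _) _ => //.
rewrite ler_expR /y -big_mkcondr -mulr_sumr.
apply: (@le_trans _ _ (X s ^+ 10 * (24 / ln (expR (L s))))).
  by rewrite ler_pM2l//; apply: sum_prime_inv_ln.
rewrite expRK /L; have -> : X s ^+ 10 = X s ^+ 6 * X s ^+ 4 by ring.
rewrite le_eqVlt; apply/orP; left; apply/eqP; field; lra.
Qed.

Lemma amul_le_ivL s al e : adm al -> (0 < e)%N -> (large_prime s).-nat e -> amul al e <= amul (ivL s) e.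
Proof.
move=> had e0 /(pnatP _ e0) h; apply: ler_amul => p pp pe.
have := h p pp pe; rewrite inE /= /ivL => ->.
by have [-> /(_ pp)] := had p.
Qed.

(** Write d = e m, where e is the part of d made of large primes. The cofactor m is coprime to e, so
    the term factors as [amul al e] times the term of m at v - ln e, and summing over m gives at
    most f (v - ln e). *)
Lemma sum_large_part s al v n (P : pred nat) (C : pred nat) (B : R) : adm al ->
  (forall d, (0 < d)%N -> P d -> C (d`_(large_prime s))%N) ->
  (forall e, (0 < e)%N -> C e -> f al (v - ln e%:R) <= B) ->
  \sum_(1 <= d < n | P d) term al v d
   <= \sum_(1 <= e < n | (large_prime s).-nat e && C e) amul al e * B.
Proof.
move=> had hC hB; set pi := large_prime s.
have t0 v' d : 0 <= term al v' d by apply: term_ge0.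
pose w e d := if (d`_pi == e)%N && P d then term al v d else 0.
have w0 e d : 0 <= w e d by rewrite /w; case: ifP.
apply: (@le_trans _ _ (\sum_(1 <= e < n) \sum_(1 <= d < n) w e d)).
  rewrite exchange_big /= big_mkcond big_nat [leRHS]big_nat; apply: ler_sum => d /andP[d0 dn].
  case: ifP => Pd; last exact: sumr_ge0.
  have pd : (d`_pi <= d)%N by apply: dvdn_leq => //; apply: dvdn_part.
  rewrite (bigD1_seq (d`_pi)%N) ?iota_uniq ?mem_index_iota ?part_gt0 ?(leq_ltn_trans pd dn)//=.
  by rewrite {1}/w eqxx Pd lerDl sumr_ge0.
rewrite [leRHS]big_mkcond [leLHS]big_nat [leRHS]big_nat; apply: ler_sum => e /andP[e0 en].
have -> : \sum_(1 <= d < n) w e d = \sum_(1 <= d < n | (e %| d)%N) w e d.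
  rewrite [RHS]big_mkcond; apply: eq_bigr => d _; rewrite /w; case: eqP => [<-|_] /=.
    by rewrite dvdn_part.
  by case: ifP.
apply: le_trans (sum_multiples_le _ (w0 e) e0) _.
have key m : (0 < m)%N -> ((e * m)`_pi == e)%N -> term al v (e * m)%N = amul al e * term al (v - ln e%:R) m.
  move=> m0 /eqP h; have em0 : (0 < e * m)%N by rewrite muln_gt0 e0.
  have hm : ((e * m)`_pi^')%N = m.
    have := partnC pi em0; rewrite {1}h => /eqP.
    by rewrite eqn_pmul2l// => /eqP.
  have cop : coprime e m by rewrite -{1}h -{2}hm coprime_partC.
  rewrite /term amul_coprime// ln_natM// mulrA; congr (_ * K _).
  ring.
case: ifP => hc; last first.
  rewrite big_nat big1// => m /andP[m0 _]; rewrite /w; case: ifP => // /andP[/eqP h Pm].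
  move/negP: hc; case; rewrite -{1}h part_pnat /= -h; apply: hC => //.
  by rewrite muln_gt0 e0.
have /andP[_ Ce] := hc.
apply: (@le_trans _ _ (amul al e * psum (term al (v - ln e%:R)) n)).
  rewrite /psum mulr_sumr big_nat [leRHS]big_nat; apply: ler_sum => m /andP[m0 _].
  rewrite /w; case: ifP => [/andP[h _]|_]; first by rewrite key.
  by rewrite mulr_ge0 ?amul_ge0//; apply: adm_ge0.
rewrite ler_wpM2l ?amul_ge0//; first exact: adm_ge0.
by apply: le_trans (hB _ e0 Ce); apply: psum_le_tot; apply: summable_term.
Qed.

Lemma growth_iter : large (fun s => forall al, regular s al -> forall m v,
  0 <= v - m%:R * (2 * X s ^+ 9) -> v <= 4 * V s ->
  2 ^+ m * f al (v - m%:R * (2 * X s ^+ 9)) <= f al v).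
Proof.
have := growth be0; apply: large_imp => s h al [had sn nzq].
have X90 : 0 < X s ^+ 9 by rewrite exprn_gt0// X_gt0.
elim=> [|m IH] v; first by rewrite mul0r subr0 expr0 mul1r.
rewrite -natr1; set y := X s ^+ 9 in X90 *; set x := m%:R.
have x0 : 0 <= x by [].
move=> h1 h2; have xy : 0 <= x * y by rewrite mulr_ge0// ltW.
apply: le_trans (IH v _ h2); last by clear -h1 X90 xy; rewrite -/x -/y; lra.
rewrite exprSr -mulrA ler_pM2l ?exprn_gt0//.
have -> : v - (x + 1) * (2 * y) = v - x * (2 * y) - 2 * y by ring.
by apply: h => //; apply/andP; split; clear -h1 h2 X90 xy; rewrite -?/x -?/y; lra.
Qed.

(* Rankin's trick on the part of d made of primes above e^L loses only exp (O(X^6)), which the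
   growth of f over a distance ep V overwhelms. *)
Lemma sum_large_part_le (ep : R) : 0 < ep <= 4^-1 -> large (fun s => forall al v n, regular s al ->
  V s / 2 <= v <= 2 * V s ->
  \sum_(1 <= d < n | (`|ln d%:R - v| <= ep * V s) && (ep * V s < ln (d`_(large_prime s))%:R))
     term al v d <= (X s ^+ 32)^-1 * f al v).
Proof.
move=> /andP[ep0 ep1]; have C1 := CQ_ge1 be0.
have := large_and growth_iter (large_and rankin_large (large_and (large_X (CQ be) 0)
  (large_and (large_X (200 / ep) 0) (large_and (large_X 1 2) (large_ge 4))))).
apply: large_imp => s [h1 [h2 [h3 [h4 [h5 s4]]]]] al v n hcl /andP[v1 v2].
have [had sn _] := hcl.
rewrite expr0 mulr1 in h3; rewrite expr0 mulr1 in h4; rewrite mul1r in h5.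
have X0 := X_gt0 s; have V0 := V_gt0 s; have X1 := X_ge1 s.
have X90 : 0 < X s ^+ 9 by rewrite exprn_gt0.
(* The number of doubling steps of length 2 X^9 that fit into ep V, about ep X^7 / 2. *)
pose m := Num.truncn (ep * V s / (2 * X s ^+ 9)).
have epV : 0 < ep * V s by rewrite mulr_gt0.
have epV4 : ep * V s <= V s / 4.
  by rewrite mulrC ler_pM2l.
have /andP[m1 m2] : m%:R <= ep * V s / (2 * X s ^+ 9) < m.+1%:R.
  by apply: truncn_itv; rewrite divr_ge0 ?ltW// mulr_gt0.
have m1' : m%:R * (2 * X s ^+ 9) <= ep * V s by rewrite -ler_pdivlMr// mulr_gt0.
set B := CQ be * (CQ be * (2 ^+ m)^-1 * f al v).
have vm0 : 0 <= v - m%:R * (2 * X s ^+ 9) by clear -m1' epV4 v1 V0; lra.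
have fB : f al (v - ep * V s) <= CQ be * (2 ^+ m)^-1 * f al v.
  apply: (@le_trans _ _ (CQ be * f al (v - m%:R * (2 * X s ^+ 9)))).
    by apply: f_quasi_mono => //; clear -m1'; lra.
  rewrite -mulrA ler_pM2l; last by clear -C1; lra.
  rewrite ler_pdivlMl ?exprn_gt0//; apply: h1 => //; clear -v2 V0; lra.
apply: (@le_trans _ _ (\sum_(1 <= e < n | (large_prime s).-nat e && ((ep * V s < ln e%:R) && (ln e%:R <= 3 * V s))) amul al e * B)).
  apply: sum_large_part => // [d d0 /andP[hd ->] /=|e e0 /andP[he _]].
    apply: (@le_trans _ _ (ln d%:R)).
      rewrite ler_ln ?posrE ?ltr0n ?part_gt0// ler_nat; apply: dvdn_leq => //; exact: dvdn_part.
    move: hd; rewrite ler_norml => /andP[_]; clear -v2 epV4 V0; lra.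
  rewrite /B; apply: (@le_trans _ _ (CQ be * f al (v - ep * V s))).
    by apply: f_quasi_mono => //; clear -he; lra.
  by rewrite ler_pM2l//; clear -C1; lra.
have fv0 : 0 <= f al v by apply: f_ge0.
have C0 : 0 <= CQ be by clear -C1; lra.
have B0 : 0 <= B.
  by apply: mulr_ge0 => //; apply: mulr_ge0 => //; apply: mulr_ge0 => //; rewrite invr_ge0 exprn_ge0.
rewrite -mulr_suml.
have hS : \sum_(1 <= e < n | (large_prime s).-nat e && ((ep * V s < ln e%:R) && (ln e%:R <= 3 * V s))) amul al e
   <= expR (27 * X s ^+ 6).
  apply: (@le_trans _ _ (expR (3 * X s ^+ 6) * \sum_(1 <= e < n) amul (ivL s) e * expR (- ((X s ^+ 10)^-1 * ln e%:R)))); last first.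
    have -> : 27 * X s ^+ 6 = 3 * X s ^+ 6 + 24 * X s ^+ 6 by ring.
    by rewrite expRD ler_pM2l ?expR_gt0//; apply: h2.
  have ivL0 p : 0 <= ivL s p by rewrite /ivL; case: ifP => // _; rewrite invr_ge0.
  rewrite mulr_sumr big_mkcond big_nat [leRHS]big_nat; apply: ler_sum => e /andP[e0 _].
  case: ifP => [/and3P[pe _ le]|_]; last by rewrite !mulr_ge0 ?expR_ge0// amul_ge0.
  rewrite mulrCA -expRD.
  apply: (@le_trans _ _ (amul (ivL s) e)); first exact: amul_le_ivL.
  rewrite ler_peMr ?amul_ge0// -[X in X <= _]expR0 ler_expR subr_ge0.
  rewrite ler_pdivrMl ?exprn_gt0// mulrCA -exprD.
  exact: le.
apply: (@le_trans _ _ (expR (27 * X s ^+ 6) * B)); first by rewrite ler_wpM2r.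
have -> : expR (27 * X s ^+ 6) * B = expR (27 * X s ^+ 6) * (CQ be * CQ be) / 2 ^+ m * f al v.
  by rewrite /B; ring.
rewrite ler_wpM2r//.
have m3 : ep * X s ^+ 7 / 2 <= m%:R + 1.
  rewrite natr1; apply: ltW; apply: le_lt_trans m2.
  rewrite le_eqVlt; apply/orP; left; apply/eqP.
  by rewrite /V; field; rewrite gt_eqF.
have e2m : expR (m%:R / 2) <= 2 ^+ m :> R.
  have -> : (2 : R) ^+ m = expR (m%:R * ln 2) by rewrite expRM_natl lnK// posrE.
  rewrite ler_expR.
  by rewrite ler_wpM2l// ln2_ge.
have CX : CQ be * CQ be <= X s * X s by apply: ler_pM.
rewrite ler_pdivrMr ?exprn_gt0// ler_pdivlMl ?exprn_gt0//; apply: le_trans e2m.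
apply: (@le_trans _ _ (expR (27 * X s ^+ 6) * X s ^+ 34)).
  have -> : X s ^+ 34 = X s ^+ 32 * (X s * X s) by ring.
  by rewrite mulrCA ler_pM2l ?expR_gt0// ler_pM2l ?exprn_gt0.
rewrite {2}/X -expRM_natl -expRD ler_expR.
have X6 : X s <= X s ^+ 6 by apply: ler_eXnr.
have h4' : 200 <= ep * X s by rewrite mulrC -ler_pdivrMr.
have : 200 * X s ^+ 6 <= ep * X s ^+ 7.
  by rewrite [X s ^+ 7]exprS [ep * _]mulrA ler_pM2r// exprn_gt0.
move: (X s ^+ 7) (X s ^+ 6) (s ^+ 2) X6 m3 h5 => a b c X6 m3 h5 hab.
by move: (m%:R) (ep * a) m3 hab => x y m3 hab; clear -X6 m3 h5 X1 hab; lra.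
Qed.

(** A d that is not good is atypical or has a heavy part made of large primes; each of the two
    classes takes at most a quarter of f. *)
Lemma tot_good (ep : R) : 0 < ep <= 4^-1 -> large (fun s => forall al v, regular s al ->
  V s / 2 <= v <= 2 * V s ->
  f al v <= 2 * tot (fun d => if good s ep v d then term al v d else 0)).
Proof.
move=> hep; have /andP[ep0 ep1] := hep; have C1 := CQ_ge1 be0.
have := large_and (sum_large_part_le hep) (large_and (sum_atypical_le be0 ep0) (large_and (large_X 4 0)
  (large_and (large_X (4 * CQ be) 0) (large_and (large_X 1 2) (large_ge 4))))).
apply: large_imp => s [h1 [h2 [h3 [h4 [h5 s4]]]]] al v hcl /andP[v1 v2].
have [had sn _] := hcl; have V0 := V_gt0 s; have X1 := X_ge1 s; have X0 := X_gt0 s.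
rewrite expr0 mulr1 in h3; rewrite expr0 mulr1 in h4; rewrite mul1r in h5.
have v0 : 0 <= v by clear -v1 V0; lra.
set tg := fun d => _.
have t0 d : 0 <= term al v d by apply: term_ge0.
have st := summable_term be0 v had.
have sg : summable tg.
  by apply: (summable_le _ st) => d *; rewrite /tg; case: ifP.
pose tb d := if good s ep v d then 0 else term al v d.
have sb : summable tb.
  by apply: (summable_le _ st) => d *; rewrite /tb; case: ifP.
have -> : f al v = tot tg + tot tb.
  rewrite -totD//; apply: eq_tot => d _; rewrite /tg /tb.
  by case: ifP => _; rewrite ?addr0 ?add0r.
suff : tot tb <= f al v / 2.
  have -> : f al v = tot tg + tot tb.
    rewrite -totD//; apply: eq_tot => d _; rewrite /tg /tb.
    by case: ifP => _; rewrite ?addr0 ?add0r.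
  by move: (tot tg) (tot tb) => a b; clear; lra.
have fv := f_lb be0 had sn v0.
have fv0 := f_ge0 be0 v had.
apply: (@le_trans _ _ (expR (- N s) + (X s ^+ 32)^-1 * f al v)).
  apply: tot_le => n; apply: le_trans (lerD (h2 v n _) (h1 al v n hcl _)); last first.
  - by rewrite v1.
  - by clear -v2 V0; lra.
  rewrite /psum [X in X + _]big_mkcond [X in _ + X]big_mkcond -big_split /=.
  apply: ler_sum => d _.
  have iv0 p : 0 <= iv R p by rewrite invr_ge0.
  have K0 := ltW (K_gt0 be (ln d%:R - v)).
  have w0 : 0 <= expR (omega d)%:R * amul (iv R) d * K (ln d%:R - v).
    by rewrite !mulr_ge0 ?expR_ge0 ?amul_ge0.
  rewrite /tb /good; case: ifP => [_|/negbT].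
    by rewrite addr_ge0//; case: ifP.
  rewrite !negb_and -!ltNge; case: ifP => [_ _|/negbT].
    rewrite -[leLHS]addr0; apply: lerD; last by case: ifP.
    rewrite /term ler_wpM2r//.
    apply: (@le_trans _ _ (amul (iv R) d)).
      by apply: ler_amul => p pp _; rewrite adm_ge0//=; have [_] := had p; apply.
    rewrite ler_peMl ?amul_ge0// -[X in X <= _]expR0 ler_expR//.
  rewrite negb_or -!leNgt => /andP[n1 n2]; rewrite n1 (ltNge (Om s)) n2 (ltNge (_ * _)) n1 /= => ->.
  by rewrite add0r.
have e1 : expR (- N s) <= f al v / 4.
  apply: (@le_trans _ _ ((CQ be)^-1 / 4)); last by rewrite ler_pM2r ?invr_gt0.
  rewrite expRN -invfM lef_pV2 ?posrE ?expR_gt0//; last by clear -C1; lra.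
  apply: (@le_trans _ _ (X s)); first by clear -h4; lra.
  apply: (@le_trans _ _ (N s)); last by apply: le_trans (expR_ge1Dx _); rewrite lerDr.
  have s0 : 0 < s by clear -s4; lra.
  rewrite /N ler_pdivlMr//.
  apply: (@le_trans _ _ (X s ^+ 2)); last by apply: ler_weXn2l.
  rewrite [X s ^+ 2]expr2 ler_pM2l//; apply: le_trans h5.
  by rewrite expr2; clear -s4; nra.
have e2 : (X s ^+ 32)^-1 * f al v <= f al v / 4.
  rewrite mulrC ler_wpM2l// lef_pV2 ?posrE ?exprn_gt0//.
  by apply: (le_trans h3); apply: ler_eXnr.
by clear -e1 e2; lra.
Qed.

End Good.

(** * Averaging over removed prime powers *)

Section Blocks.
Variable R : realType.
Variable be : R.
Hypothesis be0 : 0 < be.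
Implicit Types (s v : R) (al : nat -> R).
Local Notation K := (K be).
Local Notation f := (f be).
Local Notation term := (term be).

Lemma sum_logn_ln d : (0 < d)%N ->
  \sum_(q <- primes d) (logn q d)%:R * ln q%:R = ln d%:R :> R.
Proof.
move=> d0.
have E : d = (\prod_(q <- primes d) q ^ logn q d)%N.
  rewrite {1}(prod_prime_decomp d0) prime_decompE big_map.
  by apply: eq_bigr.
rewrite [RHS](congr1 (fun m => ln (m%:R : R)) E).
have : all (fun q => 0 < q)%N (primes d).
  by apply/allP => q; rewrite mem_primes => /andP[/prime_gt0].
elim: (primes d) => [|q l IH]; first by rewrite !big_nil ln1.
move=> /= /andP[q0 ql]; rewrite !big_cons IH// ln_natM ?expn_gt0 ?q0//.
  by rewrite natrX lnXn ?ltr0n// mulr_natl.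
by rewrite prodn_cond_gt0// => i; elim: l ql {IH} => // *; rewrite expn_gt0.
Qed.

Lemma sum_logn_ln_part (pi : nat_pred) d : (0 < d)%N ->
  \sum_(q <- primes d | q \in pi) (logn q d)%:R * ln q%:R = ln (d`_pi)%:R :> R.
Proof.
move=> d0; rewrite -sum_logn_ln ?part_gt0// primes_part big_filter.
apply: eq_bigr => q qpi; congr (_%:R * _).
rewrite -{1}(partnC pi d0) lognM ?part_gt0//.
have -> : logn q (d`_pi^')%N = 0%N; last by rewrite addn0.
by apply/eqP; rewrite -leqn0 leqNgt logn_gt0 primes_part mem_filter inE /= qpi.
Qed.

Lemma sum_primesE (F : nat -> R) d n : (0 < d < n)%N ->
  \sum_(q <- primes d) F q = \sum_(0 <= q < n | prime q && (q %| d)%N) F q.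
Proof.
move=> /andP[d0 dn]; rewrite -[RHS]big_filter; apply/perm_big/uniq_perm.
- exact: primes_uniq.
- by rewrite filter_uniq// iota_uniq.
move=> q; rewrite mem_filter mem_primes mem_index_iota d0 /=.
case: (prime q) => //=; case: (boolP (q %| d)%N) => //= qd.
by rewrite (leq_ltn_trans (dvdn_leq d0 qd) dn).
Qed.

Definition share q d : R := (logn q d)%:R * ln q%:R / ln d%:R.

Lemma share_ge0 q d : 0 <= share q d.
Proof. by rewrite /share divr_ge0 ?mulr_ge0// ln_nat_ge0. Qed.

Lemma sum_share_le1 d : (0 < d)%N -> \sum_(q <- primes d) share q d <= 1.
Proof.
move=> d0; rewrite /share -mulr_suml sum_logn_ln//.
have [->|nondeg] := eqVneq (ln d%:R : R) 0; first by rewrite mul0r.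
by rewrite divff.
Qed.

(** The point i y + w lies within 1 of the integer j = floor (i y) + w, at the cost of e^ga. A given
    j arises from at most W / y + 1 values of i, which with the factor y makes W + y. *)
Lemma K_double_sum (x y h : R) (W : nat) : 0 < y -> 0 <= h ->
  \sum_(0 <= w < W) \sum_(1 <= i < (Num.truncn (h / y)).+1) y * K (x + i%:R * y + w%:R)
  <= expR (ga be) * (W%:R + y) * \sum_(0 <= j < (Num.truncn h).+1 + W) K (x + j%:R).
Proof.
move=> y0 h0; set I := Num.truncn (h / y); set n1 := ((Num.truncn h).+1 + W)%N.
pose t (i : nat) := Num.truncn (i%:R * y).
have tP i : (t i)%:R <= i%:R * y < (t i).+1%:R.
  by apply: truncn_itv; rewrite mulr_ge0// ltW.
have K0 z : 0 <= K z by rewrite ltW// K_gt0.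
have tI i : (i <= I)%N -> (t i <= Num.truncn h)%N.
  move=> iI; apply: le_truncn; rewrite -ler_pdivlMr//.
  have /andP[I1 _] : I%:R <= h / y < I.+1%:R by apply: truncn_itv; rewrite divr_ge0// ltW.
  by apply: le_trans I1; rewrite ler_nat.
pose In (j i : nat) := ((t i <= j) && (j < t i + W))%N.
have one i : (i <= I)%N -> \sum_(0 <= w < W) y * K (x + i%:R * y + w%:R) <=
    \sum_(0 <= j < n1) (if In j i then y * (expR (ga be) * K (x + j%:R)) else 0).
  move=> iI.
  apply: (@le_trans _ _ (\sum_(0 <= w < W) y * (expR (ga be) * K (x + (w + t i)%N%:R)))).
    apply: ler_sum => w _; rewrite ler_pM2l//.
    have /andP[t1 t2] := tP i.
    have -> : x + i%:R * y + w%:R = x + (w + t i)%:R + (i%:R * y - (t i)%:R).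
      by rewrite natrD; ring.
    apply: le_trans (K_shift be0 _ _) _; rewrite ler_wpM2r// ler_expR.
    rewrite ler_piMr ?ltW//; first by apply: lt_trans (ga_gt1 be0).
    move: t2; rewrite -natr1 => t2.
    rewrite ger0_norm; last by rewrite subr_ge0.
    by clear -t2; rewrite ltrBlDr addrC.
  have tn : (t i + W <= n1)%N by rewrite /n1 leq_add2r leqW// tI.
  rewrite [leRHS](@big_cat_nat _ _ _ (t i))//=; last exact: leq_trans (leq_addr W _) tn.
  rewrite [X in _ <= X + _](_ : _ = 0) ?add0r; last first.
    by rewrite big_nat big1// => j /andP[_ jt]; rewrite /In leqNgt jt.
  rewrite [leRHS](@big_cat_nat _ _ _ (t i + W))//= ?leq_addr//.
  rewrite [X in _ <= _ + X](_ : _ = 0) ?addr0; last first.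
    by rewrite big_nat big1// => j /andP[jt _]; rewrite /In ltnNge jt andbF.
  rewrite -{2}[t i]add0n big_addn addKn.
  rewrite big_nat [leRHS]big_nat; apply: ler_sum => w /andP[_ wW].
  by rewrite /In leq_addl addnC ltn_add2l wW.
rewrite exchange_big /=.
apply: (@le_trans _ _ (\sum_(1 <= i < I.+1) \sum_(0 <= j < n1)
   (if In j i then y * (expR (ga be) * K (x + j%:R)) else 0))).
  rewrite big_nat [leRHS]big_nat; apply: ler_sum => i /andP[_ iI].
  exact: one.
rewrite exchange_big /= mulr_sumr; apply: ler_sum => j _.
rewrite -big_mkcond /= big_const_seq iter_addr addr0.
have cnt : (count (In j) (index_iota 1 I.+1))%:R * y <= W%:R + y.
  rewrite -ler_pdivlMr//.
  have -> : (W%:R + y) / y = W%:R / y + 1 by field; rewrite gt_eqF.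
  apply: le_trans (@count_spread _ (In j) I.+1 (W%:R / y) _ _).
  - by rewrite ler_nat /index_iota subn0 subn1 /= leq_addl.
  - by rewrite divr_ge0// ltW.
  move=> i i' /andP[_ h1] /andP[h2 _]; rewrite ler_pdivlMr// mulrBl.
  have /andP[a1 a2] := tP i; have /andP[b1 b2] := tP i'.
  have : (t i').+1%:R <= (t i)%:R + W%:R :> R by rewrite -natrD ler_nat; lia.
  by clear -a1 b2; lra.
set E := expR _; set Kj := K _; set c := count _ _ in cnt *.
rewrite -[_ *+ c]mulr_natl.
have -> : c%:R * (y * (E * Kj)) = c%:R * y * (E * Kj) by ring.
have -> : E * (W%:R + y) * Kj = (W%:R + y) * (E * Kj) by ring.
by rewrite ler_wpM2r// mulr_ge0// expR_ge0.
Qed.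

(** The h of the overview, a constant multiple of H. With 64, at most Om blocks of size below 2 h
    make up at most V / 32 of ln d. *)
Definition hscale s : R := V s / (64 * Om s).

Lemma hscale_gt0 s : 0 < s -> 0 < hscale s.
Proof. by move=> s0; rewrite divr_gt0 ?V_gt0// mulr_gt0// Om_gt0. Qed.

Definition big s q d := (2 * hscale s <= (logn q d)%:R * ln q%:R) && (ln q%:R <= L s).

(** A good d has ln d >= 7/16 V. Its small blocks account for at most V / 32 of this and its large
    primes for at most V / 16, together less than half. *)
Lemma big_blocks s v d : 0 < s -> (0 < d)%N -> V s / 2 <= v -> good s 16^-1 v d ->
  2^-1 <= \sum_(q <- primes d | big s q d) share q d.
Proof.
move=> s0 d0 vV /and3P[g1 g2 g3].
have V0 := V_gt0 s; have O0 := Om_gt0 s0; have h0 := ltW (hscale_gt0 s0).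
have h20 : 0 <= 2 * hscale s by rewrite mulr_ge0.
have D1 : 7 / 16 * V s <= ln d%:R.
  by move: g1; rewrite ler_norml => /andP[g1 _]; clear -g1 vV; lra.
have D0 : 0 < ln d%:R :> R by clear -D1 V0; lra.
have tot1 := sum_logn_ln d0.
have l0 q : 0 <= (logn q d)%:R * ln q%:R :> R by rewrite mulr_ge0// ln_nat_ge0.
have split3 : ln d%:R <= \sum_(q <- primes d | big s q d) (logn q d)%:R * ln q%:R
   + (\sum_(q <- primes d) 2 * hscale s + \sum_(q <- primes d | q \in large_prime s) (logn q d)%:R * ln q%:R).
  rewrite -tot1 [X in X + _]big_mkcond [X in _ + (_ + X)]big_mkcond -!big_split /=.

  apply: ler_sum => q _; rewrite inE /= /big ltNge.
  case: (lerP (2 * hscale s) ((logn q d)%:R * ln q%:R)) => b1; case: (ln q%:R <= L s) => /=;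
    have := l0 q; clear -b1 h20; lra.
rewrite sum_logn_ln_part// in split3.
have c2 : \sum_(q <- primes d) 2 * hscale s <= V s / 32.
  rewrite big_const_seq count_predT iter_addr addr0 -[_ *+ _]mulr_natl.
  apply: (@le_trans _ _ (Om s * (2 * hscale s))).
    by rewrite ler_wpM2r.
  by rewrite le_eqVlt; apply/orP; left; apply/eqP; rewrite /hscale; field; rewrite gt_eqF.
rewrite /share -mulr_suml ler_pdivlMr//.
move: split3 c2 g3; move: (\sum_(_ <- _ | _) _) (\sum_(_ <- _) _) => a b.
by clear -D1 V0; lra.
Qed.

(* Replacing q^e || d by q^(e-i) keeps amul and shrinks ln d by i ln q; at most half of the
   block is removed, so the share of q in d' is at least half its share in d. *)
Lemma block_shift s al v q i n : 0 < s -> adm al -> prime q -> (0 < i)%N ->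
  i%:R * ln q%:R <= hscale s ->
  \sum_(1 <= d < n | big s q d) share q d * term al v d
  <= \sum_(1 <= m < n | (q %| m)%N) 2 * share q m * (amul al m * K (ln m%:R - v + i%:R * ln q%:R)).
Proof.
move=> s0 had pq i0 ih.
have lq : 0 < ln q%:R :> R by apply: ln_prime_gt0.
have am0 d : 0 <= amul al d by apply: amul_ge0; apply: adm_ge0.
have K0 z : 0 <= K z by rewrite ltW// K_gt0.
pose w d := if big s q d then share q d * term al v d else 0.
have w0 d : 0 <= w d by rewrite /w; case: ifP => // _; rewrite mulr_ge0 ?share_ge0 ?term_ge0.
have qi0 : (0 < q ^ i)%N by rewrite expn_gt0 prime_gt0.
have lb d : big s q d -> (i.*2 <= logn q d)%N.
  move=> /andP[b1 _]; rewrite -(ler_nat R) -(ler_pM2r lq); apply: le_trans b1.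
  by rewrite -muln2 natrM; clear -ih; lra.
have -> : \sum_(1 <= d < n | big s q d) share q d * term al v d
   = \sum_(1 <= d < n | (q ^ i %| d)%N) w d.
  rewrite big_mkcond [RHS]big_mkcond big_nat [RHS]big_nat; apply: eq_bigr => d /andP[d0 _].
  rewrite /w; case: ifP => [bd|_]; last by case: ifP.
  have l2 := lb d bd.
  by rewrite pfactor_dvdn// (leq_trans _ l2)// -addnn leq_addr.
apply: le_trans (sum_multiples_le _ w0 qi0) _.
rewrite [leRHS]big_mkcond [leLHS]big_nat [leRHS]big_nat; apply: ler_sum => m /andP[m0 _].
rewrite /w; case: ifP => [bd|_]; last first.
  case: ifP => // _; apply: mulr_ge0; last exact: mulr_ge0.
  by apply: mulr_ge0 => //; apply: share_ge0.
have := lb _ bd; rewrite lognM// pfactorK// => l1.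
have l2 : (i <= logn q m)%N by lia.
have qm : (q %| m)%N by rewrite -(expn1 q) pfactor_dvdn//; lia.
have lm : 0 < ln m%:R :> R.
  by rewrite ln_gt0// ltr1n; apply: leq_trans (prime_gt1 pq) (dvdn_leq m0 qm).
rewrite qm /term amul_pXM// ln_natM// natrX lnXn ?ltr0n ?prime_gt0// -[_ *+ i]mulr_natl.
have -> : i%:R * ln q%:R + ln m%:R - v = ln m%:R - v + i%:R * ln q%:R by ring.
rewrite ler_wpM2r//; first by rewrite mulr_ge0.
rewrite /share lognM// pfactorK// ln_natM// natrX lnXn ?ltr0n ?prime_gt0// -[_ *+ i]mulr_natl natrD.
have il : i%:R <= (logn q m)%:R :> R by rewrite ler_nat.
have iq : 0 <= i%:R * ln q%:R :> R by rewrite mulr_ge0// ltW.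
have i0R : 0 <= i%:R :> R by [].
rewrite mulrA ler_pM//.
- by rewrite mulr_ge0// ?addr_ge0// ltW.
- by rewrite invr_ge0; clear -iq lm; lra.
- by rewrite mulrA ler_pM2r//; clear -il; lra.
by rewrite lef_pV2 ?posrE//; clear -iq lm; lra.
Qed.

(** For good d the big blocks carry half of the shares, and each offers about h / ln q possible
    removals, weighted by ln q. After [block_shift] the shares of a fixed m sum to at most 1. The
    extra average over w < W smooths the lattice of step ln q <= L: the loss is (W + L) / W, bounded
    once W is comparable with L. *)
Lemma averaging_psum s al v (W n : nat) : 1 <= s -> 2 * L s <= hscale s -> adm al -> V s / 2 + W%:R <= v ->
  hscale s / 4 * \sum_(0 <= w < W) \sum_(1 <= d < n | good s 16^-1 (v - w%:R) d) term al (v - w%:R) d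
  <= 2 * expR (ga be) * (W%:R + L s)
     * \sum_(0 <= j < (Num.truncn (hscale s)).+1 + W) psum (term al (v - j%:R)) n.
Proof.
move=> s1 Lh had vW.
have s0 : 0 < s by clear -s1; lra.
have L0 : 0 < L s by rewrite exprn_gt0// X_gt0.
have h0 : 0 < hscale s by clear -Lh L0; lra.
have h20 : 0 < hscale s / 2 by clear -h0; lra.
have am0 d : 0 <= amul al d by apply: amul_ge0; apply: adm_ge0.
pose I q := Num.truncn (hscale s / ln q%:R).
have IP q : prime q -> (I q)%:R * ln q%:R <= hscale s < (I q).+1%:R * ln q%:R.
  move=> pq; have lq : 0 < ln q%:R :> R by apply: ln_prime_gt0.
  rewrite -ler_pdivlMr// -ltr_pdivrMr//; apply: truncn_itv.
  by rewrite divr_ge0// ltW.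
apply: (@le_trans _ _ (\sum_(0 <= w < W) \sum_(0 <= q < n | prime q && (ln q%:R <= L s))
   \sum_(1 <= i < (I q).+1) ln q%:R *
     \sum_(1 <= d < n | big s q d) share q d * term al (v - w%:R) d)).
  rewrite mulr_sumr big_nat [leRHS]big_nat; apply: ler_sum => w /andP[_ wW].
  have t0 d : 0 <= term al (v - w%:R) d by apply: term_ge0.
  have vw : V s / 2 <= v - w%:R.
    have : w%:R <= W%:R :> R by rewrite ler_nat ltnW.
    by clear -vW; lra.
  apply: (@le_trans _ _ (\sum_(0 <= q < n | prime q && (ln q%:R <= L s)) hscale s / 2 *
     \sum_(1 <= d < n | big s q d) share q d * term al (v - w%:R) d)); last first.
    apply: ler_sum => q /andP[pq qL].
    have lq : 0 < ln q%:R :> R by apply: ln_prime_gt0.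
    rewrite big_const_nat subn1 /= iter_addr addr0 -[_ *+ I q]mulr_natl mulrA ler_wpM2r//.
      by apply: sumr_ge0 => d _; rewrite mulr_ge0 ?share_ge0.
    have /andP[_] := IP q pq; rewrite -natr1 mulrDl mul1r; clear -qL Lh; lra.
  under [leRHS]eq_bigr do rewrite big_mkcond mulr_sumr.
  rewrite exchange_big /= mulr_sumr big_mkcond big_nat [leRHS]big_nat.
  apply: ler_sum => d /andP[d0 dn].
  have r0 : 0 <= \sum_(0 <= q < n | prime q && (ln q%:R <= L s))
     hscale s / 2 * (if big s q d then share q d * term al (v - w%:R) d else 0).
    apply: sumr_ge0 => q _; apply: mulr_ge0; first by clear -h0; lra.
    by case: ifP => // _; rewrite mulr_ge0 ?share_ge0.
  case: ifP => gd //.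
  have := big_blocks s0 d0 vw gd.
  set S1 := \sum_(_ <- _ | _) _ => hS.
  apply: (@le_trans _ _ (hscale s / 2 * (S1 * term al (v - w%:R) d))).
    have := t0 d; set T := term _ _ d => T0.
    have -> : hscale s / 4 * T = hscale s / 2 * (2^-1 * T) by field.
    by rewrite ler_pM2l// ler_wpM2r.
  rewrite -mulr_sumr ler_pM2l// /S1 mulr_suml big_mkcond /=.
  rewrite (@sum_primesE _ d n) ?d0//.
  rewrite big_mkcond [leRHS]big_mkcond; apply: ler_sum => q _.
  case: (boolP (prime q)) => pq //=; case: (boolP (q %| d)%N) => qd /=; last first.
    by case: ifP => // _; case: ifP => // _; rewrite mulr_ge0 ?share_ge0.
  rewrite /big; case: (ln q%:R <= L s) => /=; last by rewrite andbF.
  by [].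
set n1 := ((Num.truncn (hscale s)).+1 + W)%N.
apply: (@le_trans _ _ (\sum_(0 <= w < W) \sum_(0 <= q < n | prime q && (ln q%:R <= L s))
   \sum_(1 <= i < (I q).+1) ln q%:R *
     \sum_(1 <= m < n | (q %| m)%N) 2 * share q m * (amul al m *
        K (ln m%:R - (v - w%:R) + i%:R * ln q%:R)))).
  apply: ler_sum => w _; apply: ler_sum => q /andP[pq _].
  have lq : 0 < ln q%:R :> R by apply: ln_prime_gt0.
  rewrite big_nat [leRHS]big_nat; apply: ler_sum => i /andP[i0 iI].
  rewrite ler_pM2l//; apply: block_shift => //.
  have /andP[h1 _] := IP q pq; apply: le_trans h1.
  by rewrite ler_pM2r// ler_nat -ltnS.
have K0 z : 0 <= K z by rewrite ltW// K_gt0.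
rewrite exchange_big /=.
apply: (@le_trans _ _ (\sum_(0 <= q < n | prime q && (ln q%:R <= L s))
   \sum_(1 <= m < n | (q %| m)%N) 2 * share q m * amul al m *
     (expR (ga be) * (W%:R + L s) * \sum_(0 <= j < n1) K (ln m%:R - v + j%:R)))).
  apply: ler_sum => q /andP[pq qL].
  have lq : 0 < ln q%:R :> R by apply: ln_prime_gt0.
  under eq_bigr => w _ do (under eq_bigr => i _ do rewrite mulr_sumr; rewrite exchange_big /=).
  rewrite exchange_big /=; apply: ler_sum => m _.
  have -> : \sum_(0 <= w < W) \sum_(1 <= i < (I q).+1) ln q%:R * (2 * share q m *
       (amul al m * K (ln m%:R - (v - w%:R) + i%:R * ln q%:R)))
    = 2 * share q m * amul al m * \sum_(0 <= w < W) \sum_(1 <= i < (I q).+1)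
       ln q%:R * K (ln m%:R - v + i%:R * ln q%:R + w%:R).
    rewrite mulr_sumr; apply: eq_bigr => w _; rewrite mulr_sumr; apply: eq_bigr => i _.
    have -> : ln m%:R - (v - w%:R) + i%:R * ln q%:R = ln m%:R - v + i%:R * ln q%:R + w%:R by ring.
    by ring.
  apply: ler_wpM2l.
    by apply: mulr_ge0 => //; apply: mulr_ge0 => //; apply: share_ge0.
  apply: le_trans (K_double_sum _ W lq (ltW h0)) _.
  rewrite ler_wpM2r ?sumr_ge0// ler_pM2l ?expR_gt0// lerD2l//.
under [leLHS]eq_bigr do rewrite big_mkcond.
rewrite exchange_big /=.
have -> : \sum_(0 <= j < n1) psum (term al (v - j%:R)) n =
  \sum_(1 <= m < n) amul al m * \sum_(0 <= j < n1) K (ln m%:R - v + j%:R).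
  rewrite /psum exchange_big /=; apply: eq_bigr => m _; rewrite mulr_sumr.
  apply: eq_bigr => j _; rewrite /term; congr (_ * K _).
  by ring.
rewrite mulr_sumr [leLHS]big_nat [leRHS]big_nat; apply: ler_sum => m /andP[m0 mn].
set S := \sum_(0 <= j < n1) _; have S0 : 0 <= S by apply: sumr_ge0.
set E := expR _; have E0 : 0 <= E by apply: expR_ge0.
have C0 : 0 <= 2 * E * (W%:R + L s) * (amul al m * S).
  apply: mulr_ge0; last exact: mulr_ge0.
  by apply: mulr_ge0; [apply: mulr_ge0 | rewrite addr_ge0// ltW].
apply: (@le_trans _ _ (\sum_(q <- primes m) share q m * (2 * E * (W%:R + L s) * (amul al m * S)))).
  rewrite (@sum_primesE _ m n) ?m0// big_mkcond [leRHS]big_mkcond; apply: ler_sum => q _.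
  have sh := share_ge0 q m.
  have B0 := mulr_ge0 sh C0.
  case: (prime q) => //=; case: (ln q%:R <= L s); case: (q %| m)%N => //=.
  by rewrite le_eqVlt; apply/orP; left; apply/eqP; ring.
by rewrite -mulr_suml ler_piMl// sum_share_le1.
Qed.

Lemma tot_sum (g : nat -> nat -> R) W : (forall w, summable (g w)) ->
  summable (fun d => \sum_(0 <= w < W) g w d) /\
  tot (fun d => \sum_(0 <= w < W) g w d) = \sum_(0 <= w < W) tot (g w).
Proof.
move=> sg; elim: W => [|W [IHs IHt]].
  have e n : psum (fun d => \sum_(0 <= w < 0) g w d) n = 0.
    by rewrite /psum big1// => d _; rewrite big_geq.
  split; first by split=> [d|]; [rewrite big_geq | exists 0 => n; rewrite e].
  rewrite [RHS]big_geq//; apply/eqP; rewrite eq_le; apply/andP; split.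
    by apply: tot_le => n; rewrite e.
  by apply: tot_ge0; split=> [d|]; [rewrite big_geq | exists 0 => n; rewrite e].
have e d : \sum_(0 <= w < W.+1) g w d = \sum_(0 <= w < W) g w d + g W d.
  by rewrite big_nat_recr.
split.
  case: IHs (sg W) => [h0 [M HM]] [h0' [M' HM']]; split=> [d|].
    by rewrite e addr_ge0.
  exists (M + M') => n; rewrite /psum (eq_bigr _ (fun d _ => e d)) big_split /=.
  by apply: lerD; [apply: HM|apply: HM'].
rewrite (eq_tot (w' := fun d => \sum_(0 <= w < W) g w d + g W d)) => [|d _]; last exact: e.
by rewrite totD// IHt big_nat_recr.
Qed.

Definition CA : R := 16 * expR (ga be).

Lemma averaging : large (fun s => forall al v (W : nat), regular s al ->
  V s / 2 + W%:R <= v <= 2 * V s ->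
  hscale s * \sum_(0 <= w < W) f al (v - w%:R)
  <= CA * (W%:R + L s) * \sum_(0 <= j < (Num.truncn (hscale s)).+1 + W) f al (v - j%:R)).
Proof.
have CP0 := CP_gt0 R.
have ep : 0 < (16^-1 : R) <= 4^-1 by apply/andP; split; lra.
have := large_and (tot_good be0 ep) (large_and (large_X (128 * (CP R + 6)) 0) (large_ge 1)).
apply: large_imp => s [h1 [h2 s1]] al v W hcl /andP[v1 v2].
rewrite expr0 mulr1 in h2.
have [had sn _] := hcl.
have s0 : 0 < s by clear -s1; lra.
have L0 : 0 < L s by rewrite exprn_gt0// X_gt0.
have Lh : 2 * L s <= hscale s.
  rewrite /hscale ler_pdivlMr; last by apply: mulr_gt0 => //; exact: Om_gt0.
  have X0 := X_gt0 s; have X1 := X_ge1 s.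
  have NX : N s <= X s ^+ 8 by rewrite /N ler_pdivrMr// ler_peMr// exprn_ge0// ltW.
  apply: (@le_trans _ _ (2 * X s ^+ 4 * (64 * ((CP R + 6) * X s ^+ 8)))).
    apply: ler_wpM2l; first by rewrite mulr_ge0// exprn_ge0// ltW.
    by rewrite ler_pM2l// /Om ler_pM2l//; clear -CP0; lra.
  have -> : 2 * X s ^+ 4 * (64 * ((CP R + 6) * X s ^+ 8)) = 128 * (CP R + 6) * X s ^+ 12 by ring.
  apply: (@le_trans _ _ (X s * X s ^+ 12)); first by rewrite ler_pM2r ?exprn_gt0.
  by rewrite -exprS /V; apply: ler_weXn2l.
pose g (w : nat) d := if good s 16^-1 (v - w%:R) d then term al (v - w%:R) d else 0.
have sg w : summable (g w).
  apply: (@summable_le _ _ (term al (v - w%:R))) => [d||d _]; rewrite /g.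
  - by case: ifP => // _; apply: term_ge0.
  - exact: summable_term.
  - by case: ifP => // _; apply: term_ge0.
have [sS tS] := tot_sum W sg.
have h0 := hscale_gt0 s0.
have st j := summable_term be0 (v - j%:R) had.
apply: (@le_trans _ _ (hscale s * \sum_(0 <= w < W) 2 * tot (g w))).
  rewrite ler_pM2l// big_nat [leRHS]big_nat; apply: ler_sum => w /andP[_ wW].
  apply: h1 => //.
  have : w%:R <= W%:R :> R by rewrite ler_nat ltnW.
  have : 0 <= w%:R :> R by [].
  by clear -v1 v2 => *; apply/andP; split; lra.
rewrite -mulr_sumr -tS.
have -> : hscale s * (2 * tot (fun d => \sum_(0 <= w < W) g w d)) =
   8 * tot (fun d => hscale s / 4 * \sum_(0 <= w < W) g w d).
  rewrite totZ//; first by field.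
  by rewrite divr_ge0// ltW.
have -> : CA * (W%:R + L s) = 8 * (2 * expR (ga be) * (W%:R + L s)) by rewrite /CA; ring.
rewrite -mulrA ler_pM2l//; apply: tot_le => n.
rewrite /psum -mulr_sumr exchange_big /=.
apply: (@le_trans _ _ (2 * expR (ga be) * (W%:R + L s)
     * \sum_(0 <= j < (Num.truncn (hscale s)).+1 + W) psum (term al (v - j%:R)) n)); last first.
  rewrite ler_wpM2l//; last by apply: ler_sum => j _; apply: psum_le_tot.
  by rewrite mulr_ge0 ?mulr_ge0 ?expR_ge0// addr_ge0// ltW.
apply: le_trans (averaging_psum n s1 Lh had v1).
rewrite ler_wpM2l//; first by clear -h0; lra.
by apply: ler_sum => w _; rewrite /g -big_mkcond.
Qed.

End Blocks.

(** * Local regularity of f at the scale h *)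

Section Slow.
Variable R : realType.
Variable be : R.
Hypothesis be0 : 0 < be.
Implicit Types (s v : R) (al : nat -> R).
Local Notation f := (f be).

(** With two small primes available one can itself be removed: the other still gives
    quasi-monotonicity of what remains. *)
Definition two_small al := exists b b', [/\ prime b, prime b', (b <= 11)%N, (b' <= 11)%N & b != b']
  /\ (nondeg al b /\ nondeg al b').

Definition regular2 s al := [/\ adm al, two_small al & forall q, fresh s q -> nondeg al q].

Lemma regular2_regular s al : regular2 s al -> regular s al.
Proof. by move=> [h [b [b' [[pb _ b11 _ _] [nb _]]]] hq]; split=> //; exists b. Qed.

Lemma hscaleE s : 0 < s -> hscale s = (X s ^+ 8 * s) / (64 * (CP R + 6)).
Proof.
move=> s0; have C0 := CP_gt0 R; have X0 := X_gt0 s.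
rewrite /hscale /V /Om /N; field.
by rewrite !gt_eqF//; lra.
Qed.

Lemma fresh_gt11 : large (fun s => forall q, fresh s q -> (11 < q)%N).
Proof.
apply: large_imp (large_X (11 : R) 0) => s h q /andP[_ /andP[q1 _]].
rewrite expr0 mulr1 in h.
rewrite -(ltr_nat R); apply: le_lt_trans q1; apply: (le_trans h).
by rewrite /V -exprM; apply: ler_eXnr => //; exact: X_ge1.
Qed.

Definition C2 : R := 528 * CA be * CQ be.

Lemma CA_gt0 : 0 < CA be. Proof. by rewrite mulr_gt0// expR_gt0. Qed.
Lemma CQ_gt0 : 0 < CQ be. Proof. by apply: lt_le_trans (CQ_ge1 be0). Qed.

(** [averaging] for f_b with the single-point window W = 1, at the price of a factor L, followed by
    [sum_f_rem_le]. *)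
Lemma f_rem_small : large (fun s => forall al v b,
  regular s al -> regular s (rem al b) -> prime b -> (b <= 11)%N -> nondeg al b ->
  V s / 2 + 1 <= v <= 2 * V s -> f (rem al b) v <= C2 * (L s / hscale s) * f al v).
Proof.
have := large_and (averaging be0) (large_ge 1).
apply: large_imp => s [h1 s1] al v b hcl hclr pb b11 nb hv.
have [had _ _] := hcl; have [hadr snr _] := hclr.
have s0 : 0 < s by clear -s1; lra.
have h0 := hscale_gt0 s0; have L1 : 1 <= L s by apply: exprn_ege1; exact: X_ge1.
have := h1 (rem al b) v 1%N hclr hv.
rewrite big_nat1 subr0 => h2.
have := sum_f_rem_le be0 v ((Num.truncn (hscale s)).+1 + 1) had pb snr nb.
set S := \sum_(_ <= _ < _) _ in h2 * => h3.
have fv := f_ge0 be0 v had.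
have bR : b%:R <= 11 :> R by rewrite ler_nat.
have b1 : 1 <= b%:R :> R by rewrite ler1n prime_gt0.
have lb : ln b%:R <= 11 :> R.
  by apply: (le_trans (ltW (ln_sublinear _))) => //; clear -b1; lra.
have CA0 := CA_gt0; have CQ0 := CQ_gt0.
have S1 : S <= 264 * CQ be * f al v.
  apply: (le_trans h3); rewrite ler_wpM2r//.
  have -> : 264 * CQ be = 2 * CQ be * 12 * 11 by ring.
  apply: ler_pM => //; first last.
  - apply: ler_wpM2l; first by apply: mulr_ge0 => //; exact: ltW.
    by clear -lb; lra.
  - by apply: mulr_ge0; [rewrite mulr_ge0// ltW| rewrite addr_ge0// ln_nat_ge0].
have -> : C2 * (L s / hscale s) * f al v = (CA be * (2 * L s) * (264 * CQ be * f al v)) / hscale s.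
  by rewrite /C2; field; rewrite gt_eqF.
rewrite ler_pdivlMr// mulrC; apply: (le_trans h2).
apply: ler_pM => //.
- by rewrite mulr_ge0 ?(ltW CA0)//; clear -L1; lra.
- by apply: sumr_ge0 => j _; apply: f_ge0.
- by rewrite ler_pM2l//; clear -L1; lra.
Qed.

Lemma bernoulli (d : R) n : 0 <= d <= 1 -> 1 - n%:R * d <= (1 - d) ^+ n.
Proof.
move=> /andP[d0 d1]; elim: n => [|n IH]; first by rewrite expr0 mul0r subr0.
rewrite exprS -[n.+1%:R]natr1.
have n0 : 0 <= n%:R :> R by [].
apply: (@le_trans _ _ ((1 - d) * (1 - n%:R * d))); last by rewrite ler_wpM2l// subr_ge0.
have : 0 <= n%:R * d * d by rewrite !mulr_ge0.
by clear; lra.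
Qed.

(** By [f_sub_shift] one step of ln b loses at most a proportion d = O(L / h) of f. About L steps
    lose O(L^2 / h), which is O(1 / s) because L = X^4 is the square root of X^8; this fixes the
    choice of L. *)
Lemma f_back : large (fun s => forall al v (u : R), regular2 s al ->
  5 / 8 * V s <= v <= 2 * V s -> 0 <= u <= 2 * L s -> f al v <= 2 * CQ be * f al (v - u)).
Proof.
have CA0 := CA_gt0; have CQ0 := CQ_gt0; have CP0 := CP_gt0 R.
have C20 : 0 < C2 by apply: mulr_gt0 => //; apply: mulr_gt0.
have := large_and f_rem_small (large_and fresh_gt11 (large_and (large_X 200 0)
  (large_ge (1 + 10 * C2 * (64 * (CP R + 6)))))).
apply: large_imp => s [h1 [h11 [hX hs]]] al v u hcl2 /andP[v1 v2] /andP[u0 u1].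
rewrite expr0 mulr1 in hX.
have hcl := regular2_regular hcl2; have [had [b [b' [[pb pb' b11 b11' bb'] [nb nb']]]] hq] := hcl2.
have hclr : regular s (rem al b).
  split; first exact: adm_rem.
    by exists b'; split=> //; apply: nondeg_rem => //; rewrite eq_sym.
  by move=> q fq; apply: nondeg_rem; [rewrite gtn_eqF// (leq_ltn_trans b11)// h11|exact: hq].
have s1 : 1 <= s.
  apply: le_trans hs; rewrite lerDl; apply: mulr_ge0; last by clear -CP0; lra.
  by apply: mulr_ge0 => //; exact: ltW.
have s0 : 0 < s by clear -s1; lra.
have h0 := hscale_gt0 s0; have L1 : 1 <= L s by apply: exprn_ege1; exact: X_ge1.
have V0 := V_gt0 s; have X0 := X_gt0 s; have X1 := X_ge1 s.
have LV : 200 * L s <= V s.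
  have -> : V s = X s ^+ 12 * L s by rewrite /V /L; ring.
  by rewrite ler_pM2r ?exprn_gt0//; apply: (le_trans hX); apply: ler_eXnr.
set d := C2 * (L s / hscale s).
have d0 : 0 <= d.
  apply: mulr_ge0; first exact: ltW.
  by apply: divr_ge0; [clear -L1; lra | exact: ltW].
have dL : d * (5 * L s) <= 2^-1.
  rewrite /d (hscaleE s0).
  have -> : C2 * (L s / (X s ^+ 8 * s / (64 * (CP R + 6)))) * (5 * L s) =
    5 * C2 * (64 * (CP R + 6)) / s.
    by rewrite /L; field; rewrite !gt_eqF//; clear -CP0; lra.
  by rewrite ler_pdivrMr//; clear -hs; lra.
have lb : 2^-1 <= ln b%:R :> R.
  by apply: (le_trans (ln2_ge R)); rewrite ler_ln ?posrE ?ltr0n ?prime_gt0// ler_nat prime_gt1.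
have lb11 : ln b%:R <= 11 :> R.
  apply: (le_trans (ltW (ln_sublinear _))); first by rewrite ltr0n prime_gt0.
  by rewrite ler_nat.
have lb0 : 0 < ln b%:R :> R by clear -lb; lra.
have step (w : R) : V s / 2 + 1 <= w <= 2 * V s -> (1 - d) * f al w <= f al (w - ln b%:R).
  move=> hw; have := h1 al w b hcl hclr pb b11 nb hw; rewrite -/d => k1.
  have := f_sub_shift be0 w had pb.
  have hr := adm_rem b had; have y0 := f_ge0 be0 (w - ln b%:R) hr.
  have [a0 /(_ pb) a1] := had b.
  have a1' : al b <= 1 by apply: (le_trans a1); rewrite invf_le1 ?ltr0n ?ler1n ?prime_gt0.
  have : 0 <= (1 - al b) * f (rem al b) (w - ln b%:R) by rewrite mulr_ge0// subr_ge0.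
  by clear -k1; lra.
have d1 : d <= 1 by clear -dL L1 d0; nra.
have iter k : V s / 2 + 1 <= v - k%:R * ln b%:R -> (1 - d) ^+ k * f al v <= f al (v - k%:R * ln b%:R).
  elim: k => [|k IH]; first by rewrite mul0r subr0 expr0 mul1r.
  rewrite -[k.+1%:R]natr1 mulrDl mul1r => hk.
  have hk' : V s / 2 + 1 <= v - k%:R * ln b%:R by clear -hk lb0; lra.
  have kk : 0 <= k%:R * ln b%:R :> R by rewrite mulr_ge0// ltW.
  rewrite exprS -mulrA opprD addrA.
  apply: le_trans (step _ _); last by apply/andP; split=> //; clear -kk v2; lra.
  by rewrite ler_wpM2l ?subr_ge0// IH.
pose k := (Num.truncn (u / ln b%:R)).+1.
have /andP[k1 k2] : (Num.truncn (u / ln b%:R))%:R <= u / ln b%:R < k%:R.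
  by apply: truncn_itv; rewrite divr_ge0// ltW.
have kE : k%:R = (Num.truncn (u / ln b%:R))%:R + 1 :> R by rewrite natr1.
have k3 : u < k%:R * ln b%:R by rewrite -ltr_pdivrMr.
have k4 : k%:R * ln b%:R <= u + 11.
  rewrite kE mulrDl mul1r; apply: lerD => //.
  by rewrite -ler_pdivlMr.
have k5 : k%:R <= 5 * L s.

  have : k%:R <= u / ln b%:R + 1 by rewrite kE lerD2r.
  have : u / ln b%:R <= u * 2 by rewrite ler_pdivrMr//; clear -lb u0; nra.
  by clear -u1 L1; lra.
have := iter k _; rewrite /=.
have -> : V s / 2 + 1 <= v - k%:R * ln b%:R by clear -v1 LV k4 u1 L1 V0; lra.
move=> /(_ isT) hit.
have fv := f_ge0 be0 v had.
have half : 2^-1 * f al v <= CQ be * f al (v - u).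
  apply: (@le_trans _ _ ((1 - d) ^+ k * f al v)).
    rewrite ler_wpM2r//; apply: le_trans (bernoulli k _); last by rewrite d0.
    have : k%:R * d <= 2^-1.
      by apply: le_trans dL; rewrite mulrC ler_wpM2l.
    by clear; lra.
  apply: (le_trans hit); apply: f_quasi_mono => //; first by case: hcl.
  by clear -k3; lra.
by clear -half; lra.
Qed.

Definition C4 : R := 4 * CA be * CQ be.

Lemma C4_gt0 : 0 < C4.
Proof. by apply: mulr_gt0; [apply: mulr_gt0 => //; exact: CA_gt0 | exact: CQ_gt0]. Qed.

(** [averaging] with W about L, started at v + w0 so that its whole left window lies above v, where
    quasi-monotonicity applies. On the right, the points above v number at most L and are bounded by
    f v through [f_back]; since L is much smaller than h they are absorbed, and the points from v
    downwards remain without the factor L. *)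
Lemma f_le_average : large (fun s => forall al v, regular2 s al ->
  3 / 4 * V s <= v <= 3 / 2 * V s ->
  hscale s * f al v <= C4 * \sum_(0 <= i < (Num.truncn (hscale s)).+2) f al (v - i%:R)).
Proof.
have CA0 := CA_gt0; have CQ0 := CQ_gt0; have CP0 := CP_gt0 R.
have := large_and (averaging be0) (large_and f_back (large_and (large_X 200 0)
  (large_and (large_X (8 * CA be * CQ be * CQ be * (64 * (CP R + 6))) 0) (large_ge 1)))).
apply: large_imp => s [h1 [h2 [hX [hC s1]]]] al v hcl2 /andP[v1 v2].
rewrite expr0 mulr1 in hX; rewrite expr0 mulr1 in hC.
have hcl := regular2_regular hcl2; have [had sn _] := hcl.
have s0 : 0 < s by clear -s1; lra.
have h0 := hscale_gt0 s0; have L1 : 1 <= L s by apply: exprn_ege1; exact: X_ge1.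
have V0 := V_gt0 s; have X0 := X_gt0 s; have X1 := X_ge1 s.
have LV : 200 * L s <= V s.
  have -> : V s = X s ^+ 12 * L s by rewrite /V /L; ring.
  by rewrite ler_pM2r ?exprn_gt0//; apply: (le_trans hX); apply: ler_eXnr.
have L0 : 0 <= L s by clear -L1; lra.
pose W := (Num.truncn (L s)).+1; pose w0 := Num.truncn (L s).
have /andP[W1 W2] : w0%:R <= L s < W%:R by apply: truncn_itv.
have W3 : W%:R = w0%:R + 1 :> R by rewrite natr1.
set v' := v + w0%:R.
have hv' : V s / 2 + W%:R <= v' <= 2 * V s.
  by rewrite /v' W3; apply/andP; split; clear -v1 v2 W1 LV L1; lra.
have := h1 al v' W hcl hv'.
set SL := \sum_(0 <= w < W) _; set SR := \sum_(0 <= j < _) _ => main.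
have fv := f_ge0 be0 v had.
have SL1 : W%:R * f al v / CQ be <= SL.
  rewrite ler_pdivrMr// [SL * _]mulrC /SL mulr_sumr [W%:R * _]mulr_natl.
  have -> : f al v *+ W = \sum_(0 <= w < W) f al v by rewrite big_const_nat subn0 iter_addr addr0.
  rewrite big_nat [leRHS]big_nat; apply: ler_sum => w /andP[_ wW].
  apply: f_quasi_mono => //; rewrite /v'.
  have : w%:R <= w0%:R :> R by rewrite ler_nat -ltnS.
  by clear; lra.
set SV := \sum_(0 <= i < _) f al (v - i%:R).
have SV0 : 0 <= SV by apply: sumr_ge0 => i _; apply: f_ge0.
have SR1 : SR <= L s * (2 * CQ be * f al v) + SV.
  rewrite /SR (@big_cat_nat _ _ _ w0)//=; last exact: leq_trans (leqnSn w0) (leq_addl _ _).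
  apply: lerD.
    apply: (@le_trans _ _ (\sum_(0 <= j < w0) 2 * CQ be * f al v)); last first.
      rewrite big_const_nat subn0 iter_addr addr0 -[_ *+ w0]mulr_natl ler_wpM2r//.
      by rewrite mulr_ge0// mulr_ge0// ltW.
    rewrite big_nat [leRHS]big_nat; apply: ler_sum => j /andP[_ jw].
    have jw' : j%:R <= w0%:R :> R by rewrite ler_nat ltnW.
    have j0 : 0 <= j%:R :> R by [].
    have e : v' - j%:R - (w0%:R - j%:R) = v by rewrite /v'; ring.
    have := h2 al (v' - j%:R) (w0%:R - j%:R) hcl2; rewrite e; apply;
      apply/andP; split; rewrite /v'; clear -v1 v2 jw' j0 W1 LV L1; lra.
  have -> : ((Num.truncn (hscale s)).+1 + W = (Num.truncn (hscale s)).+2 + w0)%N.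
    by rewrite -[W]/(w0.+1) addnS.
  rewrite -{1}[w0]add0n big_addn addnK.
  rewrite /SV; apply: ler_sum => i _.
  by rewrite natrD /v' opprD [- i%:R - _]addrC addrA addrK.
have WL : W%:R + L s <= 2 * W%:R by clear -W2; lra.
have W0 : 0 < W%:R :> R by rewrite ltr0n.
have CL : 8 * CA be * CQ be * CQ be * L s <= hscale s.
  rewrite (hscaleE s0) ler_pdivlMr; last by clear -CP0; lra.
  have -> : 8 * CA be * CQ be * CQ be * L s * (64 * (CP R + 6)) =
     8 * CA be * CQ be * CQ be * (64 * (CP R + 6)) * L s by ring.
  apply: (@le_trans _ _ (X s * L s)); first by rewrite ler_pM2r// exprn_gt0.
  rewrite /L -exprS; apply: (@le_trans _ _ (X s ^+ 8)); first exact: ler_weXn2l.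
  by rewrite ler_peMr// exprn_ge0// ltW.
have e1 : hscale s * (W%:R * f al v / CQ be) <= CA be * (2 * W%:R) * (L s * (2 * CQ be * f al v) + SV).
  apply: (@le_trans _ _ (hscale s * SL)); first by rewrite ler_pM2l.
  apply: (le_trans main); apply: ler_pM => //.
  - by rewrite mulr_ge0 ?addr_ge0 ?(ltW CA0).
  - by apply: sumr_ge0 => i _; apply: f_ge0.
  - by rewrite ler_pM2l.
have e2 : hscale s * f al v <= 2 * CA be * CQ be * (L s * (2 * CQ be * f al v) + SV).
  rewrite -(ler_pM2r W0) -(ler_pM2r (_ : 0 < (CQ be)^-1)) ?invr_gt0//.
  have -> : hscale s * f al v * W%:R / CQ be = hscale s * (W%:R * f al v / CQ be) by ring.
  apply: (le_trans e1); rewrite le_eqVlt; apply/orP; left; apply/eqP; field.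
  by rewrite gt_eqF.
have e3 : 2 * (2 * CA be * CQ be * (L s * (2 * CQ be * f al v))) <= hscale s * f al v.
  have -> : 2 * (2 * CA be * CQ be * (L s * (2 * CQ be * f al v))) =
    8 * CA be * CQ be * CQ be * L s * f al v by ring.
  by rewrite ler_wpM2r.
by rewrite /C4; clear -e2 e3; lra.
Qed.

Definition C5 : R := 2 * C4 * CQ be.

(** The average of f_p dominates f_p by [f_le_average], and the sum of f_p over the window is O(p
    (ln p + 1)) f by [sum_f_rem_le]. *)
Lemma f_rem_le_prime : large (fun s => forall al v p, adm al -> regular2 s (rem al p) ->
  prime p -> nondeg al p -> 3 / 4 * V s <= v <= 3 / 2 * V s ->
  f (rem al p) v <= C5 * (p%:R * (ln p%:R + 1) / hscale s) * f al v).
Proof.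
have := large_and f_le_average (large_ge 1).
apply: large_imp => s [h1 s1] al v p had hcl pp np hv.
have s0 : 0 < s by clear -s1; lra.
have h0 := hscale_gt0 s0.
have [_ snr _] := regular2_regular hcl.
have C40 := C4_gt0.
have := h1 _ v hcl hv; have := sum_f_rem_le be0 v (Num.truncn (hscale s)).+2 had pp snr np.
set S := \sum_(_ <= _ < _) _ => a1 a2.
have -> : C5 * (p%:R * (ln p%:R + 1) / hscale s) * f al v
  = C4 * (2 * CQ be * (ln p%:R + 1) * p%:R * f al v) / hscale s by rewrite /C5; ring.
rewrite ler_pdivlMr// mulrC; apply: (le_trans a2).
by rewrite ler_pM2l.
Qed.

End Slow.

(** * Comparing shifts by logarithms of integers *)

(* In the recursion on m, S is the set of primes already removed from the support of f; the condition
   keeps S so sparse that two of 3, 5, 7, 11 are never in S. *)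
Definition compat (a b : nat) :=
  [|| 2 * a < b, 2 * b < a, (a == 2) && (b == 3) | (a == 3) && (b == 2)]%N.

Definition removable (S : seq nat) (m : nat) :=
  (forall a b, a \in S -> b \in S -> a != b -> compat a b) /\
  (forall a q, a \in S -> prime q -> (q %| m)%N -> (2 * q < a)%N || ((q == 2%N) && (a == 3%N))).

Lemma removable_dvd S m d : (d %| m)%N -> removable S m -> removable S d.
Proof. by move=> dm [h1 h2]; split=> // a q aS pq qd; apply: h2 => //; apply: dvdn_trans dm. Qed.

Lemma removable_notin S p : prime p -> removable S p -> p \notin S.
Proof.
move=> pp [_ h2]; apply/negP => pS; have := h2 p p pS pp (dvdnn p).
by have := prime_gt0 pp; lia.
Qed.

(** A prime factor q of p - 1 satisfies 2 q < p unless p - 1 is itself prime, which forces p = 3 and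
    q = 2; hence the exceptional pair in [compat]. *)
Lemma removable_prime S p : prime p -> removable S p -> removable (p :: S) p.-1.
Proof.
move=> pp [h1 h2]; have p1 := prime_gt1 pp; split.
  move=> a b; rewrite !inE => /orP[/eqP->|aS] /orP[/eqP->|bS]; rewrite ?eqxx//.
  - by move=> _; have := h2 b p bS pp (dvdnn p); rewrite /compat; lia.
  - by move=> _; have := h2 a p aS pp (dvdnn p); rewrite /compat; lia.
  - exact: h1.
move=> a q; rewrite inE => /orP[/eqP->|aS] pq qp; last first.
  have := h2 a p aS pp (dvdnn p); have := prime_gt1 pq.
  have : (q <= p.-1)%N by apply: dvdn_leq => //; lia.
  lia.
case/dvdnP: qp => c pc; have q1 := prime_gt1 pq.
case: c pc => [|[|c]] pc; first lia.
  have e : p = q.+1 by lia.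
  case: (even_prime pp) => [p2|]; first lia.
  rewrite {1}e /= => oq.
  by case: (even_prime pq) => [q2|oq']; [rewrite e q2 | rewrite oq' in oq].
have : (2 * q <= c.+2 * q)%N by rewrite leq_mul2r; lia.
lia.
Qed.

Section Shift.
Variable R : realType.
Variable be : R.
Hypothesis be0 : 0 < be.
Implicit Types (s v : R) (al : nat -> R).
Local Notation f := (f be).

Definition rms al (S : seq nat) := fun q => if q \in S then 0 else al q.

Lemma rem_rms al S p : rem (rms al S) p = rms al (p :: S).
Proof. by apply: boolp.funext => q; rewrite /rem /rms inE; case: eqP. Qed.

Definition base al := adm al /\ forall p, prime p -> nondeg al p.

Lemma adm_rms al S : adm al -> adm (rms al S).
Proof.
move=> h q; rewrite /rms; case: ifP => _; last exact: h.
by split=> // _; rewrite invr_ge0.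
Qed.

Lemma two_small_rms al S m : base al -> removable S m -> two_small (rms al S).
Proof.
move=> [_ hb] [h1 _].
have n q : prime q -> q \notin S -> nondeg (rms al S) q.
  by move=> pq qS; rewrite /nondeg /rms (negPf qS); apply: hb.
have no a b : a != b -> ~~ compat a b -> a \in S -> b \notin S.
  by move=> ab nc aS; apply/negP => bS; move/negP: nc; apply; apply: h1.
have mk a b : prime a -> prime b -> (a <= 11)%N -> (b <= 11)%N -> a != b ->
    a \notin S -> b \notin S -> two_small (rms al S).
  move=> pa pb la lb ab aS bS; exists a, b; split; first by split.
  by split; apply: n.
have [s3|s3] := boolP (3%N \in S).
  have s5 : 5%N \notin S by apply: (no 3%N).
  have [s7|s7] := boolP (7%N \in S).
    by apply: (mk 5%N 11%N) => //; apply: (no 7%N).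
  exact: (mk 5%N 7%N).
have [s5|s5] := boolP (5%N \in S).
  by apply: (mk 3%N 7%N) => //; apply: (no 5%N).
exact: (mk 3%N 5%N).
Qed.

Lemma regular2_rms s al S m : base al -> removable S m -> (forall a, a \in S -> a%:R <= V s) ->
  regular2 s (rms al S).
Proof.
move=> hb hI hS; split; first by apply: adm_rms; case: hb.
  exact: two_small_rms hI.
move=> q /andP[pq /andP[q1 _]]; rewrite /nondeg /rms ifF; first by case: hb => _; apply.
apply/negP => /hS qV; have : V s <= V s ^+ 2.
  by apply: ler_eXnr => //; apply: exprn_ege1; exact: X_ge1.
by move: q1 qV; clear; lra.
Qed.

Lemma expRB1_le (x : R) : 0 <= x -> expR x - 1 <= x * expR x.
Proof.
move=> x0; have e0 := expR_gt0 x.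
have := expR_ge1Dx (- x); rewrite expRN => h.
have : (1 - x) * expR x <= 1 by rewrite -ler_pdivlMr// div1r.
by clear; lra.
Qed.

Lemma abs_sub_le (x y r : R) : 0 < x -> 0 < y -> 1 <= r -> x <= r * y -> y <= r * x ->
  `|y - x| <= (r - 1) * y.
Proof.
move=> x0 y0 r1 xy yx.
have r2 : (2 - r) * r <= 1 by have := sqr_ge0 (r - 1); rewrite expr2; clear; lra.
rewrite ler_norml; apply/andP; split; first by clear -xy; lra.
have : (2 - r) * y <= x.
  case: (lerP 2 r) => r3; first by clear -r3 x0 y0; nra.
  apply: (@le_trans _ _ ((2 - r) * (r * x))); first by rewrite ler_pM2l// subr_gt0.
  by rewrite mulrA ler_piMl// ltW.
by clear; lra.
Qed.

Lemma ratio_of_ln (x y e : R) : 0 < x -> 0 < y -> `|ln y - ln x| <= e ->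
  `|y - x| <= (expR e - 1) * x.
Proof.
move=> x0 y0; rewrite ler_norml => /andP[h1 h2].
have e0 : 0 <= e by clear -h1 h2; lra.
have E : expR (ln y - ln x) = y / x by rewrite expRB !lnK ?posrE.
have r0 : 0 < expR e := expR_gt0 e.
have yx : y <= expR e * x by rewrite -ler_pdivrMr// -E ler_expR.
have xy : x <= expR e * y.
  have : expR (- e) <= y / x by rewrite -E ler_expR.
  by rewrite ler_pdivlMr// expRN ler_pdivrMl.
have e1 : 1 <= expR e by apply: le_trans (expR_ge1Dx _); rewrite lerDl.
by rewrite distrC; apply: abs_sub_le.
Qed.

Lemma ln_of_ratio (x y e : R) : 0 < x -> 0 < y -> 0 <= e <= 2^-1 ->
  `|y - x| <= e * x -> `|ln y - ln x| <= 2 * e.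
Proof.
move=> x0 y0 /andP[e0 e1]; rewrite ler_norml => /andP[h1 h2].
have E : ln y - ln x = ln (y / x) by rewrite ln_div ?posrE.
have r0 : 0 < y / x by rewrite divr_gt0.
have r1 : y / x <= 1 + e by rewrite ler_pdivrMr//; clear -h2; lra.
have r2 : 1 - e <= y / x by rewrite ler_pdivlMr//; clear -h1; lra.
rewrite E ler_norml; apply/andP; split; last first.
  apply: (@le_trans _ _ (ln (1 + e))); first by rewrite ler_ln ?posrE//; clear -e0; lra.
  by apply: (le_trans (le_ln1Dx _)); clear -e0; lra.
rewrite lerNl -lnV ?posrE//.
apply: (@le_trans _ _ (ln (1 + 2 * e))); last by apply: le_ln1Dx; clear -e0; lra.
rewrite ler_ln ?posrE ?invr_gt0//; last by clear -e0; lra.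
rewrite -[(y / x)^-1]mul1r ler_pdivrMr//.
by clear -r2 e0 e1; nra.
Qed.

Definition E1 : R := expR 1.
Definition GG : R := expR (ga be).
(** [C6] collects the errors of order 1/p: the step from ln (p - 1) to ln p and the term in al p.
    [C1] and [c1] are chosen so that C1 / 2 = 3 C5 E1 C1 c1 + 3 C5 C6 with both summands equal to C1
    / 4, which closes the induction in [shift_ln]; [c0] turns p <= c0 N into p ln p / h <= c1. *)
Definition C6 : R := (2 * ga be + 1) * GG * E1.
Definition C1 : R := 12 * C5 be * C6.
Definition c1 : R := (12 * C5 be * E1)^-1.
Definition c0 : R := c1 / (64 * (CP R + 6)).

Lemma C5_ge1 : 1 <= C5 be.
Proof.
have h1 := CQ_ge1 be0.
have h2 : 1 <= CA be.
  rewrite /CA; have : 1 <= expR (ga be).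
    by apply: ltW; rewrite expR_gt1; have := ga_gt1 be0; lra.
  by lra.
rewrite /C5 /C4; set x := CQ be in h1 *; set y := CA be in h2 *.
have : 1 <= x * y by nra.
have -> : 2 * (4 * y * x) * x = 8 * (x * y) * x by ring.
by move: (x * y) => z hz; nra.
Qed.

Lemma E1_ge1 : 1 <= E1. Proof. by have := expR_ge1Dx (1 : R); rewrite /E1; lra. Qed.
Lemma GG_ge1 : 1 <= GG.
Proof. by apply: ltW; rewrite expR_gt1; have := ga_gt1 be0; lra. Qed.
Lemma C6_gt0 : 0 < C6.
Proof.
have := E1_ge1; have := GG_ge1; have := ga_gt1 be0 => h1 h2 h3.
by apply: mulr_gt0; [apply: mulr_gt0|]; lra.
Qed.
Lemma C1_gt0 : 0 < C1.
Proof. by have := C5_ge1 => h; apply: mulr_gt0 C6_gt0; lra. Qed.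
Lemma c0_bnd : 0 < c0 <= 1.
Proof.
have h := C5_ge1; have h' := E1_ge1; have h'' := CP_gt0 R.
have z : 1 <= C5 be * E1 by nra.
have z1 : 0 < c1 by rewrite invr_gt0; lra.
have z2 : c1 <= 1 by rewrite invf_le1; lra.
apply/andP; split; first by apply: divr_gt0; lra.
by rewrite ler_pdivrMr; lra.
Qed.

(* For the part of f avoiding p, the shift by ln p is compared with the shift by ln (p - 1),
   whose prime factors are smaller. *)
Lemma shift_ln : large (fun s => forall al, base al -> forall m S v,
  removable S m -> (forall a, a \in S -> a%:R <= V s) -> (0 < m)%N -> m%:R <= c0 * N s ->
  3 / 4 * V s + ln m%:R <= v <= 3 / 2 * V s ->
  `|ln (f (rms al S) (v - ln m%:R)) - ln (f (rms al S) v)| <= C1 * (ln m%:R / hscale s)).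
Proof.
have CP0 := CP_gt0 R; have C10 := C1_gt0; have C51 := C5_ge1; have C60 := C6_gt0.
have E11 := E1_ge1; have G1 := GG_ge1; have ga1 := ga_gt1 be0; have /andP[c00 c01] := c0_bnd.
have := large_and (f_rem_le_prime be0) (large_and (large_X 1 1)
  (large_and (large_X (C1 * (64 * (CP R + 6))) 0) (large_ge 1))).
apply: large_imp => s [h1 [sX [hC s1]]] al hb.
rewrite expr0 mulr1 in hC; rewrite mul1r expr1 in sX.
have s0 : 0 < s by clear -s1; lra.
have h0 := hscale_gt0 s0; have X0 := X_gt0 s; have X1 := X_ge1 s; have V0 := V_gt0 s.
have N0 := N_gt0 s0.
have NX : N s <= X s ^+ 8 by rewrite /N ler_pdivrMr// ler_peMr// exprn_ge0// ltW.
have NV : c0 * N s <= V s.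
  apply: (@le_trans _ _ (N s)); first by rewrite ler_piMl// ltW.
  by apply: (le_trans NX); rewrite /V; apply: ler_weXn2l.
have Hs : N s * s ^+ 2 = 64 * (CP R + 6) * hscale s.
  by rewrite (hscaleE s0) /N; field; rewrite !gt_eqF//; clear -CP0; lra.
have C1s : C1 * s ^+ 2 <= hscale s.
  rewrite (hscaleE s0) ler_pdivlMr; last by clear -CP0; lra.
  have -> : C1 * s ^+ 2 * (64 * (CP R + 6)) = C1 * (64 * (CP R + 6)) * s * s by ring.
  rewrite ler_pM2r//; apply: (@le_trans _ _ (X s * X s)).
    by apply: ler_pM => //; [apply: mulr_ge0; [exact: ltW|clear -CP0; lra]|exact: ltW].
  by rewrite -expr2; apply: ler_weXn2l.
elim/ltn_ind => m IH S v hI hS m0 mN /andP[v1 v2].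
have lmS : ln m%:R <= s ^+ 2 :> R.
  by rewrite -lnV_ ler_ln ?posrE ?ltr0n//; apply: le_trans NV.
have had := adm_rms S hb.1.
have [m1|m1] := leqP m 1.
  have -> : m = 1%N by apply/eqP; rewrite eqn_leq m1.
  by rewrite ln1 subr0 subrr normr0 mul0r mulr0.
(* For composite m = d e the two shifts are made in succession with the same [S]; the bound is
   additive in the logarithm, so [C1] does not grow. *)
have [pm|npm] := boolP (prime m); last first.
  have [d dm /andP[d1 d2]] : exists2 d, (d %| m)%N & (1 < d < m)%N.
    exists (pdiv m); first exact: pdiv_dvd.
    rewrite prime_gt1 ?pdiv_prime//= ltn_neqAle dvdn_leq ?pdiv_dvd// andbT.
    by apply: contra npm => /eqP <-; apply: pdiv_prime.
  case/dvdnP: (dm) => e me.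
  have e0 : (0 < e)%N by move: m0; rewrite me muln_gt0 => /andP[].
  have em : (e < m)%N by rewrite me -{1}[e]muln1 ltn_pmul2l.
  have ed : (e %| m)%N by rewrite me dvdn_mulr.
  have d0 := ltnW d1.
  have lm : ln m%:R = ln d%:R + ln e%:R :> R by rewrite me mulnC ln_natM.
  have ld0 := ln_nat_ge0 R d; have le0 := ln_nat_ge0 R e.
  have dN : d%:R <= c0 * N s by apply: le_trans mN; rewrite ler_nat ltnW.
  have eN : e%:R <= c0 * N s by apply: le_trans mN; rewrite ler_nat ltnW.
  have i1 := IH d d2 S v (removable_dvd dm hI) hS d0 dN.
  have i2 := IH e em S (v - ln d%:R) (removable_dvd ed hI) hS e0 eN.
  have {}i1 : `|ln (f (rms al S) (v - ln d%:R)) - ln (f (rms al S) v)| <= C1 * (ln d%:R / hscale s).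
    by apply: i1; apply/andP; split; clear -v1 v2 lm ld0 le0; lra.
  have {}i2 : `|ln (f (rms al S) (v - ln d%:R - ln e%:R)) - ln (f (rms al S) (v - ln d%:R))| <= C1 * (ln e%:R / hscale s).
    by apply: i2; apply/andP; split; clear -v1 v2 lm ld0 le0; lra.
  have -> : v - ln m%:R = v - ln d%:R - ln e%:R by rewrite lm; ring.
  have -> : C1 * (ln m%:R / hscale s) = C1 * (ln e%:R / hscale s) + C1 * (ln d%:R / hscale s).
    by rewrite lm; ring.
  apply: le_trans (lerD i2 i1); apply: le_trans (ler_normD _ _).
  by rewrite addrA subrK.
have pS := removable_notin pm hI; have hI' := removable_prime pm hI.
set p := m in pm pS hI' *.
have hS' a : a \in p :: S -> a%:R <= V s.
  by rewrite inE => /orP[/eqP->|/hS//]; apply: le_trans NV.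
have large_prime : 0 < ln p%:R :> R by apply: ln_prime_gt0.
have p2 : 2 <= p%:R :> R by rewrite ler_nat.
have p10 : (0 < p.-1)%N by rewrite -ltnS prednK.
have lp1 : ln p.-1%:R <= ln p%:R :> R.
  by rewrite ler_ln ?posrE ?ltr0n// ler_nat leq_pred.
have lp10 := ln_nat_ge0 R p.-1.
have p1N : p.-1%:R <= c0 * N s by apply: le_trans mN; rewrite ler_nat leq_pred.
have hcl := regular2_rms hb hI' hS'; rewrite -rem_rms in hcl.
have hvr : 3 / 4 * V s <= v <= 3 / 2 * V s by apply/andP; split; clear -v1 v2 large_prime; lra.
have nzp : nondeg (rms al S) p by rewrite /nondeg /rms (negPf pS); apply: hb.2.
have rho := h1 (rms al S) v p had hcl pm nzp hvr.
have IHp : `|ln (f (rms al (p :: S)) (v - ln p.-1%:R)) - ln (f (rms al (p :: S)) v)| <=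
    C1 * (ln p.-1%:R / hscale s).
  apply: IH => //; first by rewrite prednK.
  by apply/andP; split; clear -v1 v2 lp1; lra.
rewrite -rem_rms in IHp.
set F := f (rms al S) in rho IHp *; set F' := f (rem (rms al S) p) in rho IHp *.
have hadr := adm_rem p had.
have Fp w : 0 < F w by apply: f_gt0.
have F'p w : 0 < F' w by apply: f_gt0.
set eta := C1 * (ln p.-1%:R / hscale s) in IHp.
have eta0 : 0 <= eta by apply: mulr_ge0; [exact: ltW|apply: divr_ge0 => //; exact: ltW].
have eta1 : eta <= C1 * (ln p%:R / hscale s) by rewrite ler_pM2l// ler_pM2r// invr_gt0.
have Clp : C1 * (ln p%:R / hscale s) <= 1.
  rewrite mulrA ler_pdivrMr// mul1r; apply: le_trans C1s.
  by rewrite ler_pM2l.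
have q1 := ratio_of_ln (F'p v) (F'p _) IHp.
have eta_le : expR eta - 1 <= eta * E1.
  apply: (le_trans (expRB1_le eta0)); rewrite ler_wpM2l// ler_expR.
  by clear -eta1 Clp; lra.
set b := v - ln p.-1%:R in q1; set a := v - ln p%:R.
have q2 : F' b <= E1 * F' v.
  have h : F' b <= expR eta * F' v.
    have := ler_norm (F' b - F' v); clear -q1; lra.
  apply: (le_trans h); rewrite ler_pM2r// ler_expR; clear -eta1 Clp; lra.
pose t : R := ln p%:R - ln p.-1%:R.
have t0 : 0 <= t by rewrite subr_ge0.
have tp : t <= 2 / p%:R.
  have p1R : p.-1%:R = p%:R - 1 :> R by rewrite -subn1 natrB// prime_gt0.
  rewrite /t -ln_div ?posrE ?ltr0n// p1R.
  have -> : p%:R / (p%:R - 1) = 1 + (p%:R - 1)^-1 :> R by field; clear -p2; lra.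
  have i0 : 0 < (p%:R - 1)^-1 :> R by rewrite invr_gt0; clear -p2; lra.
  apply: (le_trans (le_ln1Dx _)); first by clear -i0; lra.
  rewrite -[2 / p%:R]invrK invf_div lef_pV2 ?posrE; [| |apply: divr_gt0]; clear -p2; lra.
have p0 : 0 < p%:R :> R by clear -p2; lra.
have t1 : 2 / p%:R <= 1 :> R by rewrite ler_pdivrMr//; clear -p2; lra.
have ab : `|a - b| <= t.
  have -> : a - b = - t by rewrite /a /b /t; ring.
  by rewrite normrN ger0_norm.
have ba : `|b - a| <= t by rewrite distrC.
have f1 := f_shift_le be0 hadr ab; have f2 := f_shift_le be0 hadr ba.
rewrite -/F' in f1 f2.
have gt0 : 0 <= ga be * t by rewrite mulr_ge0//; clear -ga1; lra.
have eg : expR (ga be * t) <= GG.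
  by rewrite ler_expR ler_piMr//; [clear -ga1; lra|clear -tp t1; lra].
have q3 : `|F' b - F' a| <= ga be * (2 / p%:R) * GG * F' b.
  have e1 : expR (ga be * t) - 1 <= ga be * (2 / p%:R) * GG.
    apply: (le_trans (expRB1_le gt0)); apply: ler_pM => //; first exact: expR_ge0.
    by rewrite ler_pM2l//; clear -ga1; lra.
  apply: (@le_trans _ _ ((expR (ga be * t) - 1) * F' b)); last by rewrite ler_pM2r.
  have r1 : 1 <= expR (ga be * t) by apply: le_trans (expR_ge1Dx _); rewrite lerDl.
  exact: abs_sub_le.
have [a0 /(_ pm) a1] := had p.
(* [f_sub_shift] leaves three terms in f_p: the shift by ln (p - 1), known by induction with p added
   to [S]; the remaining t <= 2 / p, by the Lipschitz bound; and the term with al p <= 1 / p. *)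
have q4 : `|F v - F a| <= F' v * (E1 * eta + C6 / p%:R).
  rewrite /F /a f_sub_shift// -/F' -/a.
  have -> : F' v - (1 - rms al S p) * F' a = (F' v - F' b) + ((F' b - F' a) + rms al S p * F' a) by ring.
  apply: (le_trans (ler_normD _ _)).
  have k1 : `|F' v - F' b| <= F' v * (E1 * eta).
    rewrite distrC; apply: (le_trans q1).
    by rewrite [leRHS]mulrC ler_pM2r// mulrC.
  have k2 : `|rms al S p * F' a| <= p%:R^-1 * (GG * F' b).
    rewrite ger0_norm; last by apply: mulr_ge0 => //; exact: ltW.
    apply: ler_pM => //; first exact: ltW.
    by apply: (le_trans f1); rewrite ler_pM2r.
  have -> : F' v * (E1 * eta + C6 / p%:R) = F' v * (E1 * eta) +
     (ga be * (2 / p%:R) * GG * (E1 * F' v) + p%:R^-1 * (GG * (E1 * F' v))).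
    by rewrite /C6; field; rewrite gt_eqF.
  apply: lerD => //; apply: (le_trans (ler_normD _ _)); apply: lerD.
    apply: (le_trans q3); rewrite ler_wpM2l//.
    apply: mulr_ge0; last by clear -G1; lra.
    by apply: mulr_ge0; [clear -ga1; lra | apply: divr_ge0 => //; exact: ltW].
  apply: (le_trans k2); rewrite ler_wpM2l ?invr_ge0// ler_wpM2l//.
  by clear -G1; lra.
have lph : 2^-1 <= ln p%:R :> R.
  by apply: (le_trans (ln2_ge R)); rewrite ler_ln ?posrE.
have rho' : F' v <= 3 * C5 be * (p%:R * ln p%:R / hscale s) * F v.
  apply: (le_trans rho); rewrite ler_pM2r//.
  have -> : 3 * C5 be * (p%:R * ln p%:R / hscale s) = C5 be * (p%:R * (3 * ln p%:R) / hscale s) by ring.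
  rewrite ler_pM2l; last by clear -C51; lra.
  by rewrite ler_pM2r ?invr_gt0// ler_pM2l//; clear -lph; lra.
have plp : p%:R * ln p%:R / hscale s <= c1.
  rewrite ler_pdivrMr//; apply: (@le_trans _ _ (c0 * N s * s ^+ 2)).
    by apply: ler_pM => //; exact: ltW.
  rewrite -mulrA Hs /c0 le_eqVlt; apply/orP; left; apply/eqP; field.
  by rewrite gt_eqF//; clear -CP0; lra.
pose e := C1 / 2 * (ln p%:R / hscale s).
have lh : 0 < ln p%:R / hscale s by apply: divr_gt0.
(* The smallness of f_p enters: p ln p / h turns the 1/p errors into ln p / h and multiplies the
   inductive error by at most a constant times c1. The target is C1 / 2, as the passage to
   logarithms doubles it. *)
have q5 : `|F v - F a| <= e * F v.
  apply: (le_trans q4).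
  have w0 : 0 <= E1 * eta + C6 / p%:R.
    apply: addr_ge0; first by apply: mulr_ge0 => //; clear -E11; lra.
    by apply: divr_ge0; [exact: ltW|exact: ltW].
  apply: (@le_trans _ _ (3 * C5 be * (p%:R * ln p%:R / hscale s) * F v * (E1 * eta + C6 / p%:R))).
    by rewrite ler_wpM2r.
  have -> : 3 * C5 be * (p%:R * ln p%:R / hscale s) * F v * (E1 * eta + C6 / p%:R) =
    (3 * C5 be * (p%:R * ln p%:R / hscale s) * (E1 * eta + C6 / p%:R)) * F v by ring.
  rewrite ler_pM2r//.
  apply: (@le_trans _ _ (3 * C5 be * (p%:R * ln p%:R / hscale s) * (E1 * (C1 * (ln p%:R / hscale s)) + C6 / p%:R))).
    apply: ler_wpM2l.
      apply: mulr_ge0; first by clear -C51; lra.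
      by apply: divr_ge0; [apply: mulr_ge0 => //; exact: ltW|exact: ltW].
    by rewrite lerD2r ler_wpM2l//; clear -E11; lra.
  have -> : 3 * C5 be * (p%:R * ln p%:R / hscale s) * (E1 * (C1 * (ln p%:R / hscale s)) + C6 / p%:R)
    = (ln p%:R / hscale s) * (3 * C5 be * E1 * C1 * (p%:R * ln p%:R / hscale s) + 3 * C5 be * C6).
    by field; rewrite !gt_eqF.
  rewrite /e [C1 / 2 * _]mulrC ler_pM2l//.
  have -> : C1 / 2 = 3 * C5 be * E1 * C1 * c1 + 3 * C5 be * C6.
    have -> : 3 * C5 be * E1 * C1 * c1 = C1 / 4.
      by rewrite /c1; field; rewrite !gt_eqF//; [clear -C51; lra|clear -E11; lra].
    by rewrite /C1; field.
  rewrite lerD2r ler_wpM2l//; apply: mulr_ge0; last exact: ltW.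
  by apply: mulr_ge0; [clear -C51; lra|clear -E11; lra].
have e01 : 0 <= e <= 2^-1.
  have e2 : e = C1 * (ln p%:R / hscale s) / 2 by rewrite /e; ring.
  apply/andP; split; last by rewrite e2; clear -Clp; lra.
  by apply: mulr_ge0; [clear -C10; lra|exact: ltW].
rewrite distrC in q5.
have := ln_of_ratio (Fp v) (Fp a) e01 q5.
by have -> : 2 * e = C1 * (ln p%:R / hscale s) by rewrite /e; field; rewrite gt_eqF.
Qed.

End Shift.

(** * Arbitrary shifts of order ln V *)

Section ShiftAll.
Variable R : realType.
Variable be : R.
Hypothesis be0 : 0 < be.
Implicit Types (s v : R) (al : nat -> R).
Local Notation f := (f be).

Lemma ln_f_lip al v v' c : adm al -> `|v - v'| <= c ->
  `|ln (f al v) - ln (f al v')| <= ga be * c.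
Proof.
move=> had h.
have a1 := f_shift_le be0 had h; rewrite distrC in h; have a2 := f_shift_le be0 had h.
have p1 := f_gt0 be0 v had; have p2 := f_gt0 be0 v' had.
have l x y : 0 < x -> 0 < y -> x <= expR (ga be * c) * y -> ln x <= ga be * c + ln y.
  move=> x0 y0 xy; rewrite -[X in _ <= X + _]expRK -lnM ?posrE ?expR_gt0//.
  by rewrite ler_ln ?posrE ?mulr_gt0 ?expR_gt0.
have := l _ _ p1 p2 a1; have := l _ _ p2 p1 a2; rewrite ler_norml; clear.
move: (ln (f al v)) (ln (f al v')) (ga be * c) => x y z h1 h2.
by apply/andP; split; lra.
Qed.

Lemma dist_path (x1 x2 x3 x4 x5 y1 y2 y3 y4 : R) : `|x3 - x2| <= y1 -> `|x5 - x3| <= y2 ->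
  `|x5 - x4| <= y3 -> `|x1 - x4| <= y4 -> `|x1 - x2| <= y4 + y3 + y2 + y1.
Proof.
rewrite !ler_norml => /andP[? ?] /andP[? ?] /andP[? ?] /andP[? ?].
by apply/andP; split; lra.
Qed.

(** The shifts used have total length at most A s^2 for the powers of 2 and s^2 for each of ln m and
    ln M; the second summand is the rounding error ga / M with M >= c0 N / 4. *)
Definition CS (A : R) : R := C1 be * (A + 2) * (64 * (CP R + 6)) + 4 * ga be / c0 be.

Lemma shift_back (A : R) : 0 < A -> large (fun s => forall al, base al -> forall v t : R,
  0 <= t <= A * s ^+ 2 -> 7 / 8 * V s <= v <= 5 / 4 * V s ->
  `|ln (f al (v - t)) - ln (f al v)| <= CS A * (s / X s ^+ 8)).
Proof.
move=> A0; have CP0 := CP_gt0 R; have C10 := C1_gt0 be0; have ga1 := ga_gt1 be0.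
have /andP[c00 c01] := c0_bnd be0.
have := large_and (shift_ln be0) (large_and (large_X (100 + 16 * A) 0) (large_and (large_X (4 / c0 be) 0)
  (large_and (large_X 1 2) (large_ge 1)))).
apply: large_imp => s [h1 [h2 [h3 [h4 s1]]]] al hb v t /andP[t0 tA] /andP[v1 v2].
rewrite expr0 mulr1 in h2; rewrite expr0 mulr1 in h3; rewrite mul1r in h4.
have s0 : 0 < s by clear -s1; lra.
have h0 := hscale_gt0 s0; have X0 := X_gt0 s; have X1 := X_ge1 s; have V0 := V_gt0 s.
have N0 := N_gt0 s0; have had := hb.1.
have X2V : X s * X s <= V s by rewrite -expr2; apply: ler_weXn2l.
have tV : t <= V s / 16.
  apply: (le_trans tA); apply: (@le_trans _ _ (A * X s)); first by rewrite ler_pM2l.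
  by clear -h2 X2V X0 A0; nra.
have sV : 4 * s ^+ 2 <= V s / 16.
  by clear -h4 h2 X2V X0 A0; nra.
have rE : rms al [::] = al by apply: boolp.funext => q.
have inv0 m : removable [::] m by [].
have h1' m (w : R) : (0 < m)%N -> m%:R <= c0 be * N s -> 3 / 4 * V s + ln m%:R <= w <= 3 / 2 * V s ->
  `|ln (f al (w - ln m%:R)) - ln (f al w)| <= C1 be * (ln m%:R / hscale s).
  by move=> m0 mN hw; have := h1 al hb m [::] w (inv0 m) _ m0 mN hw; rewrite rE; apply.
have cN : 4 <= c0 be * N s.
  rewrite -ler_pdivrMl// mulrC; apply: (le_trans h3).
  rewrite /N ler_pdivlMr//; apply: (@le_trans _ _ (X s * X s)).
    by rewrite ler_pM2l//; apply: le_trans h4; rewrite expr2 ler_peMr// ltW.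
  by rewrite -expr2; apply: ler_weXn2l.
have NV : c0 be * N s <= V s.
  apply: (@le_trans _ _ (N s)); first by rewrite ler_piMl// ltW.
  apply: (@le_trans _ _ (X s ^+ 8)); last by apply: ler_weXn2l.
  by rewrite /N ler_pdivrMr// ler_peMr// exprn_ge0// ltW.
have ls m : (0 < m)%N -> m%:R <= c0 be * N s -> ln m%:R <= s ^+ 2 :> R.
  move=> m0 mN; rewrite -lnV_ ler_ln ?posrE ?ltr0n//.
  exact: le_trans mN NV.
have l20 := ln2_gt0 R.
have N2 : 2 <= c0 be * N s by clear -cN; lra.
have l2s := ls 2%N isT N2.
pose i := Num.truncn (t / ln 2).
have /andP[i1 i2] : i%:R <= t / ln 2 < i.+1%:R.
  by apply: truncn_itv; rewrite divr_ge0// ltW.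
have i1' : i%:R * ln 2 <= t by rewrite -ler_pdivlMr.
have i2' : t < i.+1%:R * ln 2 by rewrite -ltr_pdivrMr.
have it j : (j <= i)%N -> `|ln (f al (v - j%:R * ln 2)) - ln (f al v)| <= C1 be * (j%:R * ln 2 / hscale s).
  elim: j => [|j IH] ji; first by rewrite !mul0r subr0 subrr normr0 mulr0.
  have je : j.+1%:R * ln 2 = j%:R * ln 2 + ln 2 :> R by rewrite -[j.+1%:R]natr1 mulrDl mul1r.
  have jt : j.+1%:R * ln 2 <= i%:R * ln 2 :> R by rewrite ler_pM2r// ler_nat.
  have jp : 0 <= j%:R * ln 2 :> R by rewrite mulr_ge0// ltW.
  have hw : 3 / 4 * V s + ln 2 <= v - j%:R * ln 2 <= 3 / 2 * V s.
    by apply/andP; split; clear -je jt i1' tV v1 v2 jp V0; lra.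
  have := h1' 2%N _ isT N2 hw.
  have -> : v - j%:R * ln 2 - ln 2 = v - j.+1%:R * ln 2 by rewrite je; ring.
  move=> k1; have k2 := IH (ltnW ji).
  have -> : C1 be * (j.+1%:R * ln 2 / hscale s) = C1 be * (ln 2 / hscale s) + C1 be * (j%:R * ln 2 / hscale s).
    by rewrite je; ring.
  apply: le_trans (lerD k1 k2); apply: le_trans (ler_normD _ _).
  by rewrite addrA subrK.
set r := t - i%:R * ln 2.
have r0 : 0 <= r by rewrite subr_ge0.
have r1 : r < ln 2 by move: i2'; rewrite /r -[i.+1%:R]natr1 mulrDl mul1r; clear; lra.
(* Half of the admissible range, because m, the integer part of M e^r with e^r <= 2, must stay below
   c0 N as well; ln (m / M) is then within 1 / M of r. *)
pose M := Num.truncn (c0 be * N s / 2).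
have cN2 : 0 <= c0 be * N s / 2 by clear -cN; lra.
have /andP[M1 M2] : M%:R <= c0 be * N s / 2 < M.+1%:R by apply: truncn_itv.
have M3 : c0 be * N s / 4 <= M%:R.
  by move: M2; rewrite -[M.+1%:R]natr1; clear -cN; lra.
have M0 : 0 < M%:R :> R by clear -M3 cN; lra.
have Mn0 : (0 < M)%N by rewrite -(ltr0n R).
pose m := Num.truncn (M%:R * expR r).
have er1 : 1 <= expR r by apply: le_trans (expR_ge1Dx _); rewrite lerDl.
have er2 : expR r <= 2.
  by rewrite -[X in _ <= X](lnK (_ : 2 \is Num.pos)) ?posrE// ler_expR ltW.
have Me0 : 0 < M%:R * expR r by rewrite mulr_gt0// expR_gt0.
have /andP[m1 m2] : m%:R <= M%:R * expR r < m.+1%:R by apply: truncn_itv; exact: ltW.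
have Mm : (M <= m)%N.
  rewrite truncn_ge_nat; last exact: ltW.
  by rewrite ler_peMr// ltW.
have MmR : M%:R <= m%:R :> R by rewrite ler_nat.
have m0 : (0 < m)%N by apply: leq_trans Mm.
have m0R : 0 < m%:R :> R by rewrite ltr0n.
have mN : m%:R <= c0 be * N s.
  apply: (le_trans m1); apply: (@le_trans _ _ (M%:R * 2)); first by rewrite ler_pM2l.
  by clear -M1; lra.
have MN : M%:R <= c0 be * N s by apply: le_trans mN.
have lMm : ln M%:R <= ln m%:R :> R by rewrite ler_ln ?posrE.
have lM0 := ln_nat_ge0 R M; have lm0 := ln_nat_ge0 R m.
have lms := ls m m0 mN; have lMs := ls M Mn0 MN.
have lMr : ln (M%:R * expR r) = ln M%:R + r by rewrite lnM ?posrE ?expR_gt0// expRK.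
have g1 : ln m%:R <= ln M%:R + r by rewrite -lMr ler_ln ?posrE.
have g2 : ln M%:R + r - ln m%:R <= M%:R^-1.
  rewrite -lMr -ln_div ?posrE//.
  have -> : M%:R * expR r / m%:R = 1 + (M%:R * expR r - m%:R) / m%:R by field; rewrite gt_eqF.
  have d0 : 0 <= (M%:R * expR r - m%:R) / m%:R by rewrite divr_ge0// ?subr_ge0// ltW.
  apply: (le_trans (le_ln1Dx _)); first by clear -d0; lra.
  apply: (@le_trans _ _ (m%:R^-1)); last by rewrite lef_pV2 ?posrE.
  rewrite ler_pdivrMr// mulVf ?gt_eqF//.
  by move: m2; rewrite -[m.+1%:R]natr1; clear; lra.
(* The path goes from v down to w1, down by ln m, and back up by ln M to w2, which is within 1 / M
   of v - t. *)
set w1 := v - i%:R * ln 2; set w2 := w1 - ln m%:R + ln M%:R.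
have ip : 0 <= i%:R * ln 2 :> R by rewrite mulr_ge0// ltW.
have a1 := it i (leqnn i).
have a2 : `|ln (f al (w1 - ln m%:R)) - ln (f al w1)| <= C1 be * (ln m%:R / hscale s).
  by apply: h1' => //; rewrite /w1; apply/andP; split; clear -lms i1' tV sV v1 v2 ip V0; lra.
have a3 : `|ln (f al (w2 - ln M%:R)) - ln (f al w2)| <= C1 be * (ln M%:R / hscale s).
  apply: h1' => //; rewrite /w2 /w1; apply/andP; split; clear -lms lMs lMm lM0 lm0 i1' tV sV v1 v2 ip V0; lra.
have e3 : w2 - ln M%:R = w1 - ln m%:R by rewrite /w2 addrK.
rewrite e3 in a3.
have a4 : `|ln (f al (v - t)) - ln (f al w2)| <= ga be * M%:R^-1.
  apply: ln_f_lip => //.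
  have -> : v - t - w2 = ln m%:R - ln M%:R - r by rewrite /w2 /w1 /r; ring.
  have Mi : 0 <= (M%:R : R)^-1 by rewrite invr_ge0 ltW.
  by rewrite ler_norml; apply/andP; split; clear -g1 g2 Mi; lra.
have tri : `|ln (f al (v - t)) - ln (f al v)| <= ga be * M%:R^-1 + C1 be * (ln M%:R / hscale s)
   + C1 be * (ln m%:R / hscale s) + C1 be * (i%:R * ln 2 / hscale s).
  exact: dist_path a1 a2 a3 a4.
apply: (le_trans tri).
have b1 : ga be * M%:R^-1 <= 4 * ga be / c0 be * (s / X s ^+ 8).
  have -> : 4 * ga be / c0 be * (s / X s ^+ 8) = ga be * (c0 be * N s / 4)^-1.
    by rewrite /N; field; rewrite !gt_eqF.
  rewrite ler_pM2l; last by clear -ga1; lra.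
  by rewrite lef_pV2 ?posrE//; clear -cN; lra.
have b2 : C1 be * (ln M%:R / hscale s) + C1 be * (ln m%:R / hscale s) + C1 be * (i%:R * ln 2 / hscale s)
    <= C1 be * (A + 2) * (64 * (CP R + 6)) * (s / X s ^+ 8).
  have -> : C1 be * (A + 2) * (64 * (CP R + 6)) * (s / X s ^+ 8) =
    C1 be * (((A + 2) * s ^+ 2) / hscale s).
    by rewrite (hscaleE s0); field; rewrite !gt_eqF//; clear -CP0; lra.
  rewrite -!mulrDr ler_pM2l// -!mulrDl ler_pM2r ?invr_gt0//.
  by clear -lms lMs i1' tA; lra.
rewrite /CS [leRHS]mulrDl; apply: le_trans (lerD b2 b1).
by rewrite [leRHS]addrC !addrA.
Qed.

(** A negative t is a backward shift starting from V - t, which is why [shift_back] allows its base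
    point to vary around V. *)
Lemma shift_all (A : R) : 0 < A -> large (fun s => forall al, base al -> forall t : R,
  `|t| <= A * s ^+ 2 ->
  `|ln (f al (V s - t)) - ln (f al (V s))| <= CS A * (s / X s ^+ 8)).
Proof.
move=> A0.
have := large_and (shift_back A0) (large_and (large_X (100 + 16 * A) 0) (large_X 1 2)).
apply: large_imp => s [h1 [h2 h4]] al hb t ht.
rewrite expr0 mulr1 in h2; rewrite mul1r in h4.
have X0 := X_gt0 s; have X1 := X_ge1 s; have V0 := V_gt0 s.
have X2V : X s * X s <= V s by rewrite -expr2; apply: ler_weXn2l.
have tV : A * s ^+ 2 <= V s / 16.
  apply: (@le_trans _ _ (A * X s)); first by rewrite ler_pM2l.
  by clear -h2 X2V X0 A0; nra.
move: ht; rewrite ler_norml => /andP[t1 t2].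
case: (lerP 0 t) => t0.
  by apply: h1 => //; [rewrite t0 | apply/andP; split; clear -V0; lra].
have e : V s - t - (- t) = V s by ring.
rewrite distrC -{1}e; apply: h1 => //.
  by apply/andP; split; clear -t0 t1; lra.
by apply/andP; split; clear -t0 t1 tV V0; lra.
Qed.

End ShiftAll.

(** * Radicals and the squarefree sieve *)

Section Radical.
Local Open Scope nat_scope.

Definition rad d := \prod_(p <- primes d) p.

Lemma dvdn_from_logn m n : 0 < m -> 0 < n -> (forall p, logn p m <= logn p n) -> m %| n.
Proof.
move=> m0 n0 h; apply/dvdn_partP => // p; rewrite mem_primes => /andP[pp _].
by rewrite p_part pfactor_dvdn.
Qed.

Lemma squarefreeP n : 0 < n -> reflect (forall p, logn p n <= 1) (squarefree n).
Proof.
move=> n0; apply: (iffP forallP) => [h p|h [i]/= lei].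
  rewrite leqNgt; apply/negP => l2.
  have pp : prime p by move: l2; rewrite lognE; case: prime.
  have pn : p * p %| n by rewrite mulnn pfactor_dvdn.
  have large_prime : p < n.+1.
    by rewrite ltnS; apply: leq_trans (dvdn_leq n0 pn); rewrite leq_pmulr// prime_gt0.
  by have := h (Ordinal large_prime); rewrite /= prime_gt1//= pn.
apply/implyP => i1; apply/negP => ii.
have := h (pdiv i); rewrite leqNgt -pfactor_dvdn// ?pdiv_prime//.
by rewrite (dvdn_trans _ ii)// -mulnn dvdn_mul// pdiv_dvd.
Qed.

Lemma rad_gt0 d : 0 < rad d.
Proof.
rewrite /rad big_seq; elim/big_ind: _ => // [m n m0 n0|p]; first by rewrite muln_gt0 m0.
by rewrite mem_primes => /andP[/prime_gt0].
Qed.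

Lemma logn_rad q d : logn q (rad d) = (q \in primes d) :> nat.
Proof.
rewrite /rad; have := primes_uniq d.
have : all prime (primes d) by apply/allP => p; rewrite mem_primes => /andP[].
elim: primes => [|p l IH] /=; first by rewrite big_nil logn1.
move=> /andP[pp pl] /andP[np ul].
have l0 : 0 < \prod_(j <- l) j.
  rewrite big_seq; elim/big_ind: _ => // [m n m0 n0|r /(allP pl)/prime_gt0//].
  by rewrite muln_gt0 m0.
rewrite big_cons (lognM q (prime_gt0 pp) l0) (IH pl ul) logn_prime// inE.
by case: eqP => // ->; rewrite (negPf np).
Qed.

Lemma rad_dvd_primes m n : (forall p, p \in primes m -> p \in primes n) -> rad m %| rad n.
Proof.
move=> h; apply: dvdn_from_logn; rewrite ?rad_gt0// => p; rewrite !logn_rad.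
by have := h p; case: (p \in primes m) => // ->.
Qed.

Lemma rad_dvd n : 0 < n -> rad n %| n.
Proof.
move=> n0; apply: dvdn_from_logn; rewrite ?rad_gt0// => p; rewrite logn_rad -logn_gt0.
by case: (logn p n).
Qed.

Lemma squarefree_rad n : squarefree (rad n).
Proof. by apply/squarefreeP => [|p]; rewrite ?rad_gt0// logn_rad; case: (_ \in _). Qed.

Lemma k_rad n : 0 < n -> k n = rad n.
Proof.
move=> n0; apply/eqP; rewrite eqn_leq; apply/andP; split.
  apply/bigmax_leqP => -[i /= li] /andP[idn sq]; apply: dvdn_leq; first exact: rad_gt0.
  have i0 : 0 < i by apply: dvdn_gt0 idn.
  apply: dvdn_from_logn; rewrite ?rad_gt0// => p; rewrite logn_rad -logn_gt0.
  have := squarefreeP i0 sq p; have := dvdn_leq_log p n0 idn.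
  by case: (logn p i) => [|[|]]//; case: (logn p n).
have lr : rad n < n.+1 by rewrite ltnS dvdn_leq// rad_dvd.
apply: (@leq_bigmax_cond _ _ (fun i : 'I_n.+1 => i : nat) (Ordinal lr)).
by rewrite /= rad_dvd// squarefree_rad.
Qed.

Lemma k_mul_rad d j : 0 < d -> 0 < j -> squarefree j -> coprime j d ->
  k (d * rad d * j) = rad d * j.
Proof.
move=> d0 j0 sq cp; have r0 := rad_gt0 d.
have dr0 : 0 < d * rad d by rewrite muln_gt0 d0.
have n0 : 0 < d * rad d * j by rewrite muln_gt0 dr0.
rewrite (k_rad n0); apply: eqn_from_log; first exact: rad_gt0.
  by rewrite muln_gt0 r0.
move=> q.
rewrite logn_rad lognM// logn_rad !primesM//.
have -> : (q \in primes (rad d)) = (q \in primes d) by rewrite -logn_gt0 logn_rad; case: (_ \in _).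
have := squarefreeP j0 sq q; rewrite -(logn_gt0 q j); rewrite orbb.
case qd : (q \in primes d) => /=; last by case: (logn q j) => [|[|]].
rewrite coprime_sym coprime_has_primes// in cp.
case lj : (logn q j) => [|[|]]// _; move/negP: cp; case; apply/hasP; exists q.
  by rewrite -logn_gt0 lj.
by [].
Qed.

(** The primes of n / k n are those whose square divides n, and j is the product of the others. With
    [k_mul_rad] this makes the n with n / k n = d correspond bijectively to the squarefree j coprime
    to d. *)
Lemma k_decomp n : 0 < n -> exists j, [/\ 0 < j, squarefree j, coprime j (n %/ k n),
  n = n %/ k n * rad (n %/ k n) * j & k n = rad (n %/ k n) * j].
Proof.
move=> n0; rewrite k_rad//; set d := n %/ rad n.
have rn := rad_dvd n0; have nE : n = d * rad n by rewrite divnK.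
have d0 : 0 < d by move: n0; rewrite nE muln_gt0 => /andP[].
have sub p : p \in primes d -> p \in primes n.
  by rewrite !mem_primes n0 d0/= => /andP[-> pd]; rewrite nE dvdn_mulr.
have /dvdnP[j jE] := rad_dvd_primes sub.
have j0 : 0 < j by have := rad_gt0 n; rewrite jE muln_gt0 => /andP[].
have lj q : logn q j + (q \in primes d) = (q \in primes n) :> nat.
  by rewrite -!logn_rad jE lognM// rad_gt0.
exists j; split => //.
- apply/squarefreeP => // p; have := lj p; case: (_ \in _) => /=; case: (_ \in _) => /=; lia.
- rewrite coprime_sym coprime_has_primes//; apply/hasPn => q; rewrite -logn_gt0 => q0.
  apply/negP => /= qd; have := lj q; rewrite qd; case: (_ \in _) => /=; lia.
- by rewrite -mulnA [rad d * j]mulnC -jE -nE.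
- by rewrite mulnC -jE.
Qed.

End Radical.

(** * Legendre's sieve for squarefree numbers coprime to d *)

Section Sieve.
Variable R : realType.

Definition sift (l : seq nat) n := (\sum_(1 <= j < n.+1) all (fun m => ~~ (m %| j)) l)%N.

Lemma sift_recr l n : sift l n.+1 = (sift l n + all (fun m => ~~ (m %| n.+1)) l)%N.
Proof. by rewrite /sift big_nat_recr. Qed.

(** Legendre's recursion: the survivors of [l] divisible by [m] are the m j' with j' <= n / m, and
    j' survives [l] because [m] is coprime to its members. *)
Lemma sift_cons m l n : (0 < m)%N -> all (coprime m) l ->
  sift l n = (sift (m :: l) n + sift l (n %/ m))%N.
Proof.
move=> m0 cm; elim: n => [|n IH]; first by rewrite div0n /sift !big_geq.
rewrite divnS// !sift_recr IH/=.
case dm : (m %| n.+1)%N => /=; last by rewrite add0n; lia.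
rewrite add1n sift_recr.
have -> : all (fun m0 => ~~ (m0 %| (n %/ m).+1)%N) l = all (fun m0 => ~~ (m0 %| n.+1)%N) l.
  apply: eq_in_all => q /(allP cm) cq.
  have -> : n.+1 = (m * (n %/ m).+1)%N.
    by have := divnS n m0; rewrite dm add1n => <-; rewrite mulnC divnK.
  by rewrite Gauss_dvdr// coprime_sym.
by lia.
Qed.

Lemma truncn_div (y : R) m : 0 <= y -> (0 < m)%N ->
  (Num.truncn y %/ m)%N = Num.truncn (y / m%:R).
Proof.
move=> y0 m0; have ym : 0 <= y / m%:R by rewrite divr_ge0.
have h c : (c <= Num.truncn y %/ m)%N = (c <= Num.truncn (y / m%:R))%N.
  by rewrite leq_divRL// !truncn_ge_nat// natrM ler_pdivlMr// ltr0n.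
by apply/eqP; rewrite eqn_leq -h leqnn h leqnn.
Qed.

(** Each use of [sift_cons] subtracts two counts, so the rounding error doubles with every
    modulus. *)
Lemma sift_approx l (y : R) : 0 <= y -> all (leq 1) l -> pairwise coprime l ->
  `|(sift l (Num.truncn y))%:R - y * \prod_(m <- l) (1 - m%:R^-1)| <= 2 ^+ size l.
Proof.
elim: l y => [|m l IH] y y0.
  rewrite big_nil mulr1 expr0 => _ _.
  have -> : sift [::] (Num.truncn y) = Num.truncn y.
    by rewrite /sift sum_nat_const_nat muln1 subn1.
  have /andP[h1 h2] := truncn_itv y0.
  by rewrite -[_.+1%:R]natr1 in h2; rewrite ler_norml; apply/andP; split; lra.
move=> /= /andP[m0 l0] /andP[cm pl].
have ym : 0 <= y / m%:R by rewrite divr_ge0.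
have h1 := IH y y0 l0 pl; have := IH _ ym l0 pl.
rewrite -truncn_div//; set t := Num.truncn y in h1 *.
have -> : (sift (m :: l) t)%:R = (sift l t)%:R - (sift l (t %/ m))%:R :> R.
  by rewrite (sift_cons t m0 cm) natrD addrK.
rewrite big_cons exprS.
move: h1; rewrite !ler_norml.
move: ((sift l t)%:R : R) ((sift l (t %/ m))%:R : R) (\prod_(m1 <- l) _) (2 ^+ size l : R).
move=> a b c e /andP[h1 h2] /andP[h3 h4].
have -> : y * ((1 - m%:R^-1) * c) = y * c - y / m%:R * c by ring.
by apply/andP; split; lra.
Qed.

Definition smallp d P := [seq p <- iota 0 P.+1 | prime p && ~~ (p %| d)%N].
(** Squares of primes dividing [d] are left out, which keeps the moduli pairwise coprime; those
    primes are already sifted. *)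
Definition mods d P := primes d ++ [seq (p * p)%N | p <- smallp d P].

Lemma size_smallp d P : (size (smallp d P) <= P.+1)%N.
Proof. by apply: leq_trans (size_subseq (filter_subseq _ _)) _; rewrite size_iota. Qed.

Lemma mods_coprime d P : pairwise coprime (mods d P).
Proof.
have cpr p q : prime p -> prime q -> p != q -> coprime p q.
  by move=> pp pq npq; rewrite prime_coprime// dvdn_prime2.
have pu s : all prime s -> uniq s -> pairwise coprime s.
  rewrite uniq_pairwise; apply: sub_in_pairwise => p q /= pp pq; exact: cpr.
rewrite pairwise_cat; apply/and3P; split.
- apply/allrelP => p q' hp /mapP[q]; rewrite mem_filter => /andP[/andP[pq nq] _] ->.
  rewrite mem_primes in hp; case/and3P: hp => pp d0 pd.
  have npq : p != q by apply: contraNneq nq => <-.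
  by rewrite coprimeMr andbb cpr.
- apply: pu (primes_uniq d); apply/allP => p; by rewrite mem_primes => /andP[].
rewrite pairwise_map.
have := pu (smallp d P); rewrite filter_uniq ?iota_uniq// => h.
apply: sub_pairwise (h _ isT) => [p q /= c|].
  by rewrite coprimeMl !coprimeMr c.
by apply/allP => p; rewrite mem_filter => /andP[/andP[]].
Qed.

Lemma mods_gt0 d P : all (leq 1) (mods d P).
Proof.
rewrite all_cat; apply/andP; split; apply/allP => p.
  by rewrite mem_primes => /andP[/prime_gt0].
by case/mapP => q; rewrite mem_filter => /andP[/andP[/prime_gt0 q0 _] _] ->; rewrite muln_gt0 q0.
Qed.

Definition nb_sqfree_coprime d n := (\sum_(1 <= j < n.+1) (squarefree j && coprime j d))%N.

Lemma nb_sqfree_coprime_le_sift d P n : (0 < d)%N -> (nb_sqfree_coprime d n <= sift (mods d P) n)%N.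
Proof.
move=> d0; rewrite /nb_sqfree_coprime /sift !big_nat; apply: leq_sum => j /andP[j0 _].
case sq : (squarefree j) => //=; case cp : (coprime j d) => //=.
rewrite coprime_sym coprime_has_primes// in cp.
suff -> : all (fun m => ~~ (m %| j)%N) (mods d P) by [].
rewrite all_cat; apply/andP; split; apply/allP => p.
  move=> pd; apply/negP => pj; move/negP: cp; apply.
  apply/hasP; exists p => //; move: pd; rewrite !mem_primes j0 => /andP[-> _] //=.
case/mapP => q; rewrite mem_filter => /andP[/andP[pq _] _] ->.
by rewrite mulnn pfactor_dvdn// -ltnNge ltnS; apply: squarefreeP.
Qed.

Lemma sum_dvdn m n : (0 < m)%N -> (\sum_(1 <= j < n.+1) (m %| j) = n %/ m)%N.
Proof.
move=> m0; elim: n => [|n IH]; first by rewrite big_geq// div0n.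
by rewrite big_nat_recr//= IH divnS// addnC.
Qed.

(** A survivor that is not squarefree is divisible by the square of a prime above P. *)
Lemma sift_le_nb_sqfree_coprime d P n : (0 < d)%N ->
  (sift (mods d P) n <= nb_sqfree_coprime d n + \sum_(P.+1 <= i < n.+1) n %/ (i * i))%N.
Proof.
move=> d0.
have -> : (\sum_(P.+1 <= i < n.+1) n %/ (i * i) =
   \sum_(1 <= j < n.+1) \sum_(P.+1 <= i < n.+1) (i * i %| j))%N.
  rewrite exchange_big/= [LHS]big_nat [RHS]big_nat; apply: eq_bigr => i /andP[i0 _].
  by rewrite sum_dvdn// muln_gt0 andbb; apply: leq_trans i0.
rewrite -big_split/= /sift [leqLHS]big_nat [leqRHS]big_nat; apply: leq_sum => j /andP[j0 jn].
case al : (all _ _) => //.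
have cp : coprime j d.
  rewrite coprime_sym coprime_has_primes//; apply/hasPn => p; rewrite mem_primes => /and3P[pp _ pj].
  apply/negP => /= pd; have : p \in mods d P by rewrite mem_cat pd.
  by move=> /(allP al); rewrite pj.
rewrite cp andbT; case: (boolP (squarefree j)) => //= /squarefreeP sq.
have [p p2] : exists p, (1 < logn p j)%N.
  apply: boolp.contrapT => h; apply: sq => // p; rewrite leqNgt; apply/negP => l; apply: h; by exists p.
have pp : prime p by move: p2; rewrite lognE; case: prime.
have pj : (p * p %| j)%N by rewrite mulnn pfactor_dvdn.
have pd : ~~ (p %| d)%N.
  apply/negP => pd; have : (p %| gcdn j d)%N by rewrite dvdn_gcd pd (dvdn_trans _ pj)// dvdn_mulr.
  by rewrite (eqP cp) dvdn1; apply/negP; rewrite gtn_eqF// prime_gt1.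
have pP : (P < p)%N.
  rewrite ltnNge; apply/negP => pP.
  have : (p * p)%N \in mods d P.
    rewrite mem_cat; apply/orP; right; apply: map_f.
    by rewrite mem_filter pp pd mem_iota add0n ltnS.
  by move=> /(allP al); rewrite pj.
have pn : (p < n.+1)%N.
  apply: leq_ltn_trans jn; apply: leq_trans (dvdn_leq j0 pj).
  by rewrite leq_pmulr// prime_gt0.
by rewrite (bigD1_seq p) ?iota_uniq ?mem_index_iota ?pP//= pj.
Qed.

Lemma sum_inv_sq P n : (0 < P)%N -> \sum_(P.+1 <= i < n) (i * i)%:R^-1 <= P%:R^-1 :> R.
Proof.
move=> P0; case: (leqP n P.+1) => [le|lt]; first by rewrite big_geq// invr_ge0.
rewrite -(subnKC (ltnW lt)); move: (n - _)%N => t.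
apply: (@le_trans _ _ (P%:R^-1 - (P + t)%:R^-1)); last by rewrite gerBl invr_ge0.
elim: t => [|t IH]; first by rewrite !addn0 subrr big_geq.
rewrite addnS big_nat_recr/= ?leq_addr//; apply: (le_trans (lerD IH (lexx _))).
rewrite addSn addnS; set q := (P + t)%N.
have q0 : 0 < q%:R :> R by rewrite ltr0n addn_gt0 P0.
rewrite natrM -natr1; move: (q%:R) q0 => r r0.
have -> : P%:R^-1 - (r + 1)^-1 = P%:R^-1 - r^-1 + (r * (r + 1))^-1.
  have P0' : P%:R != 0 :> R by rewrite pnatr_eq0 -lt0n.
  have r1 : r + 1 != 0 by rewrite gt_eqF//; lra.
  by field; rewrite P0' r1 gt_eqF.
by rewrite lerD2l lef_pV2 ?posrE; nra.
Qed.

(** The sieve density splits into a constant independent of d and a multiplicative function of d: a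
    prime p <= P dividing d trades its factor 1 - 1/p^2 for 1 - 1/p. As [sieve_const] depends on P
    alone, it is common to B and S. *)
Definition sieve_wt P p : R := if (p <= P)%N then (1 - p%:R^-1) / (1 - (p * p)%:R^-1) else 1 - p%:R^-1.
Definition sieve_const P : R := \prod_(0 <= p < P.+1 | prime p) (1 - (p * p)%:R^-1).

Lemma one_sub_sq_gt0 p : prime p -> 0 < 1 - (p * p)%:R^-1 :> R.
Proof.
move=> /prime_gt1 p1; rewrite subr_gt0 invf_lt1 ?ltr0n ?ltr1n ?muln_gt0 ?(ltnW p1)//.
by nia.
Qed.

Lemma prod_mods d P : (0 < d)%N ->
  \prod_(m <- mods d P) (1 - m%:R^-1) = sieve_const P * amul (sieve_wt P) d.
Proof.
move=> d0; rewrite big_cat big_map big_filter /sieve_const /amul /=.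
rewrite [X in _ = X * _](bigID (fun p => ~~ (p %| d)%N))/= mulrC -mulrA; congr (_ * _).
have -> : \prod_(0 <= p < P.+1 | prime p && ~~ ~~ (p %| d)%N) (1 - (p * p)%:R^-1) =
   \prod_(p <- primes d | (p <= P)%N) (1 - (p * p)%:R^-1) :> R.
  rewrite -big_filter -[RHS]big_filter; apply: perm_big; apply: uniq_perm.
  - by rewrite filter_uniq// iota_uniq.
  - by rewrite filter_uniq// primes_uniq.
  - move=> p; rewrite !mem_filter mem_index_iota mem_primes d0 negbK ltnS/=.
    by rewrite andbC.
rewrite [in RHS]big_mkcond/= -big_split/=; apply: eq_big_seq => p.
rewrite mem_primes => /andP[pp _]; rewrite /sieve_wt; case: ifP => _; last by rewrite mul1r.
by rewrite mulrC divfK// gt_eqF// one_sub_sq_gt0.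
Qed.

Lemma sieve_wt_bounds P p : prime p -> 1 - p%:R^-1 <= sieve_wt P p <= 1.
Proof.
move=> pp; have h := one_sub_sq_gt0 pp; have p1 : 1 < p%:R :> R by rewrite ltr1n prime_gt1.
have i0 : 0 < (p%:R : R)^-1 by rewrite invr_gt0; lra.
have i1 : (p%:R : R)^-1 < 1 by rewrite invf_lt1//; lra.
move: h; rewrite /sieve_wt natrM invfM; move: (p%:R^-1) i0 i1 => a a0 a1 h.
case: ifP => _; apply/andP; split => //; try lra.
  by rewrite ler_pdivlMr//; nra.
by rewrite ler_pdivrMr//; nra.
Qed.

(** Compared with the product of 1 - 1/n^2 over all integers n >= 2, which telescopes to values
    above 1/2. *)
Lemma sieve_const_bounds P : 2^-1 <= sieve_const P <= 1.
Proof.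
apply/andP; split; last first.
  apply: prodr_ile1 => p pp; rewrite (ltW (one_sub_sq_gt0 pp))/=.
  by rewrite gerBl invr_ge0.
case: P => [|P].
  by rewrite /sieve_const big_mkcond/= big_nat1/=; lra.
apply: (@le_trans _ _ (P.+2%:R / (2 * P.+1%:R))).
  rewrite ler_pdivlMr ?mulr_gt0 ?ltr0n// mulKf; first by rewrite ler_nat.
  by rewrite pnatr_eq0.
elim: P => [|P IH].
  by rewrite /sieve_const big_mkcond/= !big_nat_recr//= big_geq//=; lra.
have a0 : 0 < P.+1%:R :> R by rewrite ltr0n.
have e : P.+2%:R = P.+1%:R + 1 :> R by rewrite natr1.
have e' : P.+3%:R = P.+1%:R + 2 :> R by rewrite -addn2 natrD.
rewrite /sieve_const big_mkcond/= big_nat_recr//= -big_mkcond/=; case: ifP => pp.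
  rewrite -/(sieve_const _); apply: (@le_trans _ _ (P.+2%:R / (2 * P.+1%:R) * (1 - (P.+2 * P.+2)%:R^-1))); last first.
    by rewrite ler_pM2r//; apply: one_sub_sq_gt0.
  rewrite natrM e e'; move: (P.+1%:R) a0 => a a0.
  rewrite le_eqVlt; apply/orP; left; apply/eqP; field.
  by rewrite !gt_eqF//; lra.
rewrite mulr1 -/(sieve_const _); apply: le_trans IH.
rewrite e e'; move: (P.+1%:R) a0 => a a0.
rewrite ler_pdivrMr ?mulr_gt0//; last lra.
rewrite mulrAC ler_pdivlMr ?mulr_gt0//; nra.
Qed.

(** The first error is Legendre's, one factor 2 per modulus; the second bounds the multiples of
    squares of integers above P. *)
Lemma nb_sqfree_coprime_approx d P (y : R) : (0 < d)%N -> (0 < P)%N -> 0 <= y ->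
  `|(nb_sqfree_coprime d (Num.truncn y))%:R - sieve_const P * y * amul (sieve_wt P) d|
    <= 2 ^+ (omega d + P.+1) + y / P%:R.
Proof.
move=> d0 P0 y0; set n := Num.truncn y.
have := sift_approx y0 (mods_gt0 d P) (mods_coprime d P).
rewrite prod_mods// mulrCA mulrA -/n size_cat size_map.
have h1 : (nb_sqfree_coprime d n)%:R <= (sift (mods d P) n)%:R :> R by rewrite ler_nat; apply: nb_sqfree_coprime_le_sift.
have h2 : (sift (mods d P) n)%:R <= (nb_sqfree_coprime d n)%:R + y / P%:R :> R.
  apply: (@le_trans _ _ ((nb_sqfree_coprime d n)%:R + (\sum_(P.+1 <= i < n.+1) n %/ (i * i))%N%:R)).
    by rewrite -natrD ler_nat; apply: sift_le_nb_sqfree_coprime.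
  rewrite lerD2l natr_sum; apply: (@le_trans _ _ (y * \sum_(P.+1 <= i < n.+1) (i * i)%:R^-1)).
    rewrite mulr_sumr [leLHS]big_nat [leRHS]big_nat; apply: ler_sum => i /andP[i0 _].
    have ii : (0 < i * i)%N by rewrite muln_gt0 andbb; apply: leq_trans i0.
    rewrite ler_pdivlMr ?ltr0n// -natrM; apply: (@le_trans _ _ n%:R).
      by rewrite ler_nat leq_trunc_div.
    by have /andP[] := truncn_itv y0.
  by rewrite ler_wpM2l//; apply: sum_inv_sq.
have h3 : 2 ^+ (size (primes d) + size (smallp d P)) <= 2 ^+ (omega d + P.+1) :> R.
  by apply: ler_weXn2l; [lra | rewrite leq_add2l size_smallp].
move: h1 h2 h3; rewrite !ler_norml.
move: (nb_sqfree_coprime d n)%:R (sift _ n)%:R (sieve_const P * y * _) (y / _) (2 ^+ _) (2 ^+ _) => a b c e g h.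
move=> k1 k2 k3 /andP[k4 k5]; apply/andP; split; lra.
Qed.

(** The al p of the overview. It depends on x through P, hence the uniformity in [al] of all earlier
    estimates. *)
Definition level_al P p : R := sieve_wt P p / p%:R.



(** The smallest product arises for consecutive integers, where it telescopes. With c = 1 the sieve
    density of d is at least 1 / (omega d + 1). *)
Lemma path_prod_lb c l : (0 < c)%N -> path ltn c l ->
  c%:R / (c + size l)%:R <= \prod_(p <- l) (1 - p%:R^-1) :> R.
Proof.
elim: l c => [|p l IH] c c0 /=.
  by rewrite addn0 big_nil divff// pnatr_eq0 -lt0n.
move=> /andP[cp pl]; have p0 : (0 < p)%N by apply: leq_trans cp.
have := IH p p0 pl; rewrite big_cons.
have cR : 0 < c%:R :> R by rewrite ltr0n.
have cpR : c%:R + 1 <= p%:R :> R by rewrite natr1 ler_nat.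
have s0 : 0 <= (size l)%:R :> R by [].
rewrite addnS -[_.+1%:R]natr1 !natrD.
move: (\prod_(_ <- _) _) (size l)%:R s0 => x t t0.
move: (p%:R) (c%:R) cR cpR => q a a0 aq h.
apply: (@le_trans _ _ ((1 - q^-1) * (q / (q + t)))); last first.
  rewrite ler_wpM2l// subr_ge0 invf_le1; lra.
have -> : (1 - q^-1) * (q / (q + t)) = (q - 1) / (q + t) by field; rewrite !gt_eqF; lra.
rewrite ler_pdivlMr; last lra.
rewrite mulrAC ler_pdivrMr; last lra.
nra.
Qed.

Lemma amul_sieve_wt_lb P d : ((omega d).+1%:R)^-1 <= amul (sieve_wt P) d.
Proof.
have := @path_prod_lb 1 (primes d) isT; rewrite mul1r add1n -/(omega d) => h.
apply: le_trans (_ : \prod_(p <- primes d) (1 - p%:R^-1) <= _).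
  apply: h; have := sorted_primes d; case e : (primes d) => [//|p l] /= ->; rewrite andbT.
  have : p \in primes d by rewrite e mem_head.
  by rewrite mem_primes => /andP[/prime_gt1].
rewrite /amul [leLHS]big_seq [leRHS]big_seq; apply: ler_prod => p; rewrite mem_primes => /andP[pp _].
have /andP[-> _] := sieve_wt_bounds P pp; rewrite andbT subr_ge0 invf_le1 ?ltr0n ?prime_gt0// ler1n prime_gt0//.
Qed.

Lemma sieve_wt_ge0 P p : 0 <= sieve_wt P p.
Proof.
have i n : 0 <= 1 - n%:R^-1 :> R.
  by rewrite subr_ge0; case: n => [|n]; rewrite ?invr0// invf_le1 ?ltr0n// ler1n.
by rewrite /sieve_wt; case: ifP => _; rewrite ?divr_ge0.
Qed.

Lemma level_al_base P : base (level_al P).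
Proof.
split=> [p|p pp].
  split; first by rewrite divr_ge0// sieve_wt_ge0.
  by move=> pp; have /andP[_ h] := sieve_wt_bounds P pp; rewrite /level_al ler_piMl// invr_ge0.
have /andP[h _] := sieve_wt_bounds P pp; rewrite /nondeg /level_al invfM ler_pM2r ?invr_gt0 ?ltr0n ?prime_gt0//.
apply: le_trans h; have : (p%:R : R)^-1 <= 2^-1.
  by rewrite lef_pV2 ?posrE ?ltr0n ?prime_gt0// ler_nat prime_gt1.
lra.
Qed.

Lemma amul_level_al P d : amul (level_al P) d = amul (sieve_wt P) d * amul (iv R) d.
Proof. by rewrite /amul -big_split. Qed.

Lemma amul_ivE d : amul (iv R) d = (rad d)%:R^-1.
Proof. by rewrite /rad natr_prod -prodfV. Qed.

Lemma amul_iv_le P d : amul (iv R) d <= (omega d).+1%:R * amul (level_al P) d.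
Proof.
have h := amul_sieve_wt_lb P d; rewrite amul_level_al mulrA ler_peMl//.
  by rewrite amul_ivE invr_ge0.
by rewrite -ler_pdivrMl ?ltr0n// mulr1.
Qed.

End Sieve.

(** * The count as a sum over d = n / k n *)

Section Count.
Variable R : realType.
Variables (th x z : R).
Hypothesis th0 : 0 < th < 1.
Hypotheses (x1 : 1 <= x) (z0 : 0 < z).

Definition beta : R := th / (1 - th).
(** The value of ln d at which the bounds x / d and (z d^theta)^(1 / (1 - theta)) for k n coincide;
    their common value is [G], and [Y d] is their minimum. *)
Definition vshift : R := (1 - th) * ln x - ln z.
Definition G : R := z * expR (th * ln x).
Definition cond n : bool := (k n)%:R <= z * expR (th * ln n%:R).
Definition nb_small_rad : nat := (\sum_(1 <= n < (Num.truncn x).+1) cond n)%N.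
Definition Y d : R := G * K beta (ln d%:R - vshift).

Lemma G_gt0 : 0 < G. Proof. by rewrite mulr_gt0 ?expR_gt0. Qed.

Lemma Y_gt0 d : 0 < Y d. Proof. by rewrite mulr_gt0 ?G_gt0 ?K_gt0. Qed.

Lemma ln_Y d : ln (Y d) = Num.min (ln x - ln d%:R) ((ln z + th * ln d%:R) / (1 - th)).
Proof.
have /andP[t0 t1] := th0.
rewrite /Y lnM ?posrE ?G_gt0 ?K_gt0// /G lnM ?posrE ?expR_gt0// expRK /K expRK.
have e1 : ln x - ln d%:R = ln z + th * ln x - (ln d%:R - vshift) by rewrite /vshift; ring.
have e2 : (ln z + th * ln d%:R) / (1 - th) = ln z + th * ln x - (- beta * (ln d%:R - vshift)).
  by rewrite /beta /vshift; field; rewrite gt_eqF//; lra.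
rewrite e1 e2; move: (ln z + th * ln x) (ln d%:R - vshift) => a b.
move: (- beta * b) => c; rewrite minElt maxElt; case: ltP => h1; case: ltP => h2 //; lra.
Qed.

Lemma le_Y d q : (0 < d)%N -> (0 < q)%N ->
  (q%:R <= Y d) = ((d * q)%:R <= x) && (q%:R <= z * expR (th * ln (d * q)%:R)).
Proof.
move=> d0 q0; have /andP[t0 t1] := th0.
have q0R : 0 < q%:R :> R by rewrite ltr0n.
have dq0 : 0 < (d * q)%:R :> R by rewrite ltr0n muln_gt0 d0.
rewrite -[LHS]ler_ln ?posrE ?Y_gt0// ln_Y le_min; congr (_ && _).
  by rewrite -[RHS]ler_ln ?posrE//; [rewrite ln_natM// lerBrDl | have := x1; lra].
rewrite -[RHS]ler_ln ?posrE ?mulr_gt0 ?expR_gt0// lnM ?posrE ?expR_gt0// expRK ln_natM//.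
rewrite ler_pdivlMr ?subr_gt0//; apply/idP/idP; lra.
Qed.

(** Group the integers m by d = m / k m and write k m = rad d * j. Both constraints together say rad
    d * j <= Y d, by [le_Y]; any n above x may be taken, as larger d contribute nothing. *)
Lemma nb_small_radE n : (Num.truncn x < n)%N ->
  nb_small_rad = (\sum_(1 <= d < n) nb_sqfree_coprime d (Num.truncn (Y d / (rad d)%:R)))%N.
Proof.
set M := Num.truncn x => Mn.
have x0 : 0 <= x by have := x1; lra.
have kd m : (0 < m)%N -> (k m %| m)%N by move=> m0; rewrite k_rad// rad_dvd.
have -> : nb_small_rad = (\sum_(1 <= d < n) \sum_(1 <= m < M.+1 | m %/ k m == d) cond m)%N.
  rewrite /nb_small_rad; under [RHS]eq_bigr do rewrite big_mkcond.
  rewrite exchange_big/= [LHS]big_nat [RHS]big_nat; apply: eq_bigr => m /andP[m0 mM].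
  rewrite (bigD1_seq (m %/ k m)%N) ?iota_uniq//=; last first.
    have k0 : (0 < k m)%N by rewrite k_rad// rad_gt0.
    rewrite mem_index_iota (divn_gt0 _ k0) (dvdn_leq m0 (kd m m0))/=.
    by apply: leq_ltn_trans (leq_div _ _) _; apply: leq_trans mM _.
  rewrite eqxx big1 ?addn0// => d; by rewrite eq_sym => /negPf ->.
rewrite [LHS]big_nat [RHS]big_nat; apply: eq_bigr => d /andP[d0 _].
set J := Num.truncn _; rewrite /nb_sqfree_coprime.
have toc (P Q : pred nat) a b : (\sum_(a <= i < b | P i) Q i = size [seq i <- index_iota a b | P i && Q i])%N.
  by rewrite size_filter -sum1_count big_mkcondr/=; apply: eq_bigr => i _; case: (Q i).
rewrite toc (toc xpredT) /=.
have c0 : (0 < d * rad d)%N by rewrite muln_gt0 d0 rad_gt0.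
rewrite -[RHS](size_map (muln (d * rad d))); apply: perm_size; apply: uniq_perm.
- by rewrite filter_uniq// iota_uniq.
- rewrite map_inj_uniq ?filter_uniq ?iota_uniq// => a b /eqP.
  by rewrite eqn_pmul2l// => /eqP.
have r0 : 0 < (rad d)%:R :> R by rewrite ltr0n rad_gt0.
have JE j : (0 < j)%N -> (j <= J)%N = ((d * (rad d * j))%N%:R <= x) &&
    ((rad d * j)%N%:R <= z * expR (th * ln (d * (rad d * j))%N%:R)).
  move=> j0; rewrite -le_Y ?muln_gt0 ?rad_gt0// /J truncn_ge_nat; last first.
    by rewrite divr_ge0 ?ltW ?Y_gt0.
  by rewrite ler_pdivlMr// mulrC -natrM.
move=> m; apply/idP/mapP.
  rewrite mem_filter mem_index_iota ltnS => /andP[/andP[/eqP md cm] /andP[m0 mM]].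
  have [j [j0 sq cp mE kE]] := k_decomp m0; rewrite md in cp mE kE.
  exists j => //; rewrite mem_filter sq cp mem_index_iota j0 ltnS JE// mulnA -mE -kE.
  by rewrite -truncn_ge_nat// mM.
case=> j; rewrite mem_filter mem_index_iota ltnS => /andP[/andP[sq cp] /andP[j0]].
rewrite JE// => /andP[h1 h2] ->.
have kE := k_mul_rad d0 j0 sq cp.
rewrite mem_filter mem_index_iota ltnS truncn_ge_nat// /cond kE -!mulnA h1 h2 andbT/=.
by rewrite mulnK ?muln_gt0 ?rad_gt0 ?j0// eqxx d0.
Qed.

End Count.

(** * The count as a kernel sum *)

Section Main.
Variable R : realType.
Variable th : R.
Hypothesis th0 : 0 < th < 1.
Implicit Types (s x z : R).
Local Notation be := (beta th).
Local Notation f := (f be).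
Local Notation K := (K be).
Local Notation term := (term be).

Lemma be_gt0 : 0 < be.
Proof. by have /andP[t0 t1] := th0; rewrite divr_gt0// subr_gt0. Qed.

Lemma base_regular s al : base al -> regular s al.
Proof.
move=> hb; have rE : rms al [::] = al by apply: boolp.funext => q.
apply: regular2_regular; rewrite -rE; apply: (@regular2_rms R s al [::] 0%N) => //.
Qed.

(** For good d the radical is much smaller than [Y d], so that the sieve range Y d / rad d is
    long. *)
Lemma ln_rad_le s (ep : R) d : 0 <= L s -> (0 < d)%N -> (omega d)%:R <= Om s -> ln (d`_(large_prime s))%:R <= ep * V s ->
  ln (rad d)%:R <= Om s * L s + ep * V s.
Proof.
move=> L0 d0 h1 h2.
have -> : ln (rad d)%:R = \sum_(p <- primes d) ln p%:R :> R.
  have : all prime (primes d) by apply/allP => p; rewrite mem_primes => /andP[].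
  rewrite /rad; elim: primes => [|p l IH] /=; first by rewrite !big_nil ln1.
  move=> /andP[pp pl].
  have l0 : (0 < \prod_(j <- l) j)%N.
    rewrite big_seq; elim/big_ind: _ => // [m n m0 n0|r /(allP pl)/prime_gt0//].
    by rewrite muln_gt0 m0.
  by rewrite !big_cons -IH// (ln_natM _ (prime_gt0 pp) l0).
apply: (@le_trans _ _ (\sum_(p <- primes d) (L s + (if p \in large_prime s then (logn p d)%:R * ln p%:R else 0)))).
  rewrite [leLHS]big_seq [leRHS]big_seq; apply: ler_sum => p pd.
  have l0 := ln_nat_ge0 R p.
  case: ifPn; rewrite inE/= => hp; last by rewrite addr0 leNgt.
  apply: (@le_trans _ _ ((logn p d)%:R * ln p%:R)); last by rewrite lerDr.
  by rewrite ler_peMl// ler1n logn_gt0.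
rewrite big_split/= -[X in _ + X]big_mkcond/= sum_logn_ln_part//.
apply: lerD => //; rewrite big_const_seq count_predT iter_addr_0 -mulr_natl.
by rewrite ler_wpM2r.
Qed.

(** Both the count and its main term lie between 0 and W; this trivial bound is used where d is not
    good. *)
Lemma nb_sqfree_coprime_dist_le d P (W : R) : 0 <= W -> (0 < d)%N ->
  `|(nb_sqfree_coprime d (Num.truncn W))%:R - sieve_const R P * W * amul (sieve_wt R P) d| <= W.
Proof.
move=> W0 d0; have /andP[c0 c1] := sieve_const_bounds R P.
have h1 : (nb_sqfree_coprime d (Num.truncn W))%:R <= W.
  have /andP[h _] := truncn_itv W0; apply: le_trans h.
  rewrite ler_nat /nb_sqfree_coprime; apply: (@leq_trans (\sum_(1 <= j < (Num.truncn W).+1) 1)%N).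
    by apply: leq_sum => j _; case: (_ && _).
  by rewrite sum_nat_const_nat muln1 subn1.
have a0 : 0 <= amul (sieve_wt R P) d by apply: amul_ge0 => p; apply: sieve_wt_ge0.
have a1 : amul (sieve_wt R P) d <= 1.
  rewrite /amul big_seq; apply: prodr_ile1 => p; rewrite mem_primes => /andP[pp _].
  by rewrite sieve_wt_ge0; have /andP[] := sieve_wt_bounds R P pp.
have m0 : 0 <= sieve_const R P * W * amul (sieve_wt R P) d by apply: mulr_ge0 => //; apply: mulr_ge0 => //; lra.
have m1 : sieve_const R P * W * amul (sieve_wt R P) d <= W.
  rewrite -[leRHS]mulr1; apply: ler_pM => //; first by apply: mulr_ge0 => //; lra.
  by rewrite -[leRHS]mul1r; apply: ler_wpM2r.
have s0 : 0 <= (nb_sqfree_coprime d (Num.truncn W))%:R :> R by [].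
by rewrite ler_norml; apply/andP; split; lra.
Qed.

(** This is 1 / N = sqrt (ln V / V), the target precision. *)
Definition eta s : R := s / X s ^+ 8.
(** The choice makes the kernel at least e^(- be V / 8) on good d. Similarly be / 8 in [sieve_level]
    keeps 2^P far below the sieve range, at least e^(be V / 2), while 1 / P is still O(1 / V). *)
Definition eps0 : R := Num.min 4^-1 (be / (8 * ga be)).
Definition sieve_level s := Num.truncn (be / 8 * V s).
Definition sieve_al s : nat -> R := level_al R (sieve_level s).

Lemma Om_le_eta s : 1 <= s -> Om s + 1 <= (CP R + 7) * (eta s * V s).
Proof.
move=> s1; have X0 := X_gt0 s; have X1 := X_ge1 s; have CP0 := CP_gt0 R.
have s0 : 0 < s by lra.
have -> : eta s * V s = s * X s ^+ 8 by rewrite /eta /V; field; rewrite gt_eqF.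
have -> : (CP R + 7) * (s * X s ^+ 8) = (CP R + 6) * (s * X s ^+ 8) + s * X s ^+ 8 by ring.
apply: lerD; last by apply: mulr_ege1 => //; rewrite exprn_ege1.
rewrite /Om ler_pM2l; last by clear -CP0; lra.
rewrite /N ler_pdivrMr// mulrAC ler_peMl ?exprn_ge0 ?(ltW X0)//.
by apply: mulr_ege1.
Qed.

Lemma ep_bounds : [/\ 0 < eps0, eps0 <= 4^-1 & ga be * eps0 <= be / 8].
Proof.
have b0 := be_gt0; have g1 := ga_gt1 b0; rewrite /eps0; split.
- by rewrite lt_min; apply/andP; split; [lra|rewrite divr_gt0// mulr_gt0//; lra].
- by rewrite ge_min lexx.
apply: (@le_trans _ _ (ga be * (be / (8 * ga be)))).
  by rewrite ler_pM2l; [rewrite ge_min lexx orbT | lra].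
by rewrite le_eqVlt; apply/orP; left; apply/eqP; field; rewrite gt_eqF//; lra.
Qed.

(** Both sieve errors are O(W / V), where W = Y d / rad d. The main term may be smaller than W by a
    factor omega d + 1 <= Om + 1 = O(eta V), whence a relative error O(eta). *)
Lemma good_term (A : R) : 0 < A -> large (fun s => forall x z d, 1 <= x -> (1 - th) * ln x = V s ->
  0 < z -> `|ln z| <= A * s ^+ 2 -> (0 < d)%N -> good s eps0 (vshift th x z) d ->
  `|(nb_sqfree_coprime d (Num.truncn (Y th x z d / (rad d)%:R)))%:R - sieve_const R (sieve_level s) * (G th x z * term (sieve_al s) (vshift th x z) d)|
   <= 20 / be * (CP R + 7) * eta s * (G th x z * term (sieve_al s) (vshift th x z) d)).
Proof.
move=> A0; have b0 := be_gt0; have g1 := ga_gt1 b0; have CP0 := CP_gt0 R.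
have [e0 e1 e2] := ep_bounds.
have := large_and (large_X (8 * A / be) 0) (large_and (large_X 1 2) (large_and (large_X (8 * (CP R + 7) / be) 0)
  (large_and (large_X (16 / be) 0) (large_ge 1)))).
apply: large_imp => s [k1 [k2 [k3 [k4 s1]]]] x z d x1 xV z0 lz d0 /and3P[g_1 g_2 g_3].
rewrite expr0 mulr1 in k1; rewrite mul1r in k2; rewrite expr0 mulr1 in k3; rewrite expr0 mulr1 in k4.
have X0 := X_gt0 s; have X1 := X_ge1 s; have V0 := V_gt0 s.
have s0 : 0 < s by clear -s1; lra.
have X2V : X s * X s <= V s by rewrite -expr2; apply: ler_weXn2l.
have zV : A * s ^+ 2 <= be * V s / 8.
  rewrite ler_pdivrMr// in k1.
  apply: (@le_trans _ _ (A * X s)); first by rewrite ler_pM2l.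
  rewrite ler_pdivlMr//; apply: (@le_trans _ _ (X s * be * X s)).
    by rewrite mulrAC [A * 8]mulrC ler_pM2r.
  by rewrite mulrAC mulrC ler_pM2l.
have L0 : 0 < L s by rewrite exprn_gt0.
have L1 : 1 <= L s by rewrite exprn_ege1.
have OL : (Om s + 1) * L s <= be * V s / 8.
  apply: (@le_trans _ _ ((CP R + 7) * X s ^+ 12)).
    have -> : (CP R + 7) * X s ^+ 12 = ((CP R + 6) * X s ^+ 8 + X s ^+ 8) * L s by rewrite /L; ring.
    rewrite ler_pM2r//; apply: lerD; last by rewrite exprn_ege1.
    rewrite /Om ler_pM2l; last by clear -CP0; lra.
    by rewrite /N ler_pdivrMr// ler_peMr// exprn_ge0// ltW.
  rewrite ler_pdivrMr// in k3.
  have -> : be * V s / 8 = (X s * be) * X s ^+ 15 / 8 by rewrite /V; ring.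
  rewrite ler_pdivlMr//; apply: (@le_trans _ _ (X s * be * X s ^+ 12)).
    rewrite mulrAC ler_pM2r ?exprn_gt0// mulrC; exact: k3.
  apply: ler_wpM2l; first by apply: mulr_ge0; exact: ltW.
  exact: ler_weXn2l.
have Om0 := Om_gt0 s0.
have O1 : Om s + 1 <= be * V s / 8.
  by apply: le_trans OL; rewrite ler_peMr//; clear -Om0; lra.
have bV : 16 <= be * V s.
  rewrite ler_pdivrMr// in k4; rewrite mulrC; apply: (le_trans k4); rewrite ler_pM2r//.
  by apply: le_trans X2V; rewrite ler_peMl// ltW.
set P := sieve_level s; set v := vshift th x z.
have /andP[P1 P2] : P%:R <= be / 8 * V s < P.+1%:R.
  by apply: truncn_itv; apply: mulr_ge0; [clear -b0; lra | exact: ltW].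
rewrite -[P.+1%:R]natr1 in P2.
have Pr : be * V s / 16 <= P%:R by clear -P2 bV; lra.
have P0 : (0 < P)%N by rewrite -(ltr0n R); clear -Pr bV; lra.
set r := (rad d)%:R : R; have r0 : 0 < r by rewrite ltr0n rad_gt0.
set W := Y th x z d / r.
have W0 : 0 < W by rewrite divr_gt0// Y_gt0.
have WE : W = G th x z * K (ln d%:R - v) * amul (iv R) d by rewrite amul_ivE.
have GT : G th x z * term (sieve_al s) v d = W * amul (sieve_wt R P) d.
  by rewrite WE /term /sieve_al amul_level_al; ring.
(* Of the size th ln x = be V, the factor z and the kernel each lose at most be V / 8, and rad d at
   most be V / 4. *)
have lW : be * V s / 2 <= ln W.
  have Y0 := Y_gt0 th x z0 d; have G0 := G_gt0 th x z0.
  have ez := expR_gt0 (th * ln x); have K0 := K_gt0 be (ln d%:R - v).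
  rewrite /W ln_div ?posrE//.
  have -> : ln (Y th x z d) = ln z + th * ln x + ln (K (ln d%:R - v)).
    by rewrite /Y lnM ?posrE// /G lnM ?posrE// expRK.
  have -> : th * ln x = be * V s.
    by rewrite -xV /beta; field; rewrite gt_eqF//; have /andP[_ t1] := th0; clear -t1; lra.
  have := ln_rad_le (ltW L0) d0 g_2 g_3; rewrite -/r => lr.
  have lK : - (be * V s / 8) <= ln (K (ln d%:R - v)).
    apply: (@le_trans _ _ (ln (expR (- (ga be * `|ln d%:R - v|))))); last first.
      by rewrite ler_ln ?posrE ?expR_gt0 ?K_gt0//; apply: K_ge.
    rewrite expRK lerN2; apply: (@le_trans _ _ (ga be * (eps0 * V s))).
      by rewrite ler_pM2l//; clear -g1; lra.
    by rewrite mulrA; apply: le_trans (ler_wpM2r (ltW V0) e2) _; clear; lra.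
  have eV : eps0 * V s <= be * V s / 8.
    rewrite mulrAC ler_pM2r//; apply: le_trans e2; rewrite ler_peMl//; exact: ltW.
  move: lz; rewrite ler_norml => /andP[lz _].
  have OL' : Om s * L s <= be * V s / 8.
    by apply: le_trans OL; rewrite ler_pM2r//; clear; lra.
  clear -lz zV lK eV OL' lr.
  move: (be * V s) (eps0 * V s) (Om s * L s) (A * s ^+ 2) (ln z) (ln r) (ln (K _)) lz zV lK eV OL' lr => *; lra.
have two : 2 ^+ (omega d + P.+1) <= 4 / (be * V s) * W.
  have e2' : 2 <= expR 1 :> R by have := expR_ge1Dx (1 : R); rewrite -[1 + 1]/2.
  apply: (@le_trans _ _ (expR 1 ^+ (omega d + P.+1))); first by rewrite lerXn2r ?nnegrE ?expR_ge0.
  rewrite -expRM_natl mulr1 natrD -[P.+1%:R]natr1.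
  apply: (@le_trans _ _ (expR (- (be * V s / 4)) * W)); last first.
    rewrite ler_pM2r// expRN -[4 / _]invf_div lef_pV2 ?posrE ?expR_gt0//; last by clear -bV; lra.
    by apply: le_trans (expR_ge1Dx _); rewrite lerDr.
  rewrite -{1}[W]lnK ?posrE// -expRD ler_expR.
  by clear -g_2 O1 P1 lW; lra.
have := nb_sqfree_coprime_approx d0 P0 (ltW W0); rewrite -/(W) => h.
rewrite GT mulrA; apply: (le_trans h).
have WP : W / P%:R <= 16 / (be * V s) * W.
  rewrite mulrC ler_pM2r// -[16 / _]invf_div lef_pV2 ?posrE//; first by rewrite ltr0n.
  by clear -bV; lra.
have etaV := Om_le_eta s1.
have wl := amul_sieve_wt_lb R P d.
have Wd : W <= (Om s + 1) * (W * amul (sieve_wt R P) d).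
  rewrite mulrCA ler_peMr ?(ltW W0)//.
  apply: (@le_trans _ _ ((omega d).+1%:R * amul (sieve_wt R P) d)).
    by rewrite -ler_pdivrMl ?ltr0n// mulr1.
  apply: ler_wpM2r; first by apply: amul_ge0 => p; apply: sieve_wt_ge0.
  by rewrite -[_.+1%:R]natr1 lerD2r.
apply: (@le_trans _ _ (20 / (be * V s) * W)).
  have -> : 20 / (be * V s) * W = 4 / (be * V s) * W + 16 / (be * V s) * W.
    by field; rewrite !gt_eqF.
  exact: lerD.
have -> : 20 / be * (CP R + 7) * eta s * (W * amul (sieve_wt R P) d) =
   20 / (be * V s) * (((CP R + 7) * (eta s * V s)) * (W * amul (sieve_wt R P) d)).
  by field; rewrite !gt_eqF.
rewrite ler_pM2l; last by rewrite divr_gt0// mulr_gt0.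
apply: (le_trans Wd); apply: ler_wpM2r => //.
apply: mulr_ge0; first exact: ltW.
by apply: amul_ge0 => p; apply: sieve_wt_ge0.
Qed.

(** One summand for each class of d: good, atypical, and with a heavy part made of large primes.
    [CQ] appears since the atypical bound e^(- N) is absolute and f >= 1 / CQ. *)
Definition C3 : R := 20 / be * (CP R + 7) + CQ be + (CP R + 7).

Lemma C3_gt0 : 0 < C3.
Proof.
have b0 := be_gt0; have CP0 := CP_gt0 R; have Q1 := CQ_ge1 b0.
have : 0 < 20 / be * (CP R + 7) by apply: mulr_gt0; [apply: divr_gt0 | lra].
by rewrite /C3; lra.
Qed.

(** Good d use the sieve and the others the trivial bound W. In the large-prime class the passage
    from the weights 1/p to [al] costs omega d + 1 <= Om + 1, which the saving X^(-32) more than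
    absorbs. *)
Lemma nb_small_rad_approx (A : R) : 0 < A -> large (fun s => forall x z, 1 <= x -> (1 - th) * ln x = V s ->
  0 < z -> `|ln z| <= A * s ^+ 2 ->
  `|(nb_small_rad th x z)%:R - sieve_const R (sieve_level s) * (G th x z * f (sieve_al s) (vshift th x z))|
   <= C3 * eta s * (G th x z * f (sieve_al s) (vshift th x z))).
Proof.
move=> A0; have b0 := be_gt0; have CP0 := CP_gt0 R; have Q1 := CQ_ge1 b0.
have [e0 e1 e2] := ep_bounds.
have he : 0 < eps0 <= 4^-1 by rewrite e0.
have := large_and (good_term A0) (large_and (sum_atypical_le b0 e0) (large_and (sum_large_part_le b0 he)
  (large_and (large_X (2 * A) 2) (large_ge 1)))).
apply: large_imp => s [h1 [h2 [h3 [h4 s1]]]] x z x1 xV z0 lz.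
have X0 := X_gt0 s; have X1 := X_ge1 s; have V0 := V_gt0 s.
have s0 : 0 < s by clear -s1; lra.
have XV : X s <= V s by apply: ler_eXnr.
have N0 := N_gt0 s0; have Om0 := Om_gt0 s0.
set v := vshift th x z; set P := sieve_level s; set al := sieve_al s; set g := G th x z.
have g0 : 0 < g by apply: G_gt0.
have hb : base al := level_al_base R P.
have hc := base_regular s hb; have had := hb.1.
have vE : v = V s - ln z by rewrite -xV.
have lz' := lz; rewrite ler_norml in lz'; case/andP: lz' => z1 z2.
have zV : A * s ^+ 2 <= V s / 2 by clear -h4 XV; lra.
have v1 : V s / 2 <= v by rewrite vE; clear -z2 zV; lra.
have v2 : v <= 2 * V s by rewrite vE; clear -z1 zV V0; lra.
have v4 : v <= 4 * V s by clear -v2 V0; lra.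
have v0 : 0 <= v by clear -v1 V0; lra.
have F0 := f_gt0 b0 v had; set F := f al v in F0 *.
pose p01 d := (eps0 * V s < `|ln d%:R - v|) || (Om s < (omega d)%:R).
pose p2 d := (`|ln d%:R - v| <= eps0 * V s) && (eps0 * V s < ln (d`_(large_prime s))%:R).
pose q d : R := (nb_sqfree_coprime d (Num.truncn (Y th x z d / (rad d)%:R)))%:R.
pose c1 := 20 / be * (CP R + 7) * eta s.
have et0 : 0 < eta s by rewrite divr_gt0// exprn_gt0.
have c10 : 0 <= c1.
  by apply: mulr_ge0; [apply: mulr_ge0; [apply: divr_ge0; [|exact: ltW] | clear -CP0; lra] | exact: ltW].
have pt d : (0 < d)%N -> `|q d - sieve_const R P * (g * term al v d)| <=
   g * (c1 * term al v d + (if p01 d then expR (omega d)%:R * amul (iv R) d * K (ln d%:R - v) else 0)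
     + (Om s + 1) * (if p2 d then term al v d else 0)).
  move=> d0; have t0 := term_ge0 be v d had.
  have K0 := K_gt0 be (ln d%:R - v).
  have i0 : 0 <= amul (iv R) d by rewrite amul_ivE invr_ge0.
  have a01 : 0 <= (if p01 d then expR (omega d)%:R * amul (iv R) d * K (ln d%:R - v) else 0).
    by case: ifP => // _; apply: mulr_ge0; [apply: mulr_ge0 => //; exact: expR_ge0 | exact: ltW].
  have a2 : 0 <= (Om s + 1) * (if p2 d then term al v d else 0).
    by apply: mulr_ge0; [clear -Om0; lra | case: ifP].
  have [gd|] := boolP (good s eps0 v d).
    apply: (le_trans (h1 x z d x1 xV z0 lz d0 gd)); rewrite -/v -/al -/g -/c1 mulrCA.
    rewrite ler_pM2l//; clear -a01 a2; lra.
  move=> ng.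
  have W0 : 0 <= Y th x z d / (rad d)%:R by rewrite divr_ge0// ltW// Y_gt0.
  have := nb_sqfree_coprime_dist_le P W0 d0.
  have WE : Y th x z d / (rad d)%:R = g * (amul (iv R) d * K (ln d%:R - v)).
    by rewrite /Y amul_ivE mulrAC mulrA.
  have -> : sieve_const R P * (Y th x z d / (rad d)%:R) * amul (sieve_wt R P) d = sieve_const R P * (g * term al v d).
    by rewrite WE /term /al /sieve_al amul_level_al; ring.
  move=> h; apply: (le_trans h); rewrite WE ler_pM2l//.
  have c1t : 0 <= c1 * term al v d by apply: mulr_ge0.
  have [p|np] := boolP (p01 d).
    rewrite p in a01; apply: (@le_trans _ _ (expR (omega d)%:R * amul (iv R) d * K (ln d%:R - v))).
      rewrite -mulrA ler_peMl//; first by apply: mulr_ge0 => //; exact: ltW.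
      by apply: le_trans (expR_ge1Dx _); rewrite lerDl.
    by clear -c1t a2; lra.
  have p2d : p2 d.
    move: np ng; rewrite /p01 /p2 /good negb_or -!leNgt => /andP[-> ->] /=.
    by rewrite -ltNge.
  rewrite p2d addr0; apply: (@le_trans _ _ ((Om s + 1) * term al v d)); last first.
    by clear -c1t; lra.
  rewrite /term mulrA ler_pM2r//; apply: (le_trans (amul_iv_le R P d)).
  apply: ler_wpM2r; first by apply: amul_ge0; exact: adm_ge0.
  move: np; rewrite /p01 negb_or -!leNgt => /andP[_ o].
  by rewrite -[_.+1%:R]natr1 lerD2r.
have NE : N s = (eta s)^-1 by rewrite /N /eta invf_div.
have eN : expR (- N s) <= eta s.
  rewrite expRN -[eta s]invrK lef_pV2 ?posrE ?expR_gt0 ?invr_gt0// -NE.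
  by apply: le_trans (expR_ge1Dx _); rewrite lerDr.
have F1 : 1 <= CQ be * F.
  have := f_lb b0 had (_ : small_nondeg al) v0; case: hc => _ sn _ /(_ sn).
  by rewrite -[_^-1]mulr1 ler_pdivrMl//; clear -Q1; lra.
have etaV := Om_le_eta s1.
have O32 : (Om s + 1) * (X s ^+ 32)^-1 <= (CP R + 7) * eta s.
  rewrite ler_pdivrMr ?exprn_gt0//; apply: (le_trans etaV); rewrite mulrA ler_pM2l.
    by apply: ler_weXn2l.
  by apply: mulr_gt0 => //; clear -CP0; lra.
have sum n : \sum_(1 <= d < n) `|q d - sieve_const R P * (g * term al v d)| <= C3 * eta s * (g * F).
  apply: (@le_trans _ _ (g * (c1 * F + expR (- N s) + (Om s + 1) * ((X s ^+ 32)^-1 * F)))); last first.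
    have CE : C3 * eta s * F = c1 * F + CQ be * eta s * F + (CP R + 7) * eta s * F.
      by rewrite /C3 /c1; ring.
    rewrite [leRHS]mulrCA ler_pM2l// CE; apply: lerD; first apply: lerD => //.
      apply: (le_trans eN); rewrite mulrAC ler_peMl//; exact: ltW.
    by rewrite mulrA ler_pM2r.
  apply: (@le_trans _ _ (\sum_(1 <= d < n) g * (c1 * term al v d +
      (if p01 d then expR (omega d)%:R * amul (iv R) d * K (ln d%:R - v) else 0)
     + (Om s + 1) * (if p2 d then term al v d else 0)))).
    by rewrite [leLHS]big_nat [leRHS]big_nat; apply: ler_sum => d /andP[d0 _]; apply: pt.
  rewrite -mulr_sumr ler_pM2l// !big_split/= -!mulr_sumr -!big_mkcond/=.
  apply: lerD; first apply: lerD.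
  - apply: ler_wpM2l => //; exact: psum_le_tot (summable_term b0 v had).
  - exact: h2.
  - apply: ler_wpM2l; first by clear -Om0; lra.
    by apply: h3 => //; rewrite v1.
have BE n : (Num.truncn x < n)%N -> `|(nb_small_rad th x z)%:R - sieve_const R P * (g * psum (term al v) n)| <= C3 * eta s * (g * F).
  move=> xn; apply: le_trans (sum n); rewrite (nb_small_radE th0 x1 z0 xn) natr_sum /psum !mulr_sumr -sumrB.
  exact: ler_norm_sum.
set E := C3 * eta s * (g * F) in BE *.
have c0 : 0 < sieve_const R P by have /andP[c _] := sieve_const_bounds R P; clear -c; lra.
have pF n : psum (term al v) n <= F by apply: psum_le_tot; exact: summable_term.
have cg : 0 < sieve_const R P * g by rewrite mulr_gt0.
rewrite ler_norml; apply/andP; split.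
  rewrite lerBrDl -lerBrDr opprK addrC -[leRHS]addrC.
  suff : sieve_const R P * (g * F) <= (nb_small_rad th x z)%:R + E by clear; lra.
  (* The count equals its finite sum for every truncation above x, so enlarging n to exceed x lets
     the partial sums approach f without changing the count. *)
  rewrite mulrA -ler_pdivlMl//; apply: tot_le => n; rewrite ler_pdivlMl//.
  have := BE (maxn n (Num.truncn x).+1) (leq_maxr _ _).
  rewrite ler_norml => /andP[h _].
  have := ler_psum (w := term al v) (fun d => term_ge0 be v d had) (leq_maxl n (Num.truncn x).+1).
  move/(ler_wpM2l (ltW cg)) => k; apply: (le_trans k).
  by rewrite -mulrA; rewrite lerBrDr addrC lerBlDr in h.
have := BE _ (ltnSn _); rewrite ler_norml => /andP[_ h].
apply: le_trans h; rewrite lerD2l lerN2.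
apply: ler_wpM2l; first exact: ltW.
apply: ler_wpM2l; first exact: ltW.
exact: pF.
Qed.

(** Both quantities are compared with z c g F; since c - e1 >= 1/4, the size g F is at most 4 S,
    which turns 3 e1 + e2 into 12 e1 + 4 e2. *)
Lemma ratio_combine (b S z g c Fv F e1 e2 : R) : 0 < z -> 0 < g -> 0 < F -> 2^-1 <= c <= 1 ->
  0 <= e1 <= 4^-1 -> 0 <= e2 <= 1 ->
  `|b - c * (z * g * Fv)| <= e1 * (z * g * Fv) -> `|S - c * (g * F)| <= e1 * (g * F) ->
  `|Fv - F| <= e2 * F -> `|b - z * S| <= (12 * e1 + 4 * e2) * z * S.
Proof.
move=> z0 g0 F0 /andP[c1 c2] /andP[e10 e11] /andP[e20 e21].
rewrite ler_norml => /andP[h1 h2]; rewrite ler_norml => /andP[h3 h4].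
rewrite ler_norml => /andP[h5 h6].
set T := g * F in h3 h4; have T0 : 0 < T by rewrite mulr_gt0.
have ST : T <= 4 * S.
  have k1 : 2^-1 * T <= c * T by rewrite ler_pM2r.
  have k2 : e1 * T <= 4^-1 * T by rewrite ler_pM2r.
  by clear -h3 k1 k2; lra.
set U := g * Fv.
have uE : z * g * Fv = z * U by rewrite mulrA.
rewrite uE in h1 h2.
have k5 : U <= T + e2 * T.
  have := ler_wpM2l (ltW g0) h6; rewrite mulrBr -/U -/T mulrCA -/T; clear; lra.
have k6 : T - e2 * T <= U.
  have := ler_wpM2l (ltW g0) h5; rewrite mulrN mulrBr -/U -/T mulrCA -/T; clear; lra.
have eT : 0 <= e2 * T by rewrite mulr_ge0// ltW.
have eT1 : e2 * T <= T by rewrite ler_piMl// ltW.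
have U0 : 0 <= U by clear -k6 eT1; lra.
have dU : `|c * U - c * T| <= e2 * T.
  rewrite -mulrBr normrM ger0_norm; last by clear -c1; lra.
  apply: (@le_trans _ _ `|U - T|); first by rewrite ler_piMl.
  by rewrite ler_norml; apply/andP; split; clear -k5 k6; lra.
move: dU; rewrite ler_norml => /andP[k7 k8].
have eU : e1 * U <= 2 * (e1 * T).
  have u2 : U <= 2 * T by clear -k5 eT1; lra.
  by have := ler_wpM2l e10 u2; rewrite [leRHS]mulrCA.
have b1 : `|b - z * S| <= z * ((3 * e1 + e2) * T).
  have zz w w' : w <= w' -> z * w <= z * w' by rewrite ler_pM2l.
  have zT := zz _ _ h3; have zT' := zz _ _ h4; have z7 := zz _ _ k7; have z8 := zz _ _ k8.
  have zU := zz _ _ eU.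
  rewrite ler_norml; apply/andP; split; clear -zT zT' z7 z8 zU h1 h2; lra.
apply: (le_trans b1).
have -> : (12 * e1 + 4 * e2) * z * S = z * ((3 * e1 + e2) * (4 * S)) by ring.
rewrite ler_pM2l//; apply: ler_wpM2l => //; clear -e10 e20; lra.
Qed.

Definition CF (A : R) : R := 12 * C3 + 8 * CS be A.

Lemma CS_gt0 (A : R) : 0 < A -> 0 < CS be A.
Proof.
move=> A0; have b0 := be_gt0; have CP0 := CP_gt0 R; have C10 := C1_gt0 b0; have ga1 := ga_gt1 b0.
have /andP[c00 c01] := c0_bnd b0.
rewrite /CS; apply: addr_gt0.
  by apply: mulr_gt0; [apply: mulr_gt0 => //; lra | lra].
by apply: divr_gt0 => //; lra.
Qed.

(** The approximation is applied at z and at 1 with the same x, hence the same s, weights and sieve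
    constant: the main terms differ only by the factor z and by the shift ln z in the argument of
    f. *)
Lemma nb_small_rad_shift (A : R) : 0 < A -> large (fun s => forall x z, 1 <= x -> (1 - th) * ln x = V s ->
  0 < z -> `|ln z| <= A * s ^+ 2 ->
  `|(nb_small_rad th x z)%:R - z * (nb_small_rad th x 1)%:R| <= CF A * z * (nb_small_rad th x 1)%:R * eta s).
Proof.
move=> A0; have b0 := be_gt0; have C30 := C3_gt0; have CS0 := CS_gt0 A0.
have := large_and (nb_small_rad_approx A0) (large_and (shift_all b0 A0) (large_and
  (large_X (4 * C3) 1) (large_and (large_X (4 * CS be A) 1) (large_ge 1)))).
apply: large_imp => s [h1 [h2 [h3 [h4 s1]]]] x z x1 xV z0 lz.
rewrite expr1 in h3; rewrite expr1 in h4.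
have X0 := X_gt0 s; have X1 := X_ge1 s.
have s0 : 0 < s by clear -s1; lra.
have X8 : X s <= X s ^+ 8 by apply: ler_eXnr.
have X80 : 0 < X s ^+ 8 by rewrite exprn_gt0.
have et0 : 0 < eta s by rewrite divr_gt0.
have e3 : C3 * eta s <= 4^-1.
  rewrite /eta mulrA ler_pdivrMr//; clear -h3 X8; lra.
have e4 : CS be A * eta s <= 4^-1.
  rewrite /eta mulrA ler_pdivrMr//; clear -h4 X8; lra.
have hb : base (sieve_al s) := level_al_base R (sieve_level s).
set al := sieve_al s in hb *.
have p1 := f_gt0 b0 (V s) hb.1; have p2 := f_gt0 b0 (V s - ln z) hb.1.
have hz := h1 x z x1 xV z0 lz.
have l1 : `|ln (1 : R)| <= A * s ^+ 2 by rewrite ln1 normr0; apply: mulr_ge0; rewrite ?exprn_ge0// ltW.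
have h11 := h1 x 1 x1 xV ltr01 l1.
have vz : vshift th x z = V s - ln z by rewrite -xV.
have v1 : vshift th x 1 = V s by rewrite -xV /vshift ln1 subr0.
rewrite vz in hz; rewrite v1 in h11.
have sh := ratio_of_ln p1 p2 (h2 al hb (ln z) lz).
rewrite -/(eta s) in sh.
set e2 := expR (CS be A * eta s) - 1 in sh.
have ce0 : 0 < CS be A * eta s by rewrite mulr_gt0.
have e20 : 0 <= e2 by rewrite /e2 subr_ge0; apply: le_trans (expR_ge1Dx _); rewrite lerDl ltW.
have ee : expR (CS be A * eta s) <= 2.
  have := expR_ge1Dx (- (CS be A * eta s)); rewrite expRN => k.
  have k' : 2^-1 <= (expR (CS be A * eta s))^-1 by clear -k e4; lra.
  by rewrite lef_pV2 ?posrE ?expR_gt0// in k'.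
have e21 : e2 <= 2 * (CS be A * eta s).
  apply: (le_trans (expRB1_le (ltW ce0))); rewrite mulrC ler_pM2r//.
have gE : G th x z = z * expR (th * ln x) by [].
have g1E : G th x 1 = expR (th * ln x) by rewrite /G mul1r.
rewrite gE in hz; rewrite g1E in h11.
have c12 := sieve_const_bounds R (sieve_level s).
have r1 : 0 <= C3 * eta s <= 4^-1 by rewrite e3 andbT; apply: mulr_ge0; exact: ltW.
have r2 : 0 <= e2 <= 1 by rewrite e20/=; clear -e21 e4; lra.
have := ratio_combine z0 (expR_gt0 (th * ln x)) p1 c12 r1 r2 hz h11 sh.
move=> k; apply: (le_trans k).
have -> : CF A * z * (nb_small_rad th x 1)%:R * eta s =
   (12 * (C3 * eta s) + 4 * (2 * (CS be A * eta s))) * z * (nb_small_rad th x 1)%:R by rewrite /CF; ring.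
apply: ler_wpM2r => //; apply: ler_wpM2r; first exact: ltW.
by rewrite lerD2l ler_pM2l.
Qed.

Lemma eta_sqrt s x : 0 < s -> (1 - th) * ln x = V s -> 0 < ln (ln x) ->
  eta s <= Num.sqrt (1 - th)^-1 * Num.sqrt (ln (ln x) / ln x).
Proof.
have /andP[t0 t1] := th0 => s0 xV l0.
have V0 := V_gt0 s; have h0 : 0 < 1 - th by lra.
have lx : 0 < ln x by rewrite -(pmulr_rgt0 _ h0) xV.
have X0 := X_gt0 s.
rewrite -sqrtrM; last by rewrite invr_ge0 ltW.
have e0 : 0 <= eta s by rewrite divr_ge0 ?exprn_ge0// ltW.
rewrite -[leLHS]ger0_norm// -sqrtr_sqr ler_wsqrtr//.
have -> : eta s ^+ 2 = s ^+ 2 / V s by rewrite /eta /V; field; rewrite gt_eqF.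
have VE : (V s)^-1 = (1 - th)^-1 / ln x by rewrite -xV invfM.
rewrite VE mulrCA ler_pM2l ?invr_gt0// ler_pM2r ?invr_gt0//.
by rewrite -lnV_ ler_ln ?posrE// -xV ler_piMl// ?ltW//; lra.
Qed.

End Main.

(** * Return from the scale s to x *)

Lemma nb_small_rad_asymp (R : realType) (th A : R) : 0 < th < 1 -> 0 < A ->
  exists x0 C : R, [/\ 1 <= x0, 0 < C & forall x z : R, x0 <= x -> 0 < z ->
    `|ln z| <= A * ln (ln x) ->
    `|(nb_small_rad th x z)%:R - z * (nb_small_rad th x 1)%:R| <=
      C * z * (nb_small_rad th x 1)%:R * Num.sqrt (ln (ln x) / ln x)].
Proof.
move=> th0 A0; have /andP[t0 t1] := th0; have h0 : 0 < 1 - th by lra.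
have A20 : 0 < 2 * A by lra.
have [s0 hs0] := nb_small_rad_shift th0 A20.
(* As s^2 = ln (1 - th) + ln (ln x), the bound s >= - ln (1 - th) together with s <= s^2 gives ln
   (ln x) <= 2 s^2; hence the constant 2 A above. *)
pose s1 := Num.max 1 (Num.max s0 (- ln (1 - th))).
have s11 : 1 <= s1 by rewrite /s1 le_max lexx.
have s10 : s0 <= s1 by rewrite /s1 !le_max lexx orbT.
have s1l : - ln (1 - th) <= s1 by rewrite /s1 !le_max lexx !orbT.
have b0 := be_gt0 th0; have C30 := C3_gt0 th0; have CS0 := CS_gt0 th0 A20.
have CF0 : 0 < CF th (2 * A) by rewrite /CF; lra.
have q0 : 0 < Num.sqrt (1 - th)^-1 by rewrite sqrtr_gt0 invr_gt0.
exists (expR (expR (s1 ^+ 2) / (1 - th))), (CF th (2 * A) * Num.sqrt (1 - th)^-1); split.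
- apply: le_trans (expR_ge1Dx _); rewrite lerDl.
  by apply: divr_ge0; [exact: expR_ge0 | exact: ltW].
- by rewrite mulr_gt0.
move=> x z x0 z0 lz.
have xp : 0 < x by apply: lt_le_trans x0; exact: expR_gt0.
have lx : expR (s1 ^+ 2) / (1 - th) <= ln x.
  by rewrite -[leLHS]expRK ler_ln ?posrE ?expR_gt0.
have Vx : expR (s1 ^+ 2) <= (1 - th) * ln x by rewrite mulrC -ler_pdivrMr.
set v := (1 - th) * ln x in Vx.
have v0 : 0 < v by apply: lt_le_trans Vx; exact: expR_gt0.
have lv : s1 ^+ 2 <= ln v by rewrite -[leLHS]expRK ler_ln ?posrE ?expR_gt0.
have lv0 : 0 <= ln v by apply: le_trans lv; exact: sqr_ge0.
pose s := Num.sqrt (ln v).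
have s2 : s ^+ 2 = ln v by rewrite sqr_sqrtr.
have s1s : s1 <= s.
  rewrite -[leLHS]ger0_norm; last by lra.
  by rewrite -sqrtr_sqr ler_wsqrtr.
have Vs : (1 - th) * ln x = V s by rewrite V_expR s2 lnK// posrE.
have x1 : 1 <= x.
  apply: le_trans x0; apply: le_trans (expR_ge1Dx _); rewrite lerDl.
  by apply: divr_ge0; [exact: expR_ge0 | exact: ltW].
have lx0 : 0 < ln x by rewrite -(pmulr_rgt0 _ h0).
have sE : s ^+ 2 = ln (1 - th) + ln (ln x) by rewrite s2 lnM ?posrE.
have ss : s <= s ^+ 2 by rewrite expr2 ler_peMr//; lra.
have lls : ln (ln x) <= 2 * s ^+ 2 by lra.
have ll0 : 0 < ln (ln x).
  have : ln (1 - th) <= 0 by apply: ln_le0; lra.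
  lra.
have lz2 : `|ln z| <= 2 * A * s ^+ 2.
  by apply: (le_trans lz); rewrite [2 * A]mulrC -mulrA ler_pM2l.
have := hs0 s (le_trans s10 s1s) x z x1 Vs z0 lz2 => k.
apply: (le_trans k).
have sp : 0 < s by lra.
have := eta_sqrt th0 sp Vs ll0 => e.
rewrite -[leRHS]mulrA.
have -> : CF th (2 * A) * Num.sqrt (1 - th)^-1 * z * ((nb_small_rad th x 1)%:R * Num.sqrt (ln (ln x) / ln x))
  = CF th (2 * A) * z * (nb_small_rad th x 1)%:R * (Num.sqrt (1 - th)^-1 * Num.sqrt (ln (ln x) / ln x)) by ring.
apply: ler_wpM2l => //; apply: mulr_ge0 => //; apply: mulr_ge0; exact: ltW.
Qed.

(* Transfer to the real numbers and the counts of the statement *)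
From Stdlib Require Import Reals ZArith.
From mathcomp Require Import Rstruct Rstruct_topology.

Lemma Int_part_truncn (x : Rdefinitions.R) : 0 <= x -> Z.to_nat (Int_part x) = Num.truncn x.
Proof.
move=> x0; symmetry; apply: truncn_def.
have [h1 h2] := base_Int_part x.
have i0 : Z.le 0 (Int_part x).
  have {}x0 : Rle (IZR 0) x by apply/RleP.
  have : Rlt (IZR (-1)) (IZR (Int_part x)) by Lra.lra.
  by move/lt_IZR; clear; Lia.lia.
have e : (Z.to_nat (Int_part x))%:R = IZR (Int_part x).
  by rewrite -INRE INR_IZR_INZ Z2Nat.id.
apply/andP; split; first by rewrite e; apply/RleP.
by rewrite -natr1 e; apply/RltP; rewrite -[_ + 1]/(Rplus _ _) -[1]/R1; Lra.lra.
Qed.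

Lemma B_nb_small_rad (th x z : Rdefinitions.R) : 1 <= x -> B th x z = nb_small_rad th x z.
Proof.
move=> x1; rewrite /B /count_upto Int_part_truncn; last exact: le_trans ler01 x1.
rewrite /nb_small_rad -sum1_count big_mkcond/= /index_iota subn1/=.
apply: eq_bigr => n _.
rewrite /cond /Defs.Rleb !INRE /Rpower RlnE RexpE.
by case: Rle_dec => h /=; [move/RleP: h | move/RleP/negPf: h] => ->.
Qed.

Lemma S_nb_small_rad (th x : Rdefinitions.R) : 1 <= x -> S th x = nb_small_rad th x 1.
Proof.
move=> x1; rewrite -B_nb_small_rad// /B /S; apply: eq_count => m.
by rewrite Rmult_1_l.
Qed.

Open Scope R_scope.

Theorem theorem4 (theta A : R) :
  0 < theta < 1 -> 0 < A ->
  exists x0 C : R, 0 < C /\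
    forall x z : R, x0 <= x -> 0 < z ->
      Rabs (ln z) <= A * ln (ln x) ->
      Rabs (INR (B theta x z) - z * INR (S theta x))
        <= C * z * INR (S theta x) * sqrt (ln (ln x) / ln x).
Proof.
move=> [/RltP t0 /RltP t1] /RltP A0.
have [x0 [C [x01 C0 h]]] := nb_small_rad_asymp (introT andP (conj t0 t1)) A0.
exists x0, C; split; first exact/RltP.
move=> x z /RleP xx /RltP z0 /RleP lz.
have x1 := le_trans x01 xx.
rewrite B_nb_small_rad// S_nb_small_rad// !INRE RsqrtE RabsE !RlnE.
apply/RleP; apply: h => //.
by move: lz; rewrite RabsE !RlnE.
Qed.
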